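(* Let $Z_1,Z_2,\ldots$ be independent real random variables with a common cumulative distribution function $V$, with $E(Z_n)=0$ and $E(Z_n^2)=\sigma^2>0$. Suppose that (A) there is $A>0$ such that $\int_{-\infty}^{\infty}e^{hy}\,dV(y)$ converges for all real $|h|<A$; and (B) in the decomposition $V=\beta U_1+(1-\beta)U_2$ of $V$ into its absolutely continuous part $U_1$ and singular part $U_2$ (see context) one has $\beta>0$. Let $F_n(x)=\mathrm{Prob}(Z_1+\cdots+Z_n\le \sigma x\sqrt n)$, and let $\lambda(z)=c_0+c_1z+c_2z^2+\cdots$ be the function defined in the context, with $c_0=\frac{\gamma_3}{6\sigma^3}$, $c_1=\frac{\sigma^2\gamma_4-3\gamma_3^2}{24\sigma^6}$. Below $x=x_n$ denotes real numbers possibly depending on $n$, and all asymptotic relations are as $n\to\infty$. (1) If $x>1$ and $x=o(\sqrt n)$, then $$\frac{1-F_n(x)}{1-\Phi(x)}=e^{\frac{x^3}{\sqrt n}\lambda\left(\frac{x}{\sqrt n}\right)}\left[1+O\left(\frac{x}{\sqrt n}\right)\right],\qquad \frac{F_n(-x)}{\Phi(-x)}=e^{-\frac{x^3}{\sqrt n}\lambda\left(-\frac{x}{\sqrt n}\right)}\left[1+O\left(\frac{x}{\sqrt n}\right)\right].$$ (2) If $x>1$ and $x=O(n^{1/6})$, then $$\frac{1-F_n(x)}{1-\Phi(x)}=e^{\frac{c_0x^3}{\sqrt n}}+O\left(\frac{x}{\sqrt n}\right),\qquad \frac{F_n(-x)}{\Phi(-x)}=e^{-\frac{c_0x^3}{\sqrt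 n}}+O\left(\frac{x}{\sqrt n}\right).$$ (3) If $x>0$ and $x=O(n^{1/6})$, then $$1-F_n(x)=[1-\Phi(x)]e^{\frac{c_0x^3}{\sqrt n}}+O\left(\frac{1}{\sqrt n}e^{-\frac{x^2}{2}}\right),\qquad F_n(-x)=\Phi(-x)e^{-\frac{c_0x^3}{\sqrt n}}+O\left(\frac{1}{\sqrt n}e^{-\frac{x^2}{2}}\right).$$ (4) If $c>0$ is a constant, $x\to\infty$ and $x=o(\sqrt n)$, then the two expressions $$\frac{F_n\left(x+\frac cx\right)-F_n(x)}{1-F_n(x)}\qquad\text{and}\qquad\frac{\Phi\left(x+\frac cx\right)-\Phi(x)}{1-\Phi(x)}$$ converge to the same limit, namely $1-e^{-c}$.
   Context: $\Phi(x)=\frac{1}{\sqrt{2\pi}}\int_{-\infty}^x e^{-t^2/2}\,dt$. Decomposition of $V$: every cumulative distribution function $V$ can be written in the form $V(x)=\beta U_1(x)+(1-\beta)U_2(x)$ with a uniquely determined $0\le\beta\le1$, where $U_1,U_2$ are cumulative distribution functions, $U_1$ is absolutely continuous, $U_1(x)=\int_{-\infty}^xU_1'(y)\,dy$, and $U_2'(x)=0$ for almost every $x$. For real $h$ with $|h|<A$ put $R=R(h)=\int_{-\infty}^\infty e^{hy}\,dV(y)$. The cumulants $\gamma_\nu$ of $V$ are defined by $\log R(h)=\sum_{\nu\ge 2}\frac{\gamma_\nu}{\nu!}h^\nu$ for small $|h|$ (here $\gamma_1=0$, $\gamma_2=\sigma^2$). Put $\bar m=\bar m(h)=\frac{d}{dh}\log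 R(h)$. For every real $z$ of sufficiently small modulus, the equation $\sigma z=\bar m(h)$ has a unique real root $h=h(z)$ near $0$; it has the same sign as $z$ and tends to $0$ with $z$. The function $\lambda$ is defined for small $|z|$ by $$z^3\lambda(z)=\frac{\bar m^2}{2\sigma^2}-h\bar m+\log R,$$ where $h=h(z)$, $\bar m=\bar m(h(z))=\sigma z$ and $R=R(h(z))$; it admits a power series expansion $\lambda(z)=c_0+c_1z+c_2z^2+\cdots$ convergent for all $z$ of sufficiently small modulus. *)

(* Defs.v *)
(* MathComp-Analysis, over an arbitrary R : realType. *)
From HB Require Import structures.
From mathcomp Require Import all_boot all_order all_algebra.
From mathcomp Require Import all_classical all_reals all_analysis.

Set Implicit Arguments.
Unset Strict Implicit.
Unset Printing Implicit Defensive.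

Import Order.TTheory GRing.Theory Num.Theory.
Import numFieldNormedType.Exports.

Local Open Scope classical_set_scope.
Local Open Scope ring_scope.

Section distribution_functions.
Context {R : realType}.
Local Notation mu := (@lebesgue_measure R).
Implicit Types V U : cumulativeBounded (0 : R) (1 : R).

Definition Phi (x : R) : R :=
  (Num.sqrt (2 * pi))^-1 * \int[mu]_(t in `]-oo, x]) expR (- t ^+ 2 / 2).

(* At the (null set of) points where U is not derivable, derive1 U has a
   conventional value, which does not affect the integral. *)
Definition abs_continuous_cdf U : Prop :=
  {ae mu, forall y, derivable (U : R -> R) (y : R) 1} /\
  forall x, ((U x)%:E = \int[mu]_(y in `]-oo, x]) (derive1 U y)%:E)%E.

Definition singular_cdf U : Prop :=
  {ae mu, forall y, is_derive (y : R) 1 (U : R -> R) 0}.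

Definition cdf_decomposition V (beta : R) U1 U2 : Prop :=
  [/\ 0 <= beta <= 1,
      forall x, V x = beta * U1 x + (1 - beta) * U2 x,
      abs_continuous_cdf U1 &
      singular_cdf U2].

Definition exp_integrable V (h : R) : Prop :=
  (lebesgue_stieltjes_measure V).-integrable setT
    (fun y : R => (expR (h * y))%:E).

Definition mgf V (h : R) : R :=
  fine (\int[lebesgue_stieltjes_measure V]_y (expR (h * y))%:E)%E.

Definition cgf V (h : R) : R := ln (mgf V h).

Definition tilted_mean V (h : R) : R := derive1 (cgf V) h.

(* The values gamma 0 and gamma 1 play no role: for a centred V the
   expansion of cgf V starts at order 2. *)
Definition cumulants V (gamma : nat -> R) : Prop :=
  \forall h \near (0 : R),
    (\sum_(2 <= k < n) gamma k / k`!%:R * h ^+ k) @[n --> \oo] --> cgf V h.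

(* Only the germ of hz at 0 is constrained. It is determined by the two
   conditions when V is centred with variance sigma ^+ 2 > 0 and has
   exponential moments, since tilted_mean V is then strictly increasing
   around 0. *)
Definition saddlepoint V (sigma : R) (hz : R -> R) : Prop :=
  hz z @[z --> (0 : R)] --> (0 : R) /\
  \forall z \near (0 : R), sigma * z = tilted_mean V (hz z).

(* At z = 0 the equation is void; the value lambda 0 is fixed by the
   power series expansion. *)
Definition cramer_function V (sigma : R) (hz lambda : R -> R) : Prop :=
  \forall z \near (0 : R),
    z ^+ 3 * lambda z =
      tilted_mean V (hz z) ^+ 2 / (2 * sigma ^+ 2)
      - hz z * tilted_mean V (hz z) + cgf V (hz z).

Definition power_series_at0 (c : nat -> R) (f : R -> R) : Prop :=
  \forall z \near (0 : R), pseries c z @ \oo --> f z.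

End distribution_functions.

Section random_variables.
Context d (T : measurableType d) (R : realType) (P : probability T R).

Definition mutually_independent (Z : nat -> {RV P >-> R}) : Prop :=
  forall (s : seq nat) (B : nat -> set R), uniq s ->
    (forall i, i \in s -> measurable (B i)) ->
    P (\bigcap_(i in [set` s]) (Z i @^-1` B i)) =
      (\prod_(i <- s) P (Z i @^-1` B i))%E.

(* Z is indexed from 0, so Z 0, ..., Z n.-1 are the first n variables. *)
Definition normalized_sum_cdf (Z : nat -> {RV P >-> R}) (sigma : R) (n : nat)
    (x : R) : R :=
  fine (P [set w | \sum_(i < n) Z i w <= sigma * x * Num.sqrt n%:R]).

End random_variables.

(* Main.v *)
Require Import Defs.
From HB Require Import structures.
From mathcomp Require Import all_boot all_order all_algebra.
From mathcomp Require Import all_classical all_reals all_analysis.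
From mathcomp Require Import measurable_realfun zify ring lra.

(* Cramer's change of measure: weighting V by e^{hy} / R(h) with h = h(z),
   z = x / sqrt n, moves the mean of the sum to the threshold sigma x sqrt n, so
   that the upper tail probability is (R e^{-h m})^n E[e^{-h a s}; s >= 0], where
   a is the tilted standard deviation and s the standardised tilted sum.  A
   Berry-Esseen bound that is uniform for h near 0 replaces the law of s by the
   normal one up to O(1 / sqrt n), and for the normal law the expectation is the
   Mills ratio e^{b^2/2} (1 - Phi b) with b = h a sqrt n.  Its derivative is at
   most 1 / (1 + b^2) in modulus and b = x + O(h^2 sqrt n), so b may be replaced
   by x.  As (R e^{-h m})^n = e^{n z^3 lambda(z)} e^{-x^2/2}, this gives
     |tail - e^{n z^3 lambda(z)} (1 - Phi x)| <= C / sqrt n e^{-x^2/2} e^{n z^3 lambda(z)}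
   for 0 <= x <= delta sqrt n, from which all four statements follow; the lower
   tail is the same with z, h and a negative.
   The Berry-Esseen bound is obtained from Stein's equation for logistic
   smoothings of steps, by induction on n.
   The law of the sum is handled through the operator (avg F)(s) = E[F(s + X)],
   whose n-th iterate at 0 is the expectation of F at the n-fold sum. *)

Set Implicit Arguments.
Unset Strict Implicit.
Unset Printing Implicit Defensive.

Import Order.TTheory GRing.Theory Num.Theory.
Import numFieldNormedType.Exports.

Local Open Scope classical_set_scope.
Local Open Scope ring_scope.

(** * The normal distribution and Stein's equation *)

(** The obstacle in Stein's method is that the test functions are steps: the derivative of the Stein
    solution inherits the jump, so the remainder has the size of the probability that a sum of n - 1
    terms falls in a window of bounded width. The induction hypothesis controls exactly that.
    Logistic steps close the loop: their modulus of continuity is a multiple of the difference of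
    two steps one width apart, with a factor e^{|s|/width} that the exponential moments absorb; a
    large enough width halves the fed-back constant. Only a bound on exponential moments of the
    standardised summand enters, whence the uniformity in h. The weight e^{-as} on s >= 0 is no
    step, but it is a monotone function, hence a mixture of half-line indicators, minus one such
    indicator; so the half-line bound transfers with a factor 2, whatever a. Relative errors come
    from the lower Mills bound, which trades e^{-x^2/2} for x (1 - Phi x). In (2) and (3), n z^3
    lambda(z) is replaced by its cubic term because lambda is Lipschitz near 0. In (4), with z and w
    the old and new arguments over sqrt n, the shift satisfies n (w - z) z = c, so the exponent
    moves by O(z) only. *)

Section gaussian.
Context {R : realType}.
Local Notation mu := (@lebesgue_measure R).
Implicit Types (x y : R).

Definition gd x : R := (Num.sqrt (2 * pi))^-1 * expR (- x ^+ 2 / 2).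

Lemma gd_normal_pdf : gd = normal_pdf 0 1.
Proof.
apply/funext => x; rewrite normal_pdfE ?oner_eq0// /gd /normal_peak /normal_fun.
by rewrite subr0 !expr1n mul1r mulr_natl.
Qed.

Lemma gd_gt0 x : 0 < gd x.
Proof. by rewrite mulr_gt0 ?expR_gt0// invr_gt0 sqrtr_gt0 mulr_gt0// pi_gt0. Qed.

Lemma gd_ge0 x : 0 <= gd x. Proof. exact/ltW/gd_gt0. Qed.

Lemma gdN x : gd (- x) = gd x. Proof. by rewrite /gd sqrrN. Qed.

Lemma is_derive_gd x : is_derive x 1 gd (- x * gd x).
Proof.
rewrite /gd.
have d1 : is_derive x 1 (fun y : R => - y ^+ 2 / 2) (- x).
  by apply: is_derive_eq; rewrite /GRing.scale/=; field.
have d2 := @is_derive1_comp R expR (fun y : R => - y ^+ 2 / 2) _ _ _ (is_derive_expR _) d1.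
apply: is_derive_eq; rewrite /GRing.scale/=; ring.
Qed.

Lemma continuous_of_is_derive (f df : R -> R) :
  (forall x, is_derive x 1 f (df x)) -> continuous f.
Proof.
move=> fdf x; apply: differentiable_continuous; apply/derivable1_diffP.
by have := fdf x; case.
Qed.

Lemma continuous_gd : continuous gd.
Proof. exact: (continuous_of_is_derive is_derive_gd). Qed.

Lemma gd_le1 x : gd x <= 1.
Proof.
rewrite /gd -[leRHS]mulr1 ler_pM//.
- rewrite invf_le1 ?sqrtr_gt0 ?mulr_gt0 ?pi_gt0//.
  rewrite -[leLHS]sqrtr1 ler_sqrt ?mulr_ge0 ?pi_ge0//.
  have := @pi_ge2 R; lra.
- by rewrite -[leRHS]expR0 ler_expR; have := sqr_ge0 x; lra.

Qed.

Lemma integrable_gd : mu.-integrable setT (EFin \o gd).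
Proof. rewrite gd_normal_pdf; exact: integrable_normal_pdf. Qed.

Lemma Rintegral_gd : \int[mu]_x gd x = 1.
Proof. by rewrite /Rintegral gd_normal_pdf integral_normal_pdf. Qed.

Lemma integrable_gdM (g : R -> R) (C : R) : measurable_fun setT g ->
  (forall x, `|g x| <= C) -> mu.-integrable setT (EFin \o (fun x => g x * gd x)).
Proof.
move=> mg gC.
have C0 : 0 <= C by exact: le_trans (gC 0).
apply: (@le_integrable _ _ _ mu _ _ _ (EFin \o (fun x => C * gd x))) => //.
- apply/measurable_EFinP/measurable_funM => //.
  exact: continuous_measurable_fun continuous_gd.
- move=> x _ /=; rewrite lee_fin !normrM (ger0_norm C0).
  by apply: ler_wpM2r => //.
- exact: (integrableZl measurableT _ integrable_gd).
Qed.

Lemma PhiE x : Phi x = \int[mu]_(t in `]-oo, x]) gd t.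
Proof.
rewrite /Phi /gd RintegralZl//.
have : mu.-integrable `]-oo, x] (EFin \o gd).
  by apply: integrableS integrable_gd.
move=> /(@integrableZl _ _ _ mu _ (measurable_itv _) (Num.sqrt (2 * pi)) (EFin \o gd)).
apply: eq_integrable => //.
move=> t _ /=; rewrite -EFinM mulrA divff ?mul1r//.
by rewrite gt_eqF// sqrtr_gt0 mulr_gt0 ?pi_gt0.
Qed.

Lemma is_derive_FTC1Ny (f : R -> R) x : continuous f ->
  mu.-integrable setT (EFin \o f) ->
  is_derive x 1 (fun y => \int[mu]_(t in `]-oo, y]) f t) (f x).
Proof.
move=> cf intf.
have xu : x < x + 1 by rewrite ltrDl.
have [] := @continuous_FTC1 R f -oo%O x (x + 1) xu _ _ (cf x).
- by apply: integrableS intf => //.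
- by rewrite ltNyr.
- by move=> D <-; rewrite derive1E; apply: derivableP.
Qed.

Lemma is_derive_Phi x : is_derive x 1 Phi (gd x).
Proof.
rewrite (_ : Phi = fun y => \int[mu]_(t in `]-oo, y]) gd t).
  exact: is_derive_FTC1Ny continuous_gd integrable_gd.
by apply/funext => y; rewrite PhiE.
Qed.

Lemma le_of_derive (f df : R -> R) (a b : R) : a <= b ->
  (forall x, a <= x <= b -> is_derive x 1 f (df x)) ->
  (forall x, a <= x <= b -> 0 <= df x) -> f a <= f b.
Proof.
move=> ab fdf df0; rewrite -subr_ge0.
have [|x|] := @MVT_segment R f df a b ab.
- by move=> x; rewrite in_itv/= => /andP[ax xb]; apply: fdf; rewrite !ltW.
- apply: derivable_within_continuous => y; rewrite in_itv/= => xab.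
  by have := fdf _ xab; case.
- move=> x; rewrite in_itv/= => xab ->; rewrite mulr_ge0 ?subr_ge0//; exact: df0.
Qed.

(** As a random variable under the standard normal law, the identity has cdf [Phi]; the limits of
    [Phi] at both infinities are then those of a cdf. *)
Let idTR : measurableTypeR R -> R := idfun.

#[local] HB.instance Definition _ :=
  @isMeasurableFun.Build _ _ _ _ idTR (@measurable_id _ _ setT).

Lemma Phi_cdf : cdf (idTR : {RV (@normal_prob R 0 1) >-> R}) = EFin \o Phi.
Proof.
apply/esym/funext => x /=.
rewrite /cdf /distribution /pushforward/= /normal_prob PhiE -gd_normal_pdf /Rintegral fineK//.
apply: integrable_fin_num => //; apply: integrableS integrable_gd => //.
Qed.

Lemma cvg_Phiy : Phi x @[x --> +oo] --> (1 : R).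
Proof.
have := cvg_cdfy1 (idTR : {RV (@normal_prob R 0 1) >-> R}).
by rewrite Phi_cdf => /fine_cvg.
Qed.

Lemma Phi_ge0 x : 0 <= Phi x.
Proof. by rewrite PhiE; apply: Rintegral_ge0 => t _; exact: gd_ge0. Qed.

Lemma cvg_gdy : gd x @[x --> +oo] --> (0 : R).
Proof.
apply: (@squeeze_cvgr _ _ _ _ (cst 0) (fun x => expR 2^-1 * expR (- x))).
- near=> x; rewrite gd_ge0/= -expRD.
  apply: (@le_trans _ _ (expR (- x ^+ 2 / 2))).
    rewrite /gd ler_piMl ?expR_ge0// invf_le1 ?sqrtr_gt0 ?mulr_gt0 ?pi_gt0//.
    rewrite -[leLHS]sqrtr1 ler_sqrt ?mulr_ge0 ?pi_ge0//.
    by have := @pi_ge2 R; lra.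
  by rewrite ler_expR; have := sqr_ge0 (x - 1); lra.
- exact: cvg_cst.
- rewrite -[X in _ --> X](mulr0 (expR 2^-1)); apply: cvgMl_tmp.
  exact: cvgr_expR.
Unshelve. all: by end_near. Qed.

(** Beyond [a] the function decreases to its limit 0. Both Mills bounds are obtained this way, [f]
    being the difference of the two sides. *)
Lemma ge0_of_derive_cvgy (f df : R -> R) (a : R) :
  (forall x, a <= x -> is_derive x 1 f (df x)) ->
  (forall x, a <= x -> df x <= 0) -> f x @[x --> +oo] --> (0 : R) -> 0 <= f a.
Proof.
move=> fdf df0 f0; apply: (@cvgr_to_le _ _ _ _ _ _ _ f0).
near=> x; have ax : a <= x by near: x; apply: nbhs_pinfty_ge; exact: num_real.
rewrite -lerN2; apply: (@le_of_derive (\- f) (\- df) a x ax) => y /andP[ay _].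
- have := fdf _ ay => ?; exact: is_deriveN.
- by rewrite /= oppr_ge0 df0.
Unshelve. all: by end_near. Qed.

Lemma Phi_ndecr : {homo @Phi R : x y / x <= y}.
Proof.
move=> x y xy; apply: (le_of_derive xy) => z _; [exact: is_derive_Phi|exact: gd_ge0].
Qed.

Lemma Phi_le1 x : Phi x <= 1.
Proof.
apply: (@cvgr_to_ge _ _ _ _ _ _ _ cvg_Phiy).
by near=> y; apply: Phi_ndecr; near: y; apply: nbhs_pinfty_ge; exact: num_real.
Unshelve. all: by end_near. Qed.

Lemma is_derive_PhiN x : is_derive x 1 (fun y : R => Phi (- y)) (- gd x).
Proof.
have d1 : is_derive x 1 (fun y : R => - y) (- 1) by apply: is_deriveN.
have := @is_derive1_comp R Phi -%R _ _ _ (is_derive_Phi _) d1.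
by rewrite gdN mulrN1.
Qed.

(** The derivative vanishes because [gd] is even. [PhiN] then identifies the constant as 1 by
    letting [x] tend to infinity. *)
Lemma PhiD_N x : Phi x + Phi (- x) = Phi 0 + Phi 0.
Proof.
have D y : is_derive y 1 (fun z => Phi z + Phi (- z)) 0.
  have d1 := is_derive_Phi y; have d2 := is_derive_PhiN y.
  by have := is_deriveD d1 d2; rewrite subrr.
have := @is_derive_0_is_cst R (fun z => Phi z + Phi (- z)) x 0 D.
by rewrite /= oppr0.
Qed.

Lemma PhiN x : Phi (- x) = 1 - Phi x.
Proof.
suff E : Phi 0 + Phi 0 = 1 :> R by have := PhiD_N x; rewrite E => h; lra.
have c1 := cvg_cdfNy0 (idTR : {RV (@normal_prob R 0 1) >-> R}).
have {}c1 : Phi (- y) @[y --> +oo] --> (0 : R).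
  by move: c1; rewrite Phi_cdf => /fine_cvg /= /cvgNy_compNP.
have : (Phi y + Phi (- y)) @[y --> +oo] --> (1 + 0 : R) by exact: cvgD cvg_Phiy c1.
rewrite addr0 (_ : (fun y => _) = cst (Phi 0 + Phi 0)).
  by move=> h; exact: cvg_unique (cvg_cst _) h.
by apply/funext => y /=; rewrite PhiD_N.
Qed.

(** With [x] frozen, [gd y - x * (1 - Phi y)] has derivative [(x - y) * gd y], nonpositive beyond
    [x], and tends to 0. *)
Lemma mills_ub x : x * (1 - Phi x) <= gd x.
Proof.
rewrite -subr_ge0.
have := @ge0_of_derive_cvgy (fun y => gd y - x * (1 - Phi y))
  (fun y => (x - y) * gd y) x; apply.
- move=> y _; have d1 := is_derive_gd y; have d2 := is_derive_Phi y.
  by apply: is_derive_eq; rewrite /GRing.scale/=; ring.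
- by move=> y xy; rewrite mulr_le0_ge0 ?gd_ge0// subr_le0.
- rewrite -[X in _ --> X](_ : 0 - x * (1 - 1) = 0); last by ring.
  apply: cvgB; first exact: cvg_gdy.
  apply: cvgMl_tmp; apply: cvgB; [exact: cvg_cst|exact: cvg_Phiy].
Qed.

(** After division by [1 + x ^+ 2], the difference of the two sides has derivative
    [- 2 * gd y / (1 + y ^+ 2) ^+ 2] and tends to 0. *)
Lemma mills_lb x : x * gd x <= (1 - Phi x) * (1 + x ^+ 2).
Proof.
have x2 y : 0 < 1 + y ^+ 2 by rewrite ltr_pwDl ?sqr_ge0.
rewrite -ler_pdivrMr// -subr_ge0.
have := @ge0_of_derive_cvgy (fun y => (1 - Phi y) - y * gd y / (1 + y ^+ 2))
  (fun y => - (2 * gd y / (1 + y ^+ 2) ^+ 2)) x; apply.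
- move=> y _; have d1 := is_derive_gd y; have d2 := is_derive_Phi y.
  have y0 : 1 + y ^+ 2 != 0 by rewrite gt_eqF.
  have d3 : is_derive y 1 (fun y => 1 + y ^+ 2) (2 * y).
    by apply: is_derive_eq; rewrite /GRing.scale/=; ring.
  have d4 := @is_deriveV R (fun y => 1 + y ^+ 2) _ _ _ y0 d3.
  by apply: is_derive_eq; rewrite /GRing.scale/=; field.
- by move=> y xy; rewrite oppr_le0 divr_ge0 ?exprn_ge0 ?(ltW (x2 _))// mulr_ge0 ?gd_ge0.
- rewrite -[X in _ --> X](_ : (1 - 1) - 0 = 0); last by ring.
  apply: cvgB; first by apply: cvgB; [exact: cvg_cst|exact: cvg_Phiy].
  apply: (@squeeze_cvgr _ _ _ _ (cst 0) gd); [|exact: cvg_cst|exact: cvg_gdy].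
  near=> y; have y0 : 0 <= y by near: y; apply: nbhs_pinfty_ge; exact: num_real.
  rewrite /= divr_ge0 ?mulr_ge0 ?gd_ge0 ?(ltW (x2 _))//= ler_pdivrMr// mulrC.
  by rewrite ler_wpM2l ?gd_ge0//; have := sqr_ge0 (y - 2^-1); lra.
Unshelve. all: by end_near. Qed.

(** Both sides are even by [PhiN], so [mills_ub] on the positive half-line suffices. This is what
    bounds [w * stein w]. *)
Lemma Phi_norm_le x : `|x| * (Phi x * (1 - Phi x)) <= gd x.
Proof.
wlog x0 : x / 0 <= x.
  move=> H; have [/H//|x0] := leP 0 x.
  have := H (- x); rewrite normrN gdN PhiN => h.
  by rewrite [Phi x * _]mulrC -[X in _ * X](_ : (1 - Phi x) * (1 - (1 - Phi x)) = _);
    [apply: h; lra|ring].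
rewrite ger0_norm//; apply: le_trans (mills_ub x).
rewrite ler_wpM2l// ler_piMl ?Phi_le1// subr_ge0; exact: Phi_le1.
Qed.

(** For [|x| >= 1] the previous bound gives the constant 1; for [|x| < 1] the left side is at most 1
    and [gd x >= gd 1]. The constant bounds every Stein solution below. *)
Lemma Phi_le_gd : exists2 C : R, 0 < C & forall x, Phi x * (1 - Phi x) <= C * gd x.
Proof.
exists ((gd 1)^-1 + 1); first by rewrite addr_gt0 ?invr_gt0 ?gd_gt0.
move=> x; have := Phi_norm_le x.
have p0 := Phi_ge0 x; have p1 := Phi_le1 x; have g0 := gd_gt0 x.
have pp : 0 <= Phi x * (1 - Phi x) by rewrite mulr_ge0// subr_ge0.
have [x1|x1] := leP 1 `|x|.
  move=> h; apply: le_trans (_ : gd x <= _).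
    by apply: le_trans h; rewrite ler_peMl.
  by rewrite mulrDl mul1r ler_wpDl// mulr_ge0 ?gd_ge0// invr_ge0 gd_ge0.
move=> _; apply: (@le_trans _ _ 1); first by nra.
rewrite mulrDl mul1r ler_wpDr ?gd_ge0// mulrC ler_pdivlMr ?gd_gt0// mul1r.
rewrite /gd ler_wpM2l//.
rewrite ler_expR; have : x ^+ 2 <= 1 by rewrite -real_normK ?num_real// expr_le1// ltW.
by move=> ?; rewrite expr1n; lra.
Qed.

Lemma Rintegral_split (f : R -> R) w : mu.-integrable setT (EFin \o f) ->
  \int[mu]_t f t = \int[mu]_(t in `]-oo, w]) f t + \int[mu]_(t in `]w, +oo[) f t.
Proof.
move=> intf; have := @Rintegral_itvB R f -oo%O +oo%O w.
rewrite set_itvNyy => /(_ intf)/(_ isT)/(_ isT) <-.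
by rewrite addrC subrK.
Qed.

Lemma le_Rintegral_gdM (g k : R -> R) (D : set R) : measurable D ->
  mu.-integrable setT (EFin \o (fun x => g x * gd x)) ->
  mu.-integrable setT (EFin \o (fun x => k x * gd x)) ->
  (forall x, D x -> g x <= k x) ->
  \int[mu]_(x in D) (g x * gd x) <= \int[mu]_(x in D) (k x * gd x).
Proof.
move=> mD ig ik gk; apply: le_Rintegral => //.
- exact: integrableS ig.
- exact: integrableS ik.
- by move=> x Dx; rewrite ler_wpM2r ?gd_ge0// gk.
Qed.

Definition Nint (g : R -> R) : R := \int[mu]_t (g t * gd t).

Lemma Nint_cst (c : R) : Nint (fun=> c) = c.
Proof. by rewrite /Nint RintegralZl//; [rewrite Rintegral_gd mulr1|exact: integrable_gd]. Qed.

Lemma NintD (g k : R -> R) C : measurable_fun setT g -> measurable_fun setT k ->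
  (forall x, `|g x| <= C) -> (forall x, `|k x| <= C) ->
  Nint (fun x => g x + k x) = Nint g + Nint k.
Proof.
move=> mg mk gC kC; rewrite /Nint -RintegralD//.
- by apply: eq_Rintegral => x _; rewrite mulrDl.
- exact: integrable_gdM gC.
- exact: integrable_gdM kC.
Qed.

Lemma NintZ c (g : R -> R) C : measurable_fun setT g ->
  (forall x, `|g x| <= C) -> Nint (fun x => c * g x) = c * Nint g.
Proof.
move=> mg gC; rewrite /Nint -RintegralZl//.
- by apply: eq_Rintegral => x _; rewrite mulrA.
- exact: integrable_gdM gC.
Qed.

Lemma le_Nint (g k : R -> R) C : measurable_fun setT g -> measurable_fun setT k ->
  (forall x, `|g x| <= C) -> (forall x, `|k x| <= C) ->
  (forall x, g x <= k x) -> Nint g <= Nint k.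
Proof.
move=> mg mk gC kC gk; apply: le_Rintegral_gdM => //.
- exact: integrable_gdM gC.
- exact: integrable_gdM kC.
Qed.

Lemma mvt_shift (f df : R -> R) w s : (forall x, is_derive x 1 f (df x)) ->
  exists2 r, `|r| <= `|s| & f (w + s) - f w = df (w + r) * s.
Proof.
move=> fdf; have cf := continuous_of_is_derive fdf.
have [s0|s0] := leP 0 s.
- have [||x + ->] := @MVT_segment R f df w (w + s); rewrite ?lerDl//.
  + exact: continuous_subspaceT.
  rewrite in_itv/= => /andP[wx xs]; exists (x - w).
    by rewrite !ger0_norm ?subr_ge0//; lra.
  by rewrite [w + (x - w)]addrC subrK [w + s]addrC addrK.
- have [||x + h] := @MVT_segment R f df (w + s) w; rewrite ?gerDl ?ltW//.
  + exact: continuous_subspaceT.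
  rewrite in_itv/= => /andP[wx xs]; exists (x - w).
    by rewrite !ler0_norm ?subr_le0 ?(ltW s0)//; lra.
  rewrite [w + (x - w)]addrC subrK -opprB h; ring.
Qed.

Section stein.
Variables (g : R -> R) (C0 : R).
Hypothesis cg : continuous g.
Hypothesis g01 : forall x, 0 <= g x <= 1.
Hypothesis C0P : forall x, Phi x * (1 - Phi x) <= C0 * gd x.

Let gn x : `|g x| <= 1.
Proof. by case/andP: (g01 x) => ? ?; rewrite ger0_norm. Qed.

Let ig : mu.-integrable setT (EFin \o (fun x => g x * gd x)).
Proof. exact: integrable_gdM (continuous_measurable_fun cg) gn. Qed.

Let i1 : mu.-integrable setT (EFin \o (fun x => 1 * gd x)).
Proof. by apply: (@integrable_gdM _ 1) => // x; rewrite normr1. Qed.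

Definition Nlow (w : R) := \int[mu]_(t in `]-oo, w]) (g t * gd t).
Local Notation H := Nlow.

Lemma Nlow_bnd (w : R) : 0 <= H w <= Phi w.
Proof.
apply/andP; split.
  by apply: Rintegral_ge0 => x _; rewrite mulr_ge0 ?gd_ge0//; case/andP: (g01 x).
rewrite PhiE (_ : \int[mu]_(t in `]-oo, w]) gd t = \int[mu]_(t in `]-oo, w]) (1 * gd t)).
  by apply: le_Rintegral_gdM => // x _; case/andP: (g01 x).
by apply: eq_Rintegral => t _; rewrite mul1r.
Qed.

Lemma NintB_Nlow_bnd (w : R) : 0 <= Nint g - H w <= 1 - Phi w.
Proof.
rewrite /Nlow /Nint (Rintegral_split w ig) [H w + _]addrC addrK.
rewrite -Rintegral_gd (Rintegral_split w integrable_gd) PhiE [_ + \int[mu]_(x in _) gd x]addrC addrK.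
apply/andP; split.
  by apply: Rintegral_ge0 => x _; rewrite mulr_ge0 ?gd_ge0//; case/andP: (g01 x).
rewrite (_ : \int[mu]_(t in `]w, +oo[) gd t = \int[mu]_(t in `]w, +oo[) (1 * gd t)).
  by apply: le_Rintegral_gdM => // x _; case/andP: (g01 x).
by apply: eq_Rintegral => t _; rewrite mul1r.
Qed.

Lemma is_derive_Nlow (w : R) : is_derive w 1 H (g w * gd w).
Proof.
apply: is_derive_FTC1Ny => // x; apply: cvgM; [exact: cg|exact: continuous_gd].
Qed.

(** The bounded solution of Stein's equation f'(w) - w f(w) = g(w) - [Nint g]; its derivative
    [dstein] is read off the equation. *)
Definition stein w : R := (H w - Nint g * Phi w) / gd w.
Definition dstein w : R := w * stein w + g w - Nint g.

Lemma is_derive_stein (w : R) : is_derive w 1 stein (dstein w).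
Proof.
have d1 := is_derive_Nlow w; have d2 := is_derive_Phi w.
have gd0 : gd w != 0 by rewrite gt_eqF ?gd_gt0.
have d3 := @is_deriveV R gd _ _ _ gd0 (is_derive_gd w).
rewrite /dstein /stein; apply: is_derive_eq; rewrite /GRing.scale/=; field.
exact: gd0.
Qed.

(** Each of the two products lies between 0 and [Phi w * (1 - Phi w)], so their difference is
    bounded by the same quantity in modulus; both bounds on [stein] follow. *)
Let numE w : H w - Nint g * Phi w = H w * (1 - Phi w) - (Nint g - H w) * Phi w.
Proof. ring. Qed.

Let num_le w : `|H w - Nint g * Phi w| <= Phi w * (1 - Phi w).
Proof.
rewrite numE.
have /andP[a1 a2] := Nlow_bnd w; have /andP[b1 b2] := NintB_Nlow_bnd w.
have p0 := Phi_ge0 w; have p1 := Phi_le1 w.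
rewrite ler_norml; apply/andP; split; nra.
Qed.

Lemma stein_bnd (w : R) : `|stein w| <= C0.
Proof.
rewrite normrM normfV (ger0_norm (gd_ge0 w)) ler_pdivrMr ?gd_gt0//.
exact: le_trans (num_le w) (C0P w).
Qed.

Lemma stein_mul_bnd (w : R) : `|w| * `|stein w| <= 1.
Proof.
rewrite normrM normfV (ger0_norm (gd_ge0 w)) mulrA ler_pdivrMr ?gd_gt0// mul1r.
by apply: le_trans (Phi_norm_le w); rewrite ler_wpM2l.
Qed.

Lemma Nint01 : 0 <= Nint g <= 1.
Proof.
have /andP[a1 a2] := Nlow_bnd 0; have /andP[b1 b2] := NintB_Nlow_bnd 0.
apply/andP; split; lra.
Qed.

Lemma dstein_bnd (w : R) : `|dstein w| <= 2.
Proof.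
have := stein_mul_bnd w; rewrite -normrM ler_norml => /andP[h1 h2].
have /andP[a1 a2] := Nint01; have /andP[b1 b2] := g01 w.
rewrite /dstein ler_norml; apply/andP; split; lra.
Qed.

Lemma stein_lip (w s : R) : `|stein (w + s) - stein w| <= 2 * `|s|.
Proof.
have [r _ ->] := mvt_shift w s is_derive_stein.
by rewrite normrM; apply: ler_wpM2r => //; exact: dstein_bnd.
Qed.

(** The equation isolates the roughness of [g]; the other terms are Lipschitz, with a constant that
    grows linearly in [|w|]. This growth is why second moments of the partial sums are needed
    later. *)
Lemma dstein_mod (w s : R) :
  `|dstein (w + s) - dstein w| <= `|s| * (C0 + 2 * `|w|) + `|g (w + s) - g w|.
Proof.
have -> : dstein (w + s) - dstein w =
  s * stein (w + s) + w * (stein (w + s) - stein w) + (g (w + s) - g w).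
  rewrite /dstein; ring.
apply: le_trans (ler_normD _ _) _; rewrite lerD2r.
apply: le_trans (ler_normD _ _) _; rewrite (normrM s) (normrM w) mulrDr lerD//.
  by apply: ler_wpM2l => //; exact: stein_bnd.
rewrite mulrA [leRHS]mulrC; apply: ler_wpM2l => //.
by rewrite [leRHS]mulrC; exact: stein_lip.
Qed.

Lemma stein_taylor (w s D : R) :
  (forall r, `|r| <= `|s| -> `|dstein (w + r) - dstein w| <= D) ->
  `|stein (w + s) - stein w - s * dstein w| <= `|s| * D.
Proof.
move=> rD; have [r /rD rs ->] := mvt_shift w s is_derive_stein.
by rewrite mulrC -mulrBr normrM ler_wpM2l.
Qed.

Lemma continuous_stein : continuous stein.
Proof. exact: continuous_of_is_derive is_derive_stein. Qed.

Lemma continuous_dstein : continuous dstein.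
Proof.
move=> x; apply: cvgB; last exact: cvg_cst.
apply: cvgD; last exact: cg.
by apply: cvgM; [exact: cvg_id|exact: continuous_stein].
Qed.

End stein.

End gaussian.

(** * Logistic smoothing of steps *)

Section logistic.
Context {R : realType}.
Implicit Types (t s x : R).

(** A smooth step decreasing from 1 to 0. Its derivative is [- (logi t * (1 - logi t))], a quantity
    that controls finite increments, the distance to the sharp step, and is itself controlled by a
    difference of translates. *)
Definition logi t : R := (1 + expR t)^-1.

Let D0 t : 0 < 1 + expR t. Proof. by rewrite addr_gt0 ?expR_gt0. Qed.

Lemma logi01 t : 0 <= logi t <= 1.
Proof. by rewrite invr_ge0 ltW//= invf_le1// lerDl expR_ge0. Qed.

Lemma continuous_logi : continuous logi.
Proof.
move=> t; apply: cvgV; first by rewrite gt_eqF.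
by apply: cvgD; [exact: cvg_cst|exact: continuous_expR].
Qed.

Lemma logi_nincr s t : s <= t -> logi t <= logi s.
Proof. by move=> st; rewrite /logi lef_pV2 ?posrE// lerD2l ler_expR. Qed.

(** With [a = expR t] and [r = expR s] the increment is exactly [(1 - r) * (1 + a) / (1 + a * r)]
    times the last factor; the two signs of [s] are then elementary. *)
Lemma logiB_le t s : `|logi (t + s) - logi t| <=
  `|s| * expR `|s| * (logi t * (1 - logi t)).
Proof.
have a0 := expR_gt0 t; have r0 := expR_gt0 s.
rewrite /logi expRD; set a := expR t in a0 *; set r := expR s in r0 *.
have ar0 : 0 < 1 + a * r by rewrite addr_gt0// mulr_gt0.
have a10 : 0 < 1 + a by rewrite addr_gt0.
have -> : (1 + a * r)^-1 - (1 + a)^-1 =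
  ((1 - r) * (1 + a) / (1 + a * r)) * ((1 + a)^-1 * (1 - (1 + a)^-1)).
  by field; rewrite !gt_eqF.
rewrite normrM [X in _ * X]ger0_norm; last first.
  by have /andP[h1 h2] := logi01 t; rewrite mulr_ge0 ?subr_ge0.
apply: ler_wpM2r.
  by have /andP[h1 h2] := logi01 t; rewrite mulr_ge0 ?subr_ge0.
rewrite normrM normfV (ger0_norm (ltW ar0)) ler_pdivrMr// normrM (ger0_norm (ltW a10)).
have e1 : 1 - s <= expR (- s) by rewrite -(opprK s) opprK expR_ge1Dx.
have e2 : 1 + s <= r by rewrite expR_ge1Dx.
have e3 : expR (- s) * r = 1 by rewrite -expRD addNr expR0.
set r' := expR (- s) in e1 e3.
have r'0 : 0 < r' by rewrite expR_gt0.
have [s0|s0] := leP 0 s.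
- rewrite (ger0_norm s0) ler0_norm; last by rewrite subr_le0; lra.
  have h : r - 1 <= s * r.
    have -> : s * r = r - (1 - s) * r by ring.
    have : (1 - s) * r <= r' * r by rewrite ler_wpM2r// ltW.
    rewrite e3; lra.
  rewrite -/r; apply: ler_pM => //; [lra|lra|lra|].
  by rewrite lerD2l ler_peMr ?(ltW a0)//; lra.
- rewrite (ltr0_norm s0) -/r' ger0_norm; last first.
    by rewrite subr_ge0 -[leRHS]expR0 ler_expR ltW.
  have h : 1 - r <= - s by lra.
  rewrite -mulrA; apply: ler_pM => //; [|lra|].
    by rewrite subr_ge0 -[leRHS]expR0 ler_expR ltW.
  rewrite mulrDr mulr1 mulrCA e3 mulr1 lerD2r//.
  by rewrite -[leLHS]expR0 ler_expR; lra.
Qed.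

(** A difference of translates is the form to which an approximation of expectations of smoothed
    steps applies. The constant 2 comes from [expR (- 1) <= 2^-1]. *)
Lemma logi_var_le t : logi t * (1 - logi t) <= 2 * (logi (t - 1) - logi t).
Proof.
rewrite /logi expRD; have a0 := expR_gt0 t; set a := expR t in a0 *.
have e1 : expR (- 1) <= 2^-1 :> R.
  rewrite expRN lef_pV2 ?posrE ?expR_gt0//.
  by have := @expR_ge1Dx R 1; lra.
have e0 := @expR_gt0 R (-1); set e := expR (-1) in e1 e0 *.
have -> : (1 + a)^-1 * (1 - (1 + a)^-1) = a / (1 + a) ^+ 2.
  by field; rewrite gt_eqF// addr_gt0.
have ae0 : 0 < 1 + a * e by rewrite addr_gt0// mulr_gt0.
have -> : 2 * ((1 + a * e)^-1 - (1 + a)^-1) = 2 * a * (1 - e) / ((1 + a * e) * (1 + a)).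
  by field; rewrite !gt_eqF// addr_gt0.
have a10 : 0 < 1 + a by rewrite addr_gt0.
rewrite ler_pM ?(ltW a0)// ?invr_ge0 ?exprn_ge0 ?(ltW a10)//.
  by rewrite mulrAC ler_peMl ?(ltW a0)//; lra.
rewrite lef_pV2 ?posrE ?exprn_gt0 ?mulr_gt0//.
rewrite expr2 ler_wpM2r ?(ltW a10)// lerD2l ler_piMr ?(ltW a0)//; lra.
Qed.

(** Here [logi t] is at least one half. Together with its mirror image below, this bounds the
    distance from the sharp step by the derivative. *)
Lemma logi_tail_neg t : t <= 0 -> 1 - logi t <= 2 * (logi t * (1 - logi t)).
Proof.
move=> t0; have /andP[h0 h1] := logi01 t.
have : 2^-1 <= logi t.
  rewrite /logi lef_pV2 ?posrE//.
  have : expR t <= 1 by rewrite -[leRHS]expR0 ler_expR.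
  lra.
nra.
Qed.

Lemma logi_tail_pos t : 0 <= t -> logi t <= 2 * (logi t * (1 - logi t)).
Proof.
move=> t0; have /andP[h0 h1] := logi01 t.
have : logi t <= 2^-1.
  rewrite /logi lef_pV2 ?posrE//.
  have : 1 <= expR t by rewrite -[leLHS]expR0 ler_expR.
  lra.
nra.
Qed.

(** A primitive of [logi] whose unit increments lie in [[0, 1]]; it replaces the integral over the
    line of a difference of translates. *)
Definition logi_prim t : R := - ln (1 + expR (- t)).

Lemma is_derive_logi_prim t : is_derive t 1 logi_prim (logi t).
Proof.
have d1 : is_derive t 1 (fun y : R => - y) (- 1) by apply: is_deriveN.
have d2 := @is_derive1_comp R expR -%R _ _ _ (is_derive_expR _) d1.
have d3 : is_derive t 1 (fun y : R => 1 + expR (- y)) (- expR (- t)).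
  have := is_deriveD (is_derive_cst (1 : R) t 1) d2.
  by rewrite add0r mulrN1.
have d4 := @is_derive1_comp R (@ln R) (fun y : R => 1 + expR (- y)) _ _ _ (is_derive1_ln (D0 (- t))) d3.
have d5 := is_deriveN d4; apply: is_derive_eq.
rewrite /logi expRN; have a0 := expR_gt0 t.
by field; rewrite !gt_eqF// addr_gt0.
Qed.

Lemma logi_primB t : 0 <= logi_prim t - logi_prim (t - 1) <= 1.
Proof.
rewrite /logi_prim; set u := expR (- t).
have u0 : 0 < u by exact: expR_gt0.
have -> : expR (- (t - 1)) = u * expR 1 by rewrite opprB expRD mulrC.
have e1 : 1 <= expR 1 :> R by rewrite -[leLHS]expR0 ler_expR.
rewrite opprK addrC; apply/andP; split.
  rewrite subr_ge0 ler_ln ?posrE ?addr_gt0 ?mulr_gt0 ?expR_gt0//.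
  by rewrite lerD2l ler_peMr ?(ltW u0).
have lnE : ln (expR 1 * (1 + u)) = 1 + ln (1 + u).
  by rewrite lnM ?posrE ?expR_gt0 ?addr_gt0// expRK.
rewrite lerBlDr -lnE.
rewrite ler_ln ?posrE ?mulr_gt0 ?addr_gt0 ?mulr_gt0 ?expR_gt0//.
by rewrite mulrDr mulr1 [u * _]mulrC lerD2r.
Qed.

End logistic.

(** * Smoothed indicators of half-lines and the normal law *)

Section smooth_step.
Context {R : realType}.
Local Notation mu := (@lebesgue_measure R).
Implicit Types (lam x w : R).

Definition slog lam x w : R := logi ((w - x) / lam).

Lemma slog01 lam x w : 0 <= slog lam x w <= 1.
Proof. exact: logi01. Qed.

Lemma slog_norm lam x w : `|slog lam x w| <= 1.
Proof. by have /andP[h0 h1] := slog01 lam x w; rewrite ger0_norm. Qed.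

Lemma continuous_slog lam x : continuous (slog lam x).
Proof.
move=> w; apply: (@continuous_comp _ _ _ (fun w => (w - x) / lam) logi).
  by apply: cvgM; [apply: cvgB; [exact: cvg_id|exact: cvg_cst]|exact: cvg_cst].
exact: continuous_logi.
Qed.

Lemma measurable_slog lam x : measurable_fun setT (slog lam x).
Proof. exact: continuous_measurable_fun (@continuous_slog lam x). Qed.

Lemma slogDlam lam x w : lam != 0 -> slog lam (x + lam) w = logi ((w - x) / lam - 1).
Proof. by move=> l0; rewrite /slog; congr logi; field. Qed.

Lemma slog_le lam x w : 0 < lam -> slog lam x w <= slog lam (x + lam) w.
Proof.
move=> l0; rewrite slogDlam ?gt_eqF//; apply: logi_nincr; lra.
Qed.

Lemma slog_mod lam x w s : 0 < lam -> `|slog lam x (w + s) - slog lam x w| <=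
  2 * (`|s| / lam) * expR (`|s| / lam) * (slog lam (x + lam) w - slog lam x w).
Proof.
move=> l0; rewrite slogDlam ?gt_eqF// /slog.
have -> : (w + s - x) / lam = (w - x) / lam + s / lam by ring.
apply: le_trans (logiB_le _ _) _.
rewrite normrM normfV (ger0_norm (ltW l0)).
have -> (a b c : R) : 2 * a * b * c = a * b * (2 * c) by ring.
apply: ler_wpM2l; last exact: logi_var_le.
by rewrite mulr_ge0 ?expR_ge0// divr_ge0// ltW.
Qed.

(** Since [gd <= 1], the left side is at most the Lebesgue mass [lam] of the gap [D]. Concretely,
    the primitive [P] of [D], with values in [[- lam, 0]], grows at least as fast as [Nlow D] on
    [[- b, b]], and [b] tends to infinity. *)
Lemma Nint_slogB lam x : 0 < lam ->
  Nint (slog lam (x + lam)) - Nint (slog lam x) <= lam.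
Proof.
move=> l0.
pose D w := slog lam (x + lam) w - slog lam x w.
have D0 w : 0 <= D w by rewrite subr_ge0 slog_le.
have D1 w : D w <= 1.
  have /andP[? ?] := slog01 lam x w; have /andP[? ?] := slog01 lam (x + lam) w.
  by rewrite /D; lra.
have cD : continuous D.
  by move=> w; apply: cvgB; exact: continuous_slog.
have D01 w : 0 <= D w <= 1 by rewrite D0 D1.
have -> : Nint (slog lam (x + lam)) - Nint (slog lam x) = Nint D.
  rewrite /Nint -RintegralB//.
  - by apply: eq_Rintegral => t _; rewrite mulrBl.
  - exact: integrable_gdM (measurable_slog _ _) (slog_norm _ _).
  - exact: integrable_gdM (measurable_slog _ _) (slog_norm _ _).
pose P (w : R) := lam * (logi_prim ((w - x) / lam - 1) - logi_prim ((w - x) / lam)).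
have dP w : is_derive w 1 P (D w).
  have e1 : is_derive w 1 (fun w : R => (w - x) / lam) lam^-1.
    by apply: is_derive_eq; rewrite /GRing.scale/=; ring.
  have e2 : is_derive w 1 (fun w : R => (w - x) / lam - 1) lam^-1.
    by apply: is_derive_eq; rewrite /GRing.scale/=; ring.
  have f1 := @is_derive1_comp R logi_prim (fun w : R => (w - x) / lam) _ _ _
    (is_derive_logi_prim _) e1.
  have f2 := @is_derive1_comp R logi_prim (fun w : R => (w - x) / lam - 1) _ _ _
    (is_derive_logi_prim _) e2.
  rewrite /P /D slogDlam ?gt_eqF// /slog.
  apply: is_derive_eq; rewrite /GRing.scale/=; field.
  by rewrite gt_eqF.
have P01 w : - lam <= P w <= 0.
  have /andP[h0 h1] := logi_primB ((w - x) / lam); rewrite /P; apply/andP; split; nra.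
have dH w := is_derive_Nlow cD D01 w.
have bnd b : 0 <= b -> Nint D <= lam + 2 * (1 - Phi b).
  move=> b0.
  have : P (- b) - Nlow D (- b) <= P b - Nlow D b.
    have bb : - b <= b by lra.
    apply: (@le_of_derive R (fun w => P w - Nlow D w) (fun w => D w - D w * gd w) _ _ bb).
    by move=> w _; rewrite subr_ge0 ler_piMr// gd_le1.
  have /andP[h1 h2] := Nlow_bnd cD D01 (- b); rewrite PhiN in h2.
  have /andP[h3 h4] := NintB_Nlow_bnd cD D01 b.
  have /andP[h5 h6] := P01 b; have /andP[h7 h8] := P01 (- b).
  lra.
have cv : lam + 2 * (1 - Phi b) @[b --> +oo] --> (lam + 2 * (1 - 1)).
  apply: cvgD; first exact: cvg_cst.
  by apply: cvgMl_tmp; apply: cvgB; [exact: cvg_cst|exact: cvg_Phiy].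
rewrite subrr mulr0 addr0 in cv.
apply: (@cvgr_to_ge _ _ _ _ _ _ _ cv).
by near=> b; apply: bnd; near: b; apply: nbhs_pinfty_ge; exact: num_real.
Unshelve. all: by end_near. Qed.

(** Off [x] the hypothesis determines [G], and one of the logistic tail bounds applies. At [x] the
    logistic argument is 0, both tail bounds hold, and any value in [[0, 1]] is covered. *)
Lemma step_slog_le lam x (G : R -> R) w : 0 < lam ->
  (w < x)%R%:R <= G w <= (w <= x)%R%:R ->
  `|G w - slog lam x w| <= 4 * (slog lam (x + lam) w - slog lam x w).
Proof.
move=> l0 G01; rewrite slogDlam ?gt_eqF// /slog.
have h1 := logi_var_le ((w - x) / lam).
have /andP[h2 h3] := logi01 ((w - x) / lam).
have [wx|xw|xw] := ltrgtP w x.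
- have Gw : G w = 1.
    by apply/eqP; rewrite eq_le; move: G01; rewrite wx (ltW wx) => /andP[-> ->].
  have wx0 : (w - x) / lam <= 0 by rewrite pmulr_lle0 ?invr_gt0// subr_le0 ltW.
  rewrite Gw ger0_norm ?subr_ge0//.
  by have := logi_tail_neg wx0; lra.
- have Gw : G w = 0.
    apply/eqP; rewrite eq_le; move: G01; rewrite [w <= x]leNgt xw/= => /andP[h ->].
    by apply: le_trans h; rewrite ler0n.
  have wx0 : 0 <= (w - x) / lam by rewrite divr_ge0 ?(ltW l0)// subr_ge0 ltW.
  rewrite Gw sub0r normrN ger0_norm//.
  by have := logi_tail_pos wx0; lra.
- have wx0 : (w - x) / lam = 0 by rewrite xw subrr mul0r.
  have t1 := @logi_tail_pos R ((w - x) / lam); have t2 := @logi_tail_neg R ((w - x) / lam).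
  rewrite wx0 in h1 h2 h3 t1 t2 *.
  have /andP[g0 g1] : 0 <= G w <= 1.
    by move: G01; rewrite xw lexx ltxx.
  have := t1 (lexx _); have := t2 (lexx _).
  by rewrite ler_norml => ? ?; apply/andP; split; lra.
Qed.

Lemma Nint_step x : Nint (fun w => (w <= x)%R%:R) = Phi x.
Proof.
rewrite PhiE /Nint [RHS]Rintegral_mkcond; apply: eq_Rintegral => w _.
rewrite patchE; have [wx|wx] := boolP (w <= x).
  by rewrite mem_set/= ?in_itv/= ?mul1r.
by rewrite memNset/= ?in_itv/= ?mul0r//; exact/negP.
Qed.

Lemma measurable_step x : measurable_fun setT (fun w : R => (w <= x)%R%:R : R).
Proof.
rewrite (_ : (fun w => _) = \1_(`]-oo, x]%classic : set R)).
  exact: measurable_indic.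
apply/funext => w; rewrite indicE; have [wx|wx] := boolP (w <= x).
  by rewrite mem_set/= ?in_itv.
by rewrite memNset/= ?in_itv/=//; exact/negP.
Qed.

(** Integrating [step_slog_le] against [gd] leaves four times a normal gap, which [Nint_slogB]
    bounds by [lam]. *)
Lemma Nint_slog_Phi lam x : 0 < lam -> `|Phi x - Nint (slog lam x)| <= 4 * lam.
Proof.
move=> l0; pose D w := slog lam (x + lam) w - slog lam x w.
have mD : measurable_fun setT D.
  by apply: measurable_funB; exact: measurable_slog.
have D1 w : `|D w| <= 1.
  have /andP[? ?] := slog01 lam x w; have /andP[? ?] := slog01 lam (x + lam) w.
  by rewrite ler_norml /D; apply/andP; split; lra.
pose S (w : R) : R := (w <= x)%R%:R.
have S1 w : `|S w| <= 1 by rewrite /S; case: (w <= x); rewrite ?normr1 ?normr0.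
have iS := integrable_gdM (measurable_step x) S1.
have ig := integrable_gdM (measurable_slog lam x) (slog_norm lam x).
have iD := integrable_gdM mD D1.
have ND : Nint D <= lam.
  apply: le_trans (Nint_slogB x l0); rewrite /Nint -RintegralB//.
    by rewrite le_eqVlt; apply/orP; left; apply/eqP/eq_Rintegral => t _; rewrite mulrBl.
  exact: integrable_gdM (measurable_slog _ _) (slog_norm _ _).
apply: (@le_trans _ _ (4 * Nint D)); last by lra.
have st w : `|S w - slog lam x w| <= 4 * D w.
  by apply: step_slog_le => //; rewrite /S lexx andbT; case: ltrgtP; rewrite ?ler01.
rewrite -(@NintZ _ _ _ 1)// -Nint_step /Nint -RintegralB//.
apply: le_trans (le_normr_Rintegral _ _) _ => //.
  exact: (integrableB measurableT iS ig).
apply: le_Rintegral => //.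
- have := integrable_norm (integrableB measurableT iS ig); exact.
- have := @integrableZl _ _ _ mu _ measurableT 4 _ iD; apply: eq_integrable => // t _ /=.
  by rewrite -EFinM mulrA.
- move=> w _; rewrite -mulrBl normrM (ger0_norm (gd_ge0 w)).
  by apply: ler_wpM2r; [exact: gd_ge0|exact: st].
Qed.

End smooth_step.

(** * Averaging operators *)

Section weighted_mean.
Context {R : realType} d (Y : measurableType d) (Q : probability Y R) (w : Y -> R).

(** Expectation under the density [w] with respect to [Q]. With the density explicit, all tilted
    laws live over one base measure and need not be constructed as measures. *)
Definition wint (a : Y -> R) : R := \int[Q]_y (a y * w y).

Definition wable (a : Y -> R) : Prop := measurable_fun setT a /\
  Q.-integrable setT (EFin \o (fun y => a y * w y)).

Hypothesis w0 : forall y, 0 <= w y.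
Hypothesis mw : measurable_fun setT w.

Lemma wable_le (a b : Y -> R) : measurable_fun setT a ->
  (forall y, `|a y| <= b y) -> wable b -> wable a.
Proof.
move=> ma ab [mb ib]; split => //.
apply: (@le_integrable _ _ _ Q _ measurableT _ (EFin \o (fun y => b y * w y))) => //.
- by apply/measurable_EFinP/measurable_funM.
- move=> y _ /=; rewrite lee_fin !normrM.
  apply: ler_wpM2r => //; apply: le_trans (ab y) _; exact: ler_norm.
Qed.

Lemma wableZ c (a : Y -> R) : wable a -> wable (fun y => c * a y).
Proof.
move=> [ma ia]; split; first exact: measurable_funM.
have := @integrableZl _ _ _ Q _ measurableT c _ ia; apply: eq_integrable => // y _ /=.
by rewrite -EFinM mulrA.
Qed.

Lemma wableD (a b : Y -> R) : wable a -> wable b -> wable (fun y => a y + b y).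
Proof.
move=> [ma ia] [mb ib]; split; first exact: measurable_funD.
have := integrableD measurableT ia ib; apply: eq_integrable => // y _ /=.
by rewrite -EFinD mulrDl.
Qed.

Lemma wableB (a b : Y -> R) : wable a -> wable b -> wable (fun y => a y - b y).
Proof.
move=> ia /(wableZ (-1)) ib; have := wableD ia ib.
by under eq_fun do rewrite mulN1r.
Qed.

Lemma wintE (a : Y -> R) : wable a -> (wint a)%:E = (\int[Q]_y (a y * w y)%:E)%E.
Proof. by move=> [ma ia]; rewrite /wint /Rintegral fineK//; exact: integrable_fin_num. Qed.

Lemma wintZ c (a : Y -> R) : wable a -> wint (fun y => c * a y) = c * wint a.
Proof.
move=> [ma ia]; rewrite /wint -RintegralZl//.
by apply: eq_Rintegral => y _; rewrite mulrA.
Qed.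

Lemma wintD (a b : Y -> R) : wable a -> wable b ->
  wint (fun y => a y + b y) = wint a + wint b.
Proof.
move=> [ma ia] [mb ib]; rewrite /wint -RintegralD//.
by apply: eq_Rintegral => y _; rewrite mulrDl.
Qed.

Lemma wintB (a b : Y -> R) : wable a -> wable b ->
  wint (fun y => a y - b y) = wint a - wint b.
Proof.
move=> [ma ia] [mb ib]; rewrite /wint -RintegralB//.
by apply: eq_Rintegral => y _; rewrite mulrBl.
Qed.

Lemma le_wint (a b : Y -> R) : wable a -> wable b -> (forall y, a y <= b y) ->
  wint a <= wint b.
Proof.
move=> [ma ia] [mb ib] ab; apply: le_Rintegral => // y _.
exact: ler_wpM2r.
Qed.

Lemma wint_ge0 (a : Y -> R) : (forall y, 0 <= a y) -> 0 <= wint a.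
Proof. by move=> a0; apply: Rintegral_ge0 => y _; rewrite mulr_ge0. Qed.

Lemma wint_norm_le (a b : Y -> R) : wable a -> wable b ->
  (forall y, `|a y| <= b y) -> `|wint a| <= wint b.
Proof.
move=> ia ib ab; rewrite ler_norml; apply/andP; split.
  rewrite -mulN1r -wintZ//; apply: le_wint => //; first exact: wableZ.
  by move=> y; rewrite mulN1r; have := ab y; rewrite ler_norml => /andP[].
by apply: le_wint => // y; apply: le_trans (ab y); exact: ler_norm.
Qed.

Lemma eq_wint (a b : Y -> R) : a =1 b -> wint a = wint b.
Proof. by move=> ab; apply: eq_Rintegral => y _; rewrite ab. Qed.

(** [H] has no sign, so Tonelli's measurability of the partial integral is applied to positive and
    negative parts separately. *)
Lemma measurable_wint d' (T : measurableType d') (H : T -> Y -> R) :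
  measurable_fun setT (fun p : T * Y => H p.1 p.2) ->
  measurable_fun setT (fun t => wint (H t)).
Proof.
move=> mH; rewrite /wint /Rintegral.
apply: measurableT_comp; first exact: fine_measurable.
pose f (p : T * Y) := (H p.1 p.2 * w p.2)%:E.
have mf : measurable_fun setT f.
  apply/measurable_EFinP/measurable_funM => //.
  by apply: measurableT_comp.
rewrite (_ : (fun t => _) = (fun t => (fubini_F Q f^\+ t - fubini_F Q f^\- t)%E)).
  apply: emeasurable_funB.
  - apply: measurable_fun_fubini_tonelli_F => //; exact: measurable_funepos.
  - apply: measurable_fun_fubini_tonelli_F => //; exact: measurable_funeneg.
apply/funext => t; rewrite [LHS](integralE Q setT (fun y => f (t, y))).
rewrite /fubini_F; congr (_ - _)%E; apply: eq_integral => y _.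
  by rewrite !funeposE.
by rewrite !funenegE.
Qed.

(** The weight has finite mass in [y], so a bound depending on [z] alone makes the kernel integrable
    for the product, and Fubini applies. *)
Lemma wint_swap (K : Y -> Y -> R) (a : Y -> R) : wable (fun=> 1) -> wable a ->
  measurable_fun setT (fun p : Y * Y => K p.1 p.2) ->
  (forall y z, `|K y z| <= a z) ->
  wint (fun y => wint (K y)) = wint (fun z => wint (fun y => K y z)).
Proof.
move=> w1 ia mK Ka.
pose f (p : Y * Y) := (K p.1 p.2 * w p.2 * w p.1)%:E.
have mf : measurable_fun setT f.
  apply/measurable_EFinP/measurable_funM => //; last exact: measurableT_comp.
  by apply: measurable_funM => //; exact: measurableT_comp.
have ik y : wable (K y).
  apply: wable_le ia => //.
  have := measurableT_comp mK (pair1_measurable y); exact.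
have ik' z : wable (fun y => K y z).
  apply: (@wable_le _ (fun=> a z * 1)) => [|y|]; last exact: wableZ.
  - have := measurableT_comp mK (pair2_measurable z); exact.
  - by rewrite mulr1.
have intf : (Q \x Q)%E.-integrable setT f.
  apply/integrable12ltyP => //.
  apply: (@le_lt_trans _ _ (\int[Q]_y (wint a * (1 * w y))%:E)%E).
    apply: ge0_le_integral => //.
    - by move=> y _; exact: integral_ge0.
    - have -> : (fun y => \int[Q]_z `|f (y, z)|)%E = fubini_F Q (abse \o f) by [].
      apply: (measurable_fun_fubini_tonelli_F (abse \o f)) => //=.
      exact: measurableT_comp.
    - apply/measurable_EFinP; apply: measurable_funM => //.
      exact: measurable_funM.
    - move=> y _; rewrite mul1r mulrC EFinM wintE// -integralZl//; last by case: ia.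
      apply: ge0_le_integral => //.
      + apply: measurableT_comp => //.
        by have := measurableT_comp mf (pair1_measurable y); exact.
      + apply/measurable_EFinP; apply: measurable_funM => //.
        by case: ia => ma _; exact: measurable_funM.
      + move=> z _; rewrite /f/= -EFinM lee_fin !normrM (ger0_norm (w0 y)) (ger0_norm (w0 z)).
        rewrite mulrC; apply: ler_wpM2l => //; exact: ler_wpM2r.
  have [_ i1] := wableZ (wint a) w1.
  have -> : (\int[Q]_y (wint a * (1 * w y))%:E = (wint (fun=> wint a * 1))%:E)%E.
    rewrite wintE; last exact: wableZ.
    by apply: eq_integral => y _; rewrite mulrA.
  exact: ltry.
have FF := Fubini intf.
have E1 y : (wint (K y) * w y)%:E = (\int[Q]_z f (y, z))%E.
  rewrite mulrC -(wintZ _ (ik y)) (wintE (wableZ _ (ik y))).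
  by apply: eq_integral => z _; rewrite /f/=; congr EFin; ring.
have E2 z : (wint (fun y => K y z) * w z)%:E = (\int[Q]_y f (y, z))%E.
  rewrite mulrC -(wintZ _ (ik' z)) (wintE (wableZ _ (ik' z))).
  by apply: eq_integral => y _; rewrite /f/=; congr EFin; ring.
apply: (congr1 fine).
under eq_integral do rewrite E1.
by under [RHS]eq_integral do rewrite E2.
Qed.

End weighted_mean.

Section averaging.
Context {R : realType} d (Y : measurableType d) (Q : probability Y R) (w X : Y -> R).
Hypothesis w0 : forall y, 0 <= w y.
Hypothesis mw : measurable_fun setT w.
Hypothesis mX : measurable_fun setT X.
Hypothesis w1 : wable Q w (fun=> 1).
Hypothesis wint1 : wint Q w (fun=> 1) = 1.
Hypothesis wX2 : wable Q w (fun y => X y ^+ 2).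

Definition avg (F : R -> R) (s : R) : R := wint Q w (fun y => F (s + X y)).

(** The contribution of a single summand [X] to an expectation of the form E[S F(S)], with [s] the
    sum of the other summands. *)
Definition savg (F : R -> R) (s : R) : R := wint Q w (fun y => X y * F (s + X y)).

(** The domain on which [avg] is iterated: stable because [X] has a second moment, and large enough
    for [s ^+ 2] and for [s * F s] with [F] bounded, both of which the Stein argument averages. *)
Definition quadratic_growth (F : R -> R) : Prop := measurable_fun setT F /\
  exists2 C, 0 <= C & forall s, `|F s| <= C * (1 + s ^+ 2).

Local Notation qg := quadratic_growth.

Lemma qg_bounded (F : R -> R) C : measurable_fun setT F ->
  (forall s, `|F s| <= C) -> qg F.
Proof.
move=> mF FC; have C0 : 0 <= C by exact: le_trans (FC 0).
split => //; exists C => // s; apply: le_trans (FC s) _.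
by rewrite ler_peMr// lerDl sqr_ge0.
Qed.

Lemma qg_cst c : qg (fun=> c).
Proof. by apply: (@qg_bounded _ `|c|). Qed.

Lemma qgD (F G : R -> R) : qg F -> qg G -> qg (fun s => F s + G s).
Proof.
move=> [mF [C C0 FC]] [mG [D D0 GD]]; split; first exact: measurable_funD.
exists (C + D); first exact: addr_ge0.
by move=> s; rewrite mulrDl; apply: le_trans (ler_normD _ _) _; exact: lerD.
Qed.

Lemma qgZ c (F : R -> R) : qg F -> qg (fun s => c * F s).
Proof.
move=> [mF [C C0 FC]]; split; first exact: measurable_funM.
exists (`|c| * C); first exact: mulr_ge0.
by move=> s; rewrite normrM -mulrA ler_wpM2l.
Qed.

Lemma qgB (F G : R -> R) : qg F -> qg G -> qg (fun s => F s - G s).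
Proof.
move=> iF /(qgZ (-1)) iG; have := qgD iF iG.
by under eq_fun do rewrite mulN1r.
Qed.

Lemma qg_sqr : qg (fun s => s ^+ 2).
Proof.
split; first by apply: measurable_funX.
by exists 1 => // s; rewrite mul1r ger0_norm ?sqr_ge0// lerDr.
Qed.

Let sqrD_le (a b : R) : 1 + (a + b) ^+ 2 <= 2 * (1 + a ^+ 2) + 2 * b ^+ 2.
Proof. by have := sqr_ge0 (a - b); lra. Qed.

Let measurable_shift (F : R -> R) (s : R) : measurable_fun setT F ->
  measurable_fun setT (fun y => F (s + X y)).
Proof. by move=> mF; apply: measurableT_comp => //; exact: measurable_funD. Qed.

Let measurable_shift2 (F : R -> R) : measurable_fun setT F ->
  measurable_fun setT (fun p : R * Y => F (p.1 + X p.2)).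
Proof.
move=> mF; apply: measurableT_comp => //; apply: measurable_funD => //.
exact: measurableT_comp.
Qed.

Lemma wable_qg (F : R -> R) s : qg F -> wable Q w (fun y => F (s + X y)).
Proof.
move=> [mF [C C0 FC]].
apply: (@wable_le _ _ _ _ _ mw _
  (fun y => C * (2 * (1 + s ^+ 2)) * 1 + C * 2 * X y ^+ 2)).
- exact: measurable_shift.
- move=> y; apply: le_trans (FC _) _; rewrite mulr1 -!mulrA -mulrDr.
  by apply: ler_wpM2l => //; exact: sqrD_le.
- by apply: wableD => //; apply: wableZ.
Qed.

Lemma qg_avg (F : R -> R) : qg F -> qg (avg F).
Proof.
move=> iF; have [mF [C C0 FC]] := iF; split.
  exact: (measurable_wint Q mw (measurable_shift2 mF)).
have X20 : 0 <= wint Q w (fun y => X y ^+ 2).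
  by apply: wint_ge0 => // y; exact: sqr_ge0.
exists (C * (2 + 2 * wint Q w (fun y => X y ^+ 2))).
  by rewrite mulr_ge0// addr_ge0// mulr_ge0.
move=> s; apply: (@le_trans _ _ (wint Q w
  (fun y => C * (2 * (1 + s ^+ 2)) * 1 + C * 2 * X y ^+ 2))).
  apply: wint_norm_le => //.
  - exact: wable_qg.
  - by apply: wableD => //; apply: wableZ.
  - move=> y; apply: le_trans (FC _) _; rewrite mulr1 -!mulrA -mulrDr.
    by apply: ler_wpM2l => //; exact: sqrD_le.
rewrite wintD ?wintZ//; [|exact: wableZ|exact: wableZ].
rewrite wint1 mulr1 -!mulrA -mulrDr; apply: ler_wpM2l => //.
by rewrite [leRHS]mulrDl lerD2l ler_peMr ?lerDl ?sqr_ge0// mulr_ge0.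
Qed.

Lemma qg_iter n (F : R -> R) : qg F -> qg (iter n avg F).
Proof. by move=> iF; elim: n => //= n IHn; exact: qg_avg. Qed.

Lemma avgD (F G : R -> R) : qg F -> qg G ->
  avg (fun s => F s + G s) = fun s => avg F s + avg G s.
Proof. by move=> iF iG; apply/funext => s; rewrite /avg wintD//; exact: wable_qg. Qed.

Lemma avgZ c (F : R -> R) : qg F -> avg (fun s => c * F s) = fun s => c * avg F s.
Proof. by move=> iF; apply/funext => s; rewrite /avg wintZ//; exact: wable_qg. Qed.

Lemma iterD n (F G : R -> R) : qg F -> qg G ->
  iter n avg (fun s => F s + G s) = fun s => iter n avg F s + iter n avg G s.
Proof. by move=> iF iG; elim: n => //= n ->; rewrite avgD//; exact: qg_iter. Qed.

Lemma iterZ n c (F : R -> R) : qg F ->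
  iter n avg (fun s => c * F s) = fun s => c * iter n avg F s.
Proof. by move=> iF; elim: n => //= n ->; rewrite avgZ//; exact: qg_iter. Qed.

Lemma iterB n (F G : R -> R) : qg F -> qg G ->
  iter n avg (fun s => F s - G s) = fun s => iter n avg F s - iter n avg G s.
Proof.
move=> iF iG.
rewrite (_ : (fun s => F s - G s) = (fun s => F s + -1 * G s)).
  rewrite iterD//; last exact: qgZ.
  by rewrite iterZ//; apply/funext => s; rewrite mulN1r.
by apply/funext => s; rewrite mulN1r.
Qed.

Lemma iter_cst n c : iter n avg (fun=> c) = fun=> c.
Proof.
elim: n => //= n ->; apply/funext => s; rewrite /avg.
rewrite (_ : (fun=> c) = (fun=> c * 1)); first by rewrite wintZ// wint1 mulr1.
by apply/funext => y; rewrite mulr1.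
Qed.

Lemma le_iter n (F G : R -> R) : qg F -> qg G -> (forall s, F s <= G s) ->
  forall s, iter n avg F s <= iter n avg G s.
Proof.
move=> iF iG FG; elim: n => //= n IHn s; apply: le_wint => //.
- exact: wable_qg (qg_iter n iF).
- exact: wable_qg (qg_iter n iG).
Qed.

Lemma iter_norm_le n (F G : R -> R) : qg F -> qg G -> (forall s, `|F s| <= G s) ->
  forall s, `|iter n avg F s| <= iter n avg G s.
Proof.
move=> iF iG FG s; rewrite ler_norml; apply/andP; split.
- have := @le_iter n (fun s => -1 * G s) F (qgZ _ iG) iF.
  rewrite iterZ// => /(_ _ s); rewrite mulN1r; apply.
  by move=> t; rewrite mulN1r; have := FG t; rewrite ler_norml => /andP[].
- by apply: le_iter => // t; apply: le_trans (FG t); exact: ler_norm.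
Qed.

Lemma iter_bounded n (F : R -> R) C : measurable_fun setT F ->
  (forall s, `|F s| <= C) -> forall s, `|iter n avg F s| <= C.
Proof.
move=> mF FC s; have := @iter_norm_le n F (fun=> C).
by rewrite iter_cst; apply => //; [exact: qg_bounded FC|exact: qg_cst].
Qed.

Let wX : wable Q w (fun y => `|X y|).
Proof.
apply: (@wable_le _ _ _ _ _ mw _ (fun y => 1 + X y ^+ 2)).
- exact: measurableT_comp.
- move=> y; rewrite normr_id -real_normK ?num_real//.
  by have := sqr_ge0 (`|X y| - 1); have := normr_ge0 (X y); nra.
- exact: wableD.
Qed.

Lemma wable_savg (F : R -> R) C s : measurable_fun setT F ->
  (forall s, `|F s| <= C) -> wable Q w (fun y => X y * F (s + X y)).
Proof.
move=> mF FC; apply: (@wable_le _ _ _ _ _ mw _ (fun y => C * `|X y|)).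
- by apply: measurable_funM => //; exact: measurable_shift.
- by move=> y; rewrite normrM mulrC ler_wpM2r.
- exact: wableZ.
Qed.

Lemma measurable_savg (F : R -> R) : measurable_fun setT F -> measurable_fun setT (savg F).
Proof.
move=> mF; apply: (measurable_wint Q mw).
by apply: measurable_funM; [exact: measurableT_comp|exact: measurable_shift2].
Qed.

Lemma savg_bounded (F : R -> R) C : measurable_fun setT F ->
  (forall s, `|F s| <= C) -> forall s, `|savg F s| <= C * wint Q w (fun y => `|X y|).
Proof.
move=> mF FC s; rewrite -wintZ// /savg; apply: wint_norm_le => //.
- exact: wable_savg FC.
- exact: wableZ.
- by move=> y; rewrite normrM mulrC ler_wpM2r.
Qed.

Lemma qg_savg (F : R -> R) C : measurable_fun setT F ->
  (forall s, `|F s| <= C) -> qg (savg F).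
Proof.
move=> mF FC; apply: (@qg_bounded _ (C * wint Q w (fun y => `|X y|))).
- exact: measurable_savg.
- exact: savg_bounded.
Qed.

(** The two operators integrate over independent copies of [X], so they commute by Fubini. *)
Lemma avg_savg (F : R -> R) C : measurable_fun setT F ->
  (forall s, `|F s| <= C) -> avg (savg F) = savg (avg F).
Proof.
move=> mF FC; apply/funext => s; rewrite /avg /savg.
rewrite (@wint_swap _ _ _ Q w w0 mw (fun y z => X z * F (s + X y + X z))
  (fun z => C * `|X z|))//.
- apply: eq_wint => z; rewrite -wintZ; last exact: (wable_qg _ (qg_bounded mF FC)).
  by apply: eq_wint => y; rewrite addrAC.
- exact: wableZ.
- apply: measurable_funM; first exact: measurableT_comp.
  apply: measurableT_comp => //; apply: measurable_funD; last exact: measurableT_comp.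
  by apply: measurable_funD => //; exact: measurableT_comp.
- by move=> y z; rewrite normrM mulrC ler_wpM2r.
Qed.

Lemma savg_iter n (F : R -> R) C : measurable_fun setT F ->
  (forall s, `|F s| <= C) -> savg (iter n avg F) = iter n avg (savg F).
Proof.
move=> mF FC; elim: n => //= n IHn; rewrite -IHn.
have [mG _] := qg_iter n (qg_bounded mF FC).
by rewrite (avg_savg mG (iter_bounded n mF FC)).
Qed.

Lemma qgMid (F : R -> R) C : measurable_fun setT F ->
  (forall s, `|F s| <= C) -> qg (fun s => s * F s).
Proof.
move=> mF FC; have C0 : 0 <= C by exact: le_trans (FC 0).
split; first exact: measurable_funM.
exists C => // s; rewrite normrM mulrC.
apply: ler_pM => //; rewrite -[s ^+ 2]real_normK ?num_real//.
by have := sqr_ge0 (`|s| - 1); have := normr_ge0 s; nra.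
Qed.

(* Exchangeability: each of the [n] summands contributes equally to
   [E[S_n F(S_n)]]. *)
Lemma iter_Mid n (F : R -> R) C : measurable_fun setT F ->
  (forall s, `|F s| <= C) -> iter n avg (fun s => s * F s) =
  fun s => s * iter n avg F s + n%:R * iter n.-1 avg (savg F) s.
Proof.
move=> mF FC; elim: n => [|n IHn]; first by apply/funext => s; rewrite /= mul0r addr0.
rewrite iterS IHn.
have iF := qg_bounded mF FC.
have [mG _] := qg_iter n iF; have GC := iter_bounded n mF FC.
have iS := qg_savg mF FC.
rewrite avgD; [|exact: qgMid GC|exact/qgZ/qg_iter].
rewrite avgZ; last exact: qg_iter.
apply/funext => s; rewrite -iterS.
have -> : n%:R * iter n.-1.+1 avg (savg F) s = n%:R * iter n avg (savg F) s :> R.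
  by case: n {IHn mG GC} => [|//]; rewrite !mul0r.
rewrite -[in RHS]natr1 mulrDl mul1r -(savg_iter n mF FC) /=.
rewrite [_ * savg _ _ + _]addrC addrA; congr (_ + _).
rewrite {1}/avg /savg -wintZ; last exact: (wable_qg _ (qg_iter n iF)).
rewrite -wintD.
- by apply: eq_wint => y; rewrite mulrDl.
- exact/wableZ/(wable_qg _ (qg_iter n iF)).
- exact: wable_savg GC.
Qed.

Lemma iter_sqr n : wint Q w X = 0 -> wint Q w (fun y => X y ^+ 2) = 1 ->
  iter n avg (fun s => s ^+ 2) = fun s => s ^+ 2 + n%:R.
Proof.
move=> EX EX2; have iX : wable Q w X.
  by apply: (wable_le mw mX _ wX).
elim: n => [|n IHn]; first by apply/funext => s; rewrite addr0.
rewrite iterS IHn avgD; [|exact: qg_sqr|exact: qg_cst].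
have /= -> := iter_cst 1 n%:R.
apply/funext => s; rewrite -natr1 [n%:R + 1]addrC addrA; congr (_ + _).
transitivity (wint Q w (fun y => s ^+ 2 * 1 + (2 * s * X y + X y ^+ 2))).
  by apply: eq_wint => y; ring.
rewrite wintD; [|exact: wableZ|by apply: wableD => //; exact: wableZ].
rewrite wintD//; last exact: wableZ.
by rewrite !wintZ// EX EX2 wint1 mulr0 add0r mulr1.
Qed.

End averaging.

(** * The Berry-Esseen bound *)

Section berry_esseen.
Context {R : realType} d (Y : measurableType d) (Q : probability Y R) (w X : Y -> R).
Variables (kappa M C0 : R).
Hypothesis w0 : forall y, 0 <= w y.
Hypothesis mw : measurable_fun setT w.
Hypothesis mX : measurable_fun setT X.
Hypothesis w1 : wable Q w (fun=> 1).
Hypothesis wint1 : wint Q w (fun=> 1) = 1.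
Hypothesis EX : wint Q w X = 0.
Hypothesis EX2 : wint Q w (fun y => X y ^+ 2) = 1.
Hypothesis kappa01 : 0 < kappa <= 1.
Hypothesis wexp : wable Q w (fun y => expR (kappa * `|X y|)).
Hypothesis wintM : wint Q w (fun y => expR (kappa * `|X y|)) <= M.
Hypothesis C0_gt0 : 0 < C0.
Hypothesis C0P : forall x : R, Phi x * (1 - Phi x) <= C0 * gd x.

Let k0 : 0 < kappa. Proof. by case/andP: kappa01. Qed.

(** [C3] is the constant of [cube_le]. [K] is the smoothing width for the unnormalised sum, with
    [C3 * M * (2 / K) = 8^-1]. [B] closes the induction: the fed-back error [4 * B / 8] is one half
    of it, and [C3 * M * (C0 + 6)] is the other. *)
Let C3 : R := (6 / kappa) ^+ 3.
Let K : R := 16 * C3 * M.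
Let B : R := 2 * C3 * M * (C0 + 6).

Let M1 : 1 <= M.
Proof.
apply: le_trans wintM; rewrite -wint1; apply: le_wint => // y.
by rewrite -[leLHS]expR0 ler_expR mulr_ge0// ltW.
Qed.

Let C31 : 2 / kappa <= C3.
Proof.
have h : 1 <= kappa^-1 by rewrite invf_ge1//; case/andP: kappa01.
rewrite /C3 exprMn; set a := kappa^-1 in h *.
have : a <= a ^+ 3 by rewrite -[leLHS]expr1; apply: ler_weXn2l.
lra.
Qed.

Let C3_1 : 1 <= C3.
Proof.
apply: le_trans C31; rewrite ler_pdivlMr// mul1r.
by have := kappa01; lra.
Qed.

Let C30 : 0 < C3. Proof. by have := C3_1; lra. Qed.

Let KC3 : 2 / kappa <= K.
Proof.
apply: le_trans C31 _; rewrite /K.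
have := C3_1; have := M1 => h1 h2.
have : C3 * 1 <= C3 * M by rewrite ler_wpM2l// ltW.
nra.
Qed.

Let K1 : 1 <= K.
Proof. by apply: le_trans KC3; rewrite ler_pdivlMr// mul1r; have := kappa01; lra. Qed.

Let K0 : 0 < K. Proof. by have := K1; lra. Qed.

Let cube_le (u : R) : 0 <= u -> (1 + u) ^+ 3 <= C3 * expR (kappa * u / 2).
Proof.
move=> u0; have -> : kappa * u / 2 = 3%:R * (kappa * u / 6) by field.
rewrite expRM_natl -exprMn; apply: lerXn2r; rewrite ?nnegrE.
- by rewrite addr_ge0.
- by rewrite mulr_ge0 ?expR_ge0// divr_ge0// ltW.
apply: (@le_trans _ _ (6 / kappa * (1 + kappa * u / 6))); last first.
  by rewrite ler_wpM2l ?expR_ge1Dx// divr_ge0// ltW.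
have -> : 6 / kappa * (1 + kappa * u / 6) = 6 / kappa + u by field; rewrite gt_eqF.
by rewrite lerD2r ler_pdivlMr// mul1r; have := kappa01; lra.
Qed.

(** Half of the exponent pays for the polynomial by [cube_le], the other half for [expR (u / K)],
    because [2 / kappa <= K]. *)
Let exp_dom (u : R) : 0 <= u -> (1 + u ^+ 2) * u * expR (u / K) <= C3 * expR (kappa * u).
Proof.
move=> u0; apply: (@le_trans _ _ ((1 + u) ^+ 3 * expR (kappa * u / 2))).
  apply: ler_pM; rewrite ?expR_ge0//.
  - by rewrite mulr_ge0// addr_ge0// sqr_ge0.
  - by have := sqr_ge0 u; nra.
  - rewrite ler_expR -mulrA mulrCA ler_wpM2l//.
    have := KC3; rewrite ler_pdivrMr// => h.
    rewrite -[leLHS]mul1r ler_pdivrMr//.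
    by rewrite mulrAC ler_pdivlMr// mul1r mulrC.
have -> : expR (kappa * u) = expR (kappa * u / 2 + kappa * u / 2) by congr expR; field.
by rewrite expRD mulrA ler_wpM2r ?expR_ge0// cube_le.
Qed.

Let dom_lin (u : R) : 0 <= u -> (1 + u ^+ 2) * u <= C3 * expR (kappa * u).
Proof.
move=> u0; apply: le_trans (exp_dom u0); rewrite ler_peMr//.
  by rewrite mulr_ge0// addr_ge0// sqr_ge0.
by rewrite -[leLHS]expR0 ler_expR divr_ge0// ltW.
Qed.

Let dom_sqr (u : R) : 0 <= u -> u ^+ 2 <= C3 * expR (kappa * u).
Proof.
move=> u0; apply: le_trans (_ : (1 + u) ^+ 3 <= _); first by have := sqr_ge0 u; nra.
apply: le_trans (cube_le u0) _; rewrite ler_wpM2l ?(ltW C30)// ler_expR.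
by rewrite -[leRHS]mulr1 ler_wpM2l//; [exact: mulr_ge0 (ltW k0) u0|lra].
Qed.

Let wX2 : wable Q w (fun y => X y ^+ 2).
Proof.
apply: (@wable_le _ _ _ _ _ mw _ (fun y => C3 * expR (kappa * `|X y|))).
- exact: measurable_funX.
- by move=> y; rewrite ger0_norm ?sqr_ge0// -real_normK ?num_real//; exact: dom_sqr.
- exact: wableZ.
Qed.

Let wX : wable Q w X.
Proof.
apply: (@wable_le _ _ _ _ _ mw _ (fun y => 1 + X y ^+ 2)) => //; last exact: wableD.
move=> y; rewrite -real_normK ?num_real//.
by have := sqr_ge0 (`|X y| - 1); have := normr_ge0 (X y); nra.
Qed.

Lemma slog_scale (r x s : R) : 0 < r -> slog K x s = slog (K / r) (x / r) (s / r).
Proof.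
move=> r0; rewrite /slog; congr logi; field.
by rewrite !gt_eqF.
Qed.

Let qgslog x : quadratic_growth (slog K x).
Proof. exact: qg_bounded (measurable_slog K x) (slog_norm K x). Qed.

(** * One step of the induction on the number of summands *)

Section step.
Variables (n : nat) (x : R).
Hypothesis n0 : (0 < n)%N.

Let r : R := Num.sqrt n%:R.
Let lam : R := K / r.
Let g := slog lam (x / r).

Let r0 : 0 < r. Proof. by rewrite sqrtr_gt0 ltr0n. Qed.
Let lam0 : 0 < lam. Proof. exact: divr_gt0. Qed.
Let r2 : r ^+ 2 = n%:R. Proof. by rewrite sqr_sqrtr. Qed.

Let cg : continuous g. Proof. exact: continuous_slog. Qed.
Let g01 v : 0 <= g v <= 1. Proof. exact: slog01. Qed.

Let f := stein g.
Let df := dstein g.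

(** Being nondecreasing in [|u|], this bounds the increments of [df] over all steps of length at
    most [|u|], and so serves both for an increment and for the Taylor remainder in
    [stein_taylor]. *)
Let modulus (v u : R) := `|u| * (C0 + 2 * `|v|) +
  2 * (`|u| / lam) * expR (`|u| / lam) * (slog lam (x / r + lam) v - slog lam (x / r) v).

Let modulus_ge0 (v u : R) : 0 <= modulus v u.
Proof.
have h1 : 0 <= slog lam (x / r + lam) v - slog lam (x / r) v by rewrite subr_ge0 slog_le.
have h2 : 0 <= C0 + 2 * `|v| by rewrite addr_ge0 ?(ltW C0_gt0) ?mulr_ge0.
have h3 : 0 <= `|u| / lam by rewrite divr_ge0 ?(ltW lam0).
apply: addr_ge0; first exact: mulr_ge0.
apply: mulr_ge0 => //; apply: mulr_ge0 (expR_ge0 _); exact: mulr_ge0.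
Qed.

Let df_modulus (v u t : R) : `|t| <= `|u| -> `|df (v + t) - df v| <= modulus v u.
Proof.
move=> tu; apply: le_trans (dstein_mod cg g01 C0P v t) _.
apply: lerD.
  by apply: ler_wpM2r => //; rewrite addr_ge0 ?(ltW C0_gt0) ?mulr_ge0.
apply: le_trans (slog_mod _ _ _ lam0) _; apply: ler_wpM2r.
  by rewrite subr_ge0 slog_le.
have tul : `|t| / lam <= `|u| / lam by rewrite ler_wpM2r// invr_ge0 ltW.
apply: ler_pM; rewrite ?expR_ge0 ?ler_expR ?mulr_ge0 ?invr_ge0 ?(ltW lam0)//.
by rewrite ler_wpM2l.
Qed.

Let bound (s : R) := C3 * M * ((C0 + 1 + s ^+ 2 / n%:R) / r +
  2 / K * (slog K (x + K) s - slog K x s)).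

Let F (s : R) := f (s / r) / r.

Let measurable_scale (h : R -> R) : continuous h -> measurable_fun setT (fun s : R => h (s / r)).
Proof.
move=> ch; apply: measurableT_comp; first exact: continuous_measurable_fun.
exact: measurable_funM.
Qed.

Let mdf : measurable_fun setT (fun s : R => df (s / r)).
Proof. exact: measurable_scale (continuous_dstein cg g01). Qed.

Let dfn (s : R) : `|df (s / r)| <= 2. Proof. exact: dstein_bnd. Qed.

Let mF : measurable_fun setT F.
Proof. by apply: measurable_funM => //; exact: measurable_scale (continuous_stein cg g01). Qed.

Let FC (s : R) : `|F s| <= C0 / r.
Proof.
rewrite normrM normfV (ger0_norm (ltW r0)) ler_wpM2r ?invr_ge0 ?(ltW r0)//.
exact: stein_bnd.
Qed.

(** Here [s] is the sum of the other [n - 1] summands, still to be averaged. Centring and unit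
    variance cancel the terms of low order, and what remains is bounded by [modulus] at
    [X y / r]. *)
Let stein_step (s : R) :
  `|avg Q w X (fun t => df (t / r)) s - n%:R * savg Q w X F s| <= bound s.
Proof.
set v := s / r.
pose rem y := f (v + X y / r) - f v - X y / r * df v.
have wdf : wable Q w (fun y => df ((s + X y) / r)).
  exact: (wable_qg mw mX w1 wX2 s (qg_bounded mdf dfn)).
have wF := wable_savg mw mX w1 wX2 s mF FC.
have wdf' : wable Q w (fun y => df ((s + X y) / r) - n%:R * (X y * F (s + X y))).
  by apply: wableB => //; exact: wableZ.
(* This function has mean zero since [X] is centred with unit variance. Subtracting it turns the
   integrand into an increment of [df] and a first-order Taylor remainder of [f]. *)
have wc : wable Q w (fun y => df v * 1 - df v * X y ^+ 2 - r * f v * X y).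
  by apply: wableB; [apply: wableB|]; exact: wableZ.
have wc0 : wint Q w (fun y => df v * 1 - df v * X y ^+ 2 - r * f v * X y) = 0.
  rewrite wintB; [|by apply: wableB; exact: wableZ|exact: wableZ].
  rewrite wintB; [|exact: wableZ|exact: wableZ].
  by rewrite !wintZ// wint1 EX2 EX mulr0 subrr subrr.
have -> : avg Q w X (fun t => df (t / r)) s - n%:R * savg Q w X F s =
  wint Q w (fun y => (df ((s + X y) / r) - n%:R * (X y * F (s + X y)))
                     - (df v * 1 - df v * X y ^+ 2 - r * f v * X y)).
  rewrite wintB// wc0 subr0 wintB//; last exact: wableZ.
  by rewrite wintZ.
have E y : (df ((s + X y) / r) - n%:R * (X y * F (s + X y)))
    - (df v * 1 - df v * X y ^+ 2 - r * f v * X y) =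
    (df (v + X y / r) - df v) - r * X y * rem y.
  rewrite /rem /F mulrDl -/v -r2; field.
  by rewrite gt_eqF.
rewrite (eq_wint Q w E).
have bnd y : `|(df (v + X y / r) - df v) - r * X y * rem y| <=
    C3 * ((C0 + 1 + s ^+ 2 / n%:R) / r + 2 / K * (slog K (x + K) s - slog K x s))
    * expR (kappa * `|X y|).
  apply: (@le_trans _ _ ((1 + `|X y| ^+ 2) * modulus v (X y / r))).
    apply: le_trans (ler_normB _ _) _; rewrite mulrDl mul1r lerD//.
      exact: df_modulus.
    have h : `|rem y| <= `|X y / r| * modulus v (X y / r).
      by apply: (stein_taylor cg g01) => t tu; exact: df_modulus.
    rewrite normrM; apply: (@le_trans _ _ (`|r * X y| * (`|X y / r| * modulus v (X y / r)))).
      by rewrite ler_wpM2l.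
    rewrite mulrA; apply: ler_wpM2r; first exact: modulus_ge0.
    rewrite -normrM (_ : r * X y * (X y / r) = X y ^+ 2); last by field; rewrite gt_eqF.
    by rewrite normrX.
  have ur : `|X y / r| = `|X y| / r by rewrite normrM normfV (ger0_norm (ltW r0)).
  have ul : `|X y / r| / lam = `|X y| / K by rewrite ur /lam; field; rewrite !gt_eqF.
  have Dq : slog lam (x / r + lam) v - slog lam (x / r) v = slog K (x + K) s - slog K x s.
    by rewrite (slog_scale (x + K) s r0) (slog_scale x s r0) mulrDl.
  rewrite /modulus ul Dq ur; set q := slog K (x + K) s - slog K x s.
  have q0 : 0 <= q by rewrite subr_ge0 slog_le.
  set u := `|X y|; have u0 : 0 <= u by exact: normr_ge0.
  (* The linear growth in [v] is traded for a square, whose average over [m] summands [iter_sqr]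
     computes exactly. *)
  have v2 : 2 * `|v| <= 1 + s ^+ 2 / n%:R.
    rewrite -r2 -expr_div_n -/v -[v ^+ 2]real_normK ?num_real//.
    by have := sqr_ge0 (`|v| - 1); lra.
  have -> : (1 + u ^+ 2) * (u / r * (C0 + 2 * `|v|) + 2 * (u / K) * expR (u / K) * q) =
    ((1 + u ^+ 2) * u) * ((C0 + 2 * `|v|) / r) + ((1 + u ^+ 2) * u * expR (u / K)) * (2 / K * q).
    by field; rewrite !gt_eqF.
  rewrite [leRHS](_ : _ = C3 * expR (kappa * u) * ((C0 + 1 + s ^+ 2 / n%:R) / r)
     + C3 * expR (kappa * u) * (2 / K * q)); last by ring.
  apply: lerD; apply: ler_pM.
  - by rewrite mulr_ge0// addr_ge0// sqr_ge0.
  - by rewrite divr_ge0 ?(ltW r0)// addr_ge0 ?(ltW C0_gt0)// mulr_ge0.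
  - exact: dom_lin.
  - rewrite ler_wpM2r ?invr_ge0 ?(ltW r0)//; lra.
  - by rewrite mulr_ge0 ?expR_ge0// mulr_ge0// addr_ge0// sqr_ge0.
  - by rewrite mulr_ge0// divr_ge0// ltW.
  - exact: exp_dom.
  - exact: lexx.
apply: le_trans (wint_norm_le w0 _ _ bnd) _.
- apply: (wable_le mw) bnd _ => //; last exact: wableZ.
  have [m1 _] := wableB wdf' wc.
  by move: m1; rewrite (_ : (fun y => _) = (fun y => df (v + X y / r) - df v - r * X y * rem y)) //;
    apply/funext => y; rewrite E.
- exact: wableZ.
rewrite wintZ// /bound [C3 * M * _]mulrAC ler_wpM2l//.
have q0 : 0 <= slog K (x + K) s - slog K x s by rewrite subr_ge0 slog_le.
rewrite mulr_ge0 ?(ltW C30)// addr_ge0//.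
- by rewrite divr_ge0 ?(ltW r0)// !addr_ge0 ?(ltW C0_gt0)// divr_ge0// sqr_ge0.
- by rewrite mulr_ge0// divr_ge0// ltW.
Qed.

Let itD := iterD w0 mw mX w1 wint1 wX2.
Let itB := iterB w0 mw mX w1 wint1 wX2.
Let itZ := iterZ w0 mw mX w1 wint1 wX2.

Let qgbound : quadratic_growth bound.
Proof.
apply: qgZ; apply: qgD.
- rewrite (_ : (fun s => _) = (fun s => (C0 + 1) / r + (n%:R * r)^-1 * s ^+ 2)).
    by apply: qgD; [exact: qg_cst|exact/qgZ/qg_sqr].
  by apply/funext => s; field; rewrite gt_eqF// pnatr_eq0 -lt0n.
- exact/qgZ/qgB.
Qed.

Let iter_bound m : iter m (avg Q w X) bound 0 =
  C3 * M * ((C0 + 1 + m%:R / n%:R) / r + 2 / K *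
    (iter m (avg Q w X) (slog K (x + K)) 0 - iter m (avg Q w X) (slog K x) 0)).
Proof.
have nn : n%:R != 0 :> R by rewrite pnatr_eq0 -lt0n.
have q1 : quadratic_growth (fun s : R => (n%:R * r)^-1 * s ^+ 2) by exact/qgZ/qg_sqr.
have q2 : quadratic_growth (fun s : R => (C0 + 1) / r + (n%:R * r)^-1 * s ^+ 2).
  by apply: qgD => //; exact: qg_cst.
have q3 : quadratic_growth (fun s : R => 2 / K * (slog K (x + K) s - slog K x s)).
  exact/qgZ/qgB.
rewrite (_ : bound = (fun s => C3 * M * (((C0 + 1) / r + (n%:R * r)^-1 * s ^+ 2)
    + 2 / K * (slog K (x + K) s - slog K x s)))); last first.
  apply/funext => s; rewrite /bound; congr (_ * (_ + _)).
  by field; rewrite gt_eqF.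
rewrite (itZ _ _ (qgD q2 q3)) (itD _ q2 q3) (itD _ (qg_cst _) q1).
rewrite (itZ _ _ (qgB (qgslog _) (qgslog _))) (itB _ (qgslog _) (qgslog _)).
rewrite (itZ _ _ qg_sqr) (iter_cst _ w1 wint1) (iter_sqr mw mX w1 wint1 wX2 _ EX EX2).
by congr (_ * (_ + _)); field; rewrite gt_eqF.
Qed.

(** Stein's equation replaces the smoothed step, and [iter_Mid] singles out one summand;
    [stein_step] is then averaged over the other [n - 1]. The last term measures how much their sum
    concentrates near [x]. *)
Lemma stein_iter : `|iter n (avg Q w X) (slog K x) 0 - Nint g| <=
  C3 * M * ((C0 + 1 + n.-1%:R / n%:R) / r + 2 / K *
    (iter n.-1 (avg Q w X) (slog K (x + K)) 0 - iter n.-1 (avg Q w X) (slog K x) 0)).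
Proof.
rewrite -iter_bound.
have qdf := qg_bounded mdf dfn.
have qF := qg_savg w0 mw mX w1 wX2 mF FC.
have qsF := qgMid mF FC.
(* Stein's equation at [s / r]: the factor [r^-1] in [F] turns [s / r * f (s / r)] into
   [s * F s]. *)
have -> : slog K x = (fun s => (df (s / r) - s * F s) + Nint g).
  apply/funext => s; rewrite (slog_scale _ _ r0) -/lam -/g /F /df /dstein -/f.
  by field; rewrite gt_eqF.
rewrite (itD _ (qgB qdf qsF) (qg_cst _)) (iter_cst _ w1 wint1) addrK.
rewrite (itB _ qdf qsF) (iter_Mid w0 mw mX w1 wint1 wX2 _ mF FC) mul0r add0r.
have qadf := qg_avg w0 mw mX w1 wint1 wX2 qdf.
have -> : iter n (avg Q w X) (fun s => df (s / r)) =
    iter n.-1 (avg Q w X) (avg Q w X (fun s => df (s / r))).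
  by rewrite -iterSr prednK.
have := @iter_norm_le _ _ _ _ _ _ w0 mw mX w1 wint1 wX2 n.-1
  (fun s => avg Q w X (fun s => df (s / r)) s - n%:R * savg Q w X F s) bound
  (qgB qadf (qgZ _ qF)) qgbound stein_step 0.
by rewrite (itB _ qadf (qgZ _ qF)) (itZ _ _ qF).
Qed.

End step.

Let it01 n x : 0 <= iter n (avg Q w X) (slog K x) 0 <= 1.
Proof.
apply/andP; split.
  have := @le_iter _ _ _ _ _ _ w0 mw mX w1 wint1 wX2 n (fun=> 0) _ (qg_cst 0) (qgslog x).
  rewrite (iter_cst _ w1 wint1) => /(_ _ 0); apply => s.
  by have /andP[] := slog01 K x s.
have := @le_iter _ _ _ _ _ _ w0 mw mX w1 wint1 wX2 n _ (fun=> 1) (qgslog x) (qg_cst 1).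
rewrite (iter_cst _ w1 wint1) => /(_ _ 0); apply => s.
by have /andP[] := slog01 K x s.
Qed.

Let diff_arith (k b p p1 i i1 : R) : p1 - p <= k -> `|i - p| <= b ->
  `|i1 - p1| <= b -> i1 - i <= k + 2 * b.
Proof. by move=> h1; rewrite !ler_norml => /andP[h2 h3] /andP[h4 h5]; lra. Qed.

(** The induction is uniform in [x], since the hypothesis for one summand fewer is used at [x] and
    at [x + K] to bound the concentration term of [stein_iter]. *)
Lemma berry_esseen_slog n x : (0 < n)%N ->
  `|iter n (avg Q w X) (slog K x) 0 -
    Nint (slog (K / Num.sqrt n%:R) (x / Num.sqrt n%:R))| <= B / Num.sqrt n%:R.
Proof.
have B0 : 0 <= B.
  have M0 := le_trans ler01 M1; rewrite /B; apply: mulr_ge0.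
    by apply: mulr_ge0 => //; apply: mulr_ge0 => //; exact: ltW.
  by rewrite addr_ge0// ltW.
have CM0 : 0 <= C3 * M by apply: mulr_ge0 (ltW C30) (le_trans ler01 M1).
elim: n x => // n IHn x _.
apply: le_trans (stein_iter x _) _ => //=.
have := ltr0Sn R n; set N : R := n.+1%:R => N0.
set r := Num.sqrt N; have r0 : 0 < r by rewrite sqrtr_gt0.
have h1 : n%:R / N <= 1 by rewrite ler_pdivrMr// mul1r ler_nat.
have cK : C3 * M * (2 / K) = 8^-1.
  have ? := C30; have ? := M1; rewrite /K; field.
  by rewrite !gt_eqF//; lra.
have CB : C3 * M * (C0 + 6) = B / 2 by rewrite /B; field.
move: (n%:R / N) h1 => q h1.
(* With [m] the root of the smaller number of summands, the normal gap costs [K / m] and the two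
   approximations [B / m] each; [m^-1 <= 2 / r] doubles these constants. *)
suff D : iter n (avg Q w X) (slog K (x + K)) 0 - iter n (avg Q w X) (slog K x) 0
    <= (2 * K + 4 * B) / r.
  rewrite mulrDr mulrA mulrA cK.
  apply: (@le_trans _ _ (C3 * M * (C0 + 2) / r + 8^-1 * ((2 * K + 4 * B) / r))).
    apply: lerD; last by rewrite ler_wpM2l.
    rewrite -mulrA -[leRHS]mulrA ler_wpM2l// ler_wpM2r ?invr_ge0 ?(ltW r0)//; lra.
  rewrite mulrA -mulrDl ler_wpM2r ?invr_ge0 ?(ltW r0)//.
  have : K = 16 * (C3 * M) by rewrite /K mulrA.
  lra.
(* There is no hypothesis for zero summands; the difference is then at most 1, and [K >= 1]. *)
have [n0|n0] := posnP n.
  have -> : r = 1 by rewrite /r /N n0 sqrtr1.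
  have /andP[? ?] := it01 n x; have /andP[? ?] := it01 n (x + K).
  by rewrite divr1; have := K1; lra.
have m0 : 0 < Num.sqrt n%:R :> R by rewrite sqrtr_gt0 ltr0n.
have := IHn (x + K) n0; have := IHn x n0.
set m : R := Num.sqrt n%:R in m0 *.
have mr : m^-1 <= 2 / r.
  rewrite -[m^-1]mul1r ler_pdivrMr// mulrAC ler_pdivlMr// mul1r.
  rewrite -(@ler_pXn2r _ 2) ?nnegrE ?mulr_ge0 ?(ltW r0) ?(ltW m0)//.
  rewrite exprMn !sqr_sqrtr ?(ltW N0)// /N -natrX -natrM ler_nat.
  by rewrite -[(2 ^ 2)%N]/4%N; move: n0; clear; case: n => // n _; rewrite !mulSn mul0n; lia.
have := @Nint_slogB R (K / m) (x / m) (divr_gt0 K0 m0).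
rewrite -mulrDl => h2 h3 h4.
apply: (@le_trans _ _ ((K + 2 * B) * m^-1)).
  by rewrite mulrDl -[2 * B * _]mulrA; exact: diff_arith h2 h3 h4.
have -> : (2 * K + 4 * B) / r = (K + 2 * B) * (2 / r) by ring.
by rewrite ler_wpM2l// addr_ge0 ?(ltW K0)// mulr_ge0.
Qed.

(** The constants add up as [4 * (k + 2 * b)] for smoothing the step under the law of the sum, [b]
    for the smoothed comparison, and [4 * k] for undoing the smoothing under the normal law. *)
Let step_arith (k b p p1 i i1 j q : R) : `|q - p| <= 4 * k -> p1 - p <= k ->
  `|i - p| <= b -> `|i1 - p1| <= b -> `|j - i| <= 4 * (i1 - i) ->
  `|j - q| <= 8 * k + 9 * b.
Proof.
rewrite !ler_norml => /andP[a1 a2] b1 /andP[c1 c2] /andP[d1 d2] /andP[e1 e2].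
by apply/andP; split; lra.
Qed.

(* The step [G] is sandwiched so that both [P(S < x)] and [P(S <= x)] are
   covered. *)
Lemma berry_esseen_explicit n x (G : R -> R) : (0 < n)%N -> measurable_fun setT G ->
  (forall s, (s < x)%R%:R <= G s <= (s <= x)%R%:R) ->
  `|iter n (avg Q w X) G 0 - Phi (x / Num.sqrt n%:R)| <= (8 * K + 9 * B) / Num.sqrt n%:R.
Proof.
move=> n0 mG Gx.
set r := Num.sqrt n%:R; have r0 : 0 < r :> R by rewrite sqrtr_gt0 ltr0n.
have G1 s : `|G s| <= 1.
  have /andP[h1 h2] := Gx s; rewrite ger0_norm; last by apply: le_trans h1; rewrite ler0n.
  by apply: le_trans h2 _; rewrite lern1 leq_b1.
have qG := qg_bounded mG G1.
have dG s : `|G s - slog K x s| <= 4 * (slog K (x + K) s - slog K x s).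
  exact: step_slog_le.
have qd := qgZ 4 (qgB (qgslog (x + K)) (qgslog x)).
have := @iter_norm_le _ _ _ _ _ _ w0 mw mX w1 wint1 wX2 n _ _ (qgB qG (qgslog x)) qd dG 0.
rewrite (iterB w0 mw mX w1 wint1 wX2 _ qG (qgslog x)).
rewrite (iterZ w0 mw mX w1 wint1 wX2 _ _ (qgB (qgslog (x + K)) (qgslog x))).
rewrite (iterB w0 mw mX w1 wint1 wX2 _ (qgslog (x + K)) (qgslog x)).
have := berry_esseen_slog (x + K) n0; have := berry_esseen_slog x n0.
have := @Nint_slogB R (K / r) (x / r) (divr_gt0 K0 r0).
have := @Nint_slog_Phi R (K / r) (x / r) (divr_gt0 K0 r0).
rewrite -(mulrDl x K r^-1) (_ : (8 * K + 9 * B) / r = 8 * (K / r) + 9 * (B / r)).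
  exact: step_arith.
by rewrite mulrDl !mulrA.
Qed.

End berry_esseen.

(** The constant is chosen before the law and depends on [kappa] and [M] only, so that a single one
    serves all tilts [h] near 0. *)
Lemma berry_esseen {R : realType} (kappa M : R) : 0 < kappa <= 1 ->
  exists2 C : R, 0 < C & forall d (Y : measurableType d) (Q : probability Y R) (w X : Y -> R),
  (forall y, 0 <= w y) -> measurable_fun setT w -> measurable_fun setT X ->
  wable Q w (fun=> 1) -> wint Q w (fun=> 1) = 1 ->
  wint Q w X = 0 -> wint Q w (fun y => X y ^+ 2) = 1 ->
  wable Q w (fun y => expR (kappa * `|X y|)) ->
  wint Q w (fun y => expR (kappa * `|X y|)) <= M ->
  forall n x (G : R -> R), (0 < n)%N -> measurable_fun setT G ->
  (forall s, (s < x)%R%:R <= G s <= (s <= x)%R%:R) ->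
  `|iter n (avg Q w X) G 0 - Phi (x / Num.sqrt n%:R)| <= C / Num.sqrt n%:R.
Proof.
move=> k01; have [C0 C00 C0P] := @Phi_le_gd R.
set D := 8 * (16 * (6 / kappa) ^+ 3 * M) + 9 * (2 * (6 / kappa) ^+ 3 * M * (C0 + 6)).
(* [M] carries no sign at this point, so the modulus and the added 1 secure a positive constant. *)
exists (`|D| + 1); first by rewrite ltr_wpDl.
move=> d Y Q w X w0 mw mX w1 wint1 EX EX2 wexp wintM n x G n0 mG Gx.
apply: le_trans (berry_esseen_explicit w0 mw mX w1 wint1 EX EX2 k01 wexp wintM C00 C0P n0 mG Gx) _.
rewrite ler_wpM2r ?invr_ge0 ?sqrtr_ge0//.
by apply: le_trans (ler_norm _) _; rewrite lerDl.
Qed.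

(** * Exponential tilting *)

Section smoothed_tail.
Context {R : realType}.
Local Notation mu := (@lebesgue_measure R).

Definition millsR (b : R) : R := expR (b ^+ 2 / 2) * (1 - Phi b).

Lemma gd_shift (b v : R) : expR (b ^+ 2 / 2) * gd (v + b) = expR (- (b * v)) * gd v.
Proof.
by rewrite /gd mulrCA [RHS]mulrCA -!expRD; congr (_ * expR _); field.
Qed.

(** Completing the square as in [gd_shift] shows that [expR (b ^+ 2 / 2) * Phi (v + b)] is a
    primitive of the integrand. *)
Lemma Rintegral_exp_gd (b : R) : 0 <= b ->
  \int[mu]_(v in `[0, +oo[) (expR (- (b * v)) * gd v) = millsR b.
Proof.
move=> b0.
have cs : continuous (fun v : R => v + b).
  by move=> v; apply: cvgD; [exact: cvg_id|exact: cvg_cst].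
have d1 (v : R) : is_derive v 1 (fun v : R => expR (b ^+ 2 / 2) * Phi (v + b))
   (expR (- (b * v)) * gd v).
  have d2 : is_derive v 1 (fun v : R => v + b) 1.
    by apply: is_derive_eq; rewrite addr0.
  have d3 := @is_derive1_comp R (@Phi R) (fun v : R => v + b) _ _ _ (is_derive_Phi _) d2.
  rewrite -gd_shift; apply: is_derive_eq.
  by rewrite /GRing.scale/= mulr1.
have := @Rintegral_ge0_continuous_FTC2y R (fun v => expR (- (b * v)) * gd v)
  (fun v : R => expR (b ^+ 2 / 2) * Phi (v + b)) 0 (expR (b ^+ 2 / 2)).
rewrite add0r => ->.
- by rewrite /millsR mulrBr mulr1.
- by move=> v v0; rewrite mulr_ge0 ?expR_ge0 ?gd_ge0.
- apply: continuous_subspaceT => v; apply: cvgM; last exact: continuous_gd.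
  apply: (@continuous_comp _ _ _ (fun v : R => - (b * v)) expR); last exact: continuous_expR.
  by apply: cvgN; apply: cvgM; [exact: cvg_cst|exact: cvg_id].
- rewrite -[X in _ --> X]mulr1; apply: cvgMl_tmp.
  apply: (cvg_comp (fun v : R => v + b) Phi); last exact: cvg_Phiy.
  exact: cvg_addrr.
- by move=> v _; have := d1 v; case.
- apply: cvg_at_right_filter.
  have := continuous_of_is_derive d1 (x := 0); rewrite /continuous_at /= add0r; exact.
- by move=> v _; rewrite derive1E; apply: derive_val.
Qed.

(** The weight [expR (- (a * s))] on the positive side, prolonged by 1. Unlike the weight cut to 0
    there, it is nonincreasing, so its upper level sets are half-lines unbounded below. *)
Definition expmax (a s : R) : R := expR (- (a * Num.max s 0)).

Lemma expmax01 a s : 0 <= a -> 0 <= expmax a s <= 1.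
Proof.
move=> a0; rewrite expR_ge0/= -[leRHS]expR0 ler_expR oppr_le0 mulr_ge0//.
by rewrite le_max lexx orbT.
Qed.

Lemma measurable_expmax a : measurable_fun setT (expmax a).
Proof.
apply: measurableT_comp => //; apply: measurableT_comp => //.
by apply: measurable_funM => //; exact: measurable_maxr.
Qed.

Lemma expmax_norm a s : 0 <= a -> `|expmax a s| <= 1.
Proof. by move=> /(expmax01 s)/andP[h0 h1]; rewrite ger0_norm. Qed.

Lemma Nint_expmax (b : R) : 0 <= b -> Nint (expmax b) = Phi 0 + millsR b.
Proof.
move=> b0; have int := integrable_gdM (measurable_expmax b) (fun s => expmax_norm s b0).
rewrite /Nint (Rintegral_split 0 int); congr (_ + _).
  rewrite PhiE; apply: eq_Rintegral => v; rewrite inE/= in_itv/= => v0.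
  by rewrite /expmax max_r// mulr0 oppr0 expR0 mul1r.
rewrite Rintegral_itv_obnd_cbnd; last exact: integrableS int.
rewrite -(Rintegral_exp_gd b0); apply: eq_Rintegral => v.
by rewrite inE/= in_itv/= andbT => v0; rewrite /expmax max_l.
Qed.

(** A discrete layer-cake formula: the sum counts the integer part of [N%:R * t]. *)
Lemma sum_levels (N : nat) (t : R) : (0 < N)%N -> 0 <= t <= 1 ->
  `|t - N%:R^-1 * \sum_(k < N) ((k.+1%:R / N%:R <= t)%R%:R : R)| <= N%:R^-1.
Proof.
move=> N0 /andP[t0 t1]; have NR : 0 < N%:R :> R by rewrite ltr0n.
have Nt0 : 0 <= N%:R * t by rewrite mulr_ge0// ltW.
have /andP[m1 m2] := Num.Theory.truncn_itv Nt0.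
set m := Num.truncn (N%:R * t) in m1 m2.
have mN : (m <= N)%N.
  by rewrite -(ler_nat R); apply: le_trans m1 _; rewrite ler_piMr// ltW.
have -> : \sum_(k < N) ((k.+1%:R / N%:R <= t)%R%:R : R) = m%:R.
  rewrite -natr_sum; congr _%:R.
  rewrite (eq_bigr (fun k : 'I_N => (k < m)%N : nat)); last first.
    move=> k _; congr nat_of_bool; rewrite ler_pdivrMr// mulrC.
    apply/idP/idP => h.
      have : k.+1%:R < m.+1%:R :> R by exact: le_lt_trans h m2.
      by rewrite ltr_nat ltnS.
    by apply: le_trans m1; rewrite ler_nat.
  rewrite -(big_mkord xpredT (fun k => (k < m)%N : nat)).
  rewrite (big_cat_nat (n := m))//= big_nat_cond (eq_bigr (fun=> 1%N)); last first.
    by move=> i /andP[/andP[_ ->]].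
  rewrite -big_nat_cond sum_nat_const_nat subn0 muln1 big_nat_cond big1 ?addn0// => i.
  by move=> /andP[/andP[mi _] _]; rewrite ltnNge mi.
have -> : t - N%:R^-1 * m%:R = N%:R^-1 * (N%:R * t - m%:R) by field; rewrite gt_eqF.
rewrite ger0_norm; last by rewrite mulr_ge0 ?invr_ge0 ?(ltW NR)// subr_ge0.
rewrite ler_piMr ?invr_ge0 ?(ltW NR)// lerBlDr.
by rewrite addrC natr1 ltW.
Qed.

End smoothed_tail.

(** * From half-lines to exponentially weighted half-lines *)

Section level_approximation.
Context {R : realType} d (Y : measurableType d) (Q : probability Y R) (w X : Y -> R).
Variables (n : nat) (C : R).
Hypothesis w0 : forall y, 0 <= w y.
Hypothesis mw : measurable_fun setT w.
Hypothesis mX : measurable_fun setT X.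
Hypothesis w1 : wable Q w (fun=> 1).
Hypothesis wint1 : wint Q w (fun=> 1) = 1.
Hypothesis wX2 : wable Q w (fun y => X y ^+ 2).
Hypothesis n0 : (0 < n)%N.
Hypothesis C0 : 0 <= C.
Hypothesis BE : forall x (G : R -> R), measurable_fun setT G ->
  (forall s, (s < x)%R%:R <= G s <= (s <= x)%R%:R) ->
  `|iter n (avg Q w X) G 0 - Phi (x / Num.sqrt n%:R)| <= C / Num.sqrt n%:R.

Let r : R := Num.sqrt n%:R.
Let r0 : 0 < r. Proof. by rewrite sqrtr_gt0 ltr0n. Qed.

(** The signed error of the normal approximation; its linearity on bounded measurable functions lets
    a bound for half-lines pass to mixtures of half-lines. *)
Let discrepancy (g : R -> R) : R :=
  iter n (avg Q w X) g 0 - Nint (fun v => g (r * v)).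

Let bounded_measurable (g : R -> R) := measurable_fun setT g /\
  exists D, forall s, `|g s| <= D.

Local Notation bm := bounded_measurable.

Let bm_qg g : bm g -> quadratic_growth g.
Proof. by move=> [mg [D gD]]; exact: qg_bounded gD. Qed.

Let mscale (g : R -> R) : measurable_fun setT g -> measurable_fun setT (fun v : R => g (r * v)).
Proof. by move=> mg; apply: measurableT_comp => //; exact: measurable_funM. Qed.

Let discrepancyD g k : bm g -> bm k ->
  discrepancy (fun s => g s + k s) = discrepancy g + discrepancy k.
Proof.
move=> bg bk; have := (bm_qg bg); have := (bm_qg bk) => qk qg.
case: bg => mg [D gD]; case: bk => mk [D' kD'].
rewrite /discrepancy (iterD w0 mw mX w1 wint1 wX2 _ qg qk).
rewrite (@NintD _ _ _ (D + D'))//; first by ring.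
- exact: mscale.
- exact: mscale.
- by move=> s; apply: le_trans (gD _) _; rewrite lerDl; exact: le_trans (kD' 0).
- by move=> s; apply: le_trans (kD' _) _; rewrite lerDr; exact: le_trans (gD 0).
Qed.

Let discrepancyZ c g : bm g -> discrepancy (fun s => c * g s) = c * discrepancy g.
Proof.
move=> bg; have qg := bm_qg bg; case: bg => mg [D gD].
rewrite /discrepancy (iterZ w0 mw mX w1 wint1 wX2 _ _ qg).
by rewrite (@NintZ _ _ _ D)//; [ring|exact: mscale].
Qed.

Let discrepancy_le (g : R -> R) (e : R) : measurable_fun setT g -> (forall s, `|g s| <= e) ->
  `|discrepancy g| <= 2 * e.
Proof.
move=> mg ge; rewrite /discrepancy mulr_natl mulr2n.
apply: le_trans (ler_normB _ _) _; apply: lerD.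
  exact: (iter_bounded w0 mw mX w1 wint1 wX2).
rewrite ler_norml; apply/andP; split.
  rewrite -(Nint_cst (- e)); apply: (@le_Nint _ _ _ e) => //.
  - exact: mscale.
  - by move=> s; rewrite normrN ger0_norm//; exact: le_trans (ge 0).
  - by move=> s; have := ge (r * s); rewrite ler_norml => /andP[].
rewrite -[leRHS](Nint_cst e); apply: (@le_Nint _ _ _ e) => //.
- exact: mscale.
- by move=> s; rewrite ger0_norm//; exact: le_trans (ge 0).
- by move=> s; have := ge (r * s); rewrite ler_norml => /andP[].
Qed.

Let discrepancy_cst c : discrepancy (fun=> c) = 0.
Proof. by rewrite /discrepancy (iter_cst _ w1 wint1) Nint_cst subrr. Qed.

Let bm_sum (h : nat -> R -> R) (N : nat) : (forall k, bm (h k)) ->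
  bm (fun s => \sum_(k < N) h k s).
Proof.
move=> bh; elim: N => [|N [m [D sD]]].
  rewrite (_ : (fun s => _) = (fun=> 0)); last by apply/funext => s; rewrite big_ord0.
  by split => //; exists 0 => s; rewrite normr0.
rewrite (_ : (fun s => _) = (fun s => \sum_(k < N) h k s + h N s)); last first.
  by apply/funext => s; rewrite big_ord_recr.
have [mh [D' hD']] := bh N; split; first exact: measurable_funD.
by exists (D + D') => s; apply: le_trans (ler_normD _ _) _; exact: lerD.
Qed.

Let discrepancy_sum (h : nat -> R -> R) (N : nat) e : (forall k, bm (h k)) ->
  (forall k, (k < N)%N -> `|discrepancy (h k)| <= e) ->
  `|discrepancy (fun s => \sum_(k < N) h k s)| <= N%:R * e.
Proof.
move=> bh; elim: N => [|N IHN] he.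
  rewrite (_ : (fun s => _) = (fun=> 0)); last by apply/funext => s; rewrite big_ord0.
  by rewrite discrepancy_cst normr0 mul0r.
rewrite (_ : (fun s => _) = (fun s => \sum_(k < N) h k s + h N s)); last first.
  by apply/funext => s; rewrite big_ord_recr.
rewrite discrepancyD//; last exact: bm_sum.
apply: le_trans (ler_normD _ _) _; rewrite -natr1 mulrDl mul1r lerD//.
- by apply: IHN => k kN; apply: he; exact: ltnW.
- exact: he.
Qed.

Let discrepancy_step x : `|discrepancy (fun s => (s <= x)%R%:R)| <= C / r.
Proof.
rewrite /discrepancy (_ : Nint _ = Phi (x / r)).
  apply: BE; first exact: measurable_step.
  by move=> s; rewrite lexx andbT; case: ltrgtP; rewrite ?ler01.
rewrite -Nint_step; congr Nint; apply/funext => v.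
by rewrite ler_pdivlMr// mulrC.
Qed.

Let Cr0 : 0 <= C / r. Proof. by rewrite divr_ge0// ltW. Qed.

(** A mean of half-line indicators inherits the bound for half-lines, and so does a uniform limit of
    such means; hence no dependence on [a]. The levels are found by dividing by [a], which sets
    [a = 0] apart. *)
Lemma expmax_discrepancy (a : R) : 0 <= a ->
  `|iter n (avg Q w X) (expmax a) 0 - (Phi 0 + millsR (a * r))| <= C / r.
Proof.
move=> a0; have -> : Phi 0 + millsR (a * r) = Nint (fun v => expmax a (r * v)).
  rewrite -Nint_expmax; last by rewrite mulr_ge0// ltW.
  congr Nint; apply/funext => v; rewrite /expmax; congr (expR (- _)).
  by rewrite -mulrA maxr_pMr ?(ltW r0)// mulr0.
rewrite -/(discrepancy _).
move: a0; rewrite le_eqVlt => /predU1P[<-|a0].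
  rewrite (_ : expmax 0 = fun=> 1); first by rewrite discrepancy_cst normr0.
  by apply/funext => s; rewrite /expmax mul0r oppr0 expR0.
apply/ler_addgt0Pr => e e0.
have [N N0 Ne] : exists2 N, (0 < N)%N & 2 * N%:R^-1 <= e.
  exists (Num.truncn (2 / e)).+1 => //.
  rewrite ler_pdivrMr// mulrC -ler_pdivrMr// ltW//.
  by apply: Num.Theory.truncnS_gt.
(* [expmax a] is, up to [1 / N], the mean of the indicators of its [N] upper
   level sets, which are half-lines. *)
pose lev (k : nat) : R -> R := fun s => (k.+1%:R / N%:R <= expmax a s)%R%:R.
have levE k : (k < N)%N -> lev k = fun s => (s <= - ln (k.+1%:R / N%:R) / a)%R%:R.
  move=> kN; apply/funext => s; rewrite /lev; congr (nat_of_bool _)%:R.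
  set q := k.+1%:R / N%:R.
  have q0 : 0 < q by rewrite divr_gt0 ?ltr0n.
  have q1 : q <= 1 by rewrite ler_pdivrMr ?ltr0n// mul1r ler_nat.
  have lq : 0 <= - ln q / a by rewrite divr_ge0 ?(ltW a0)// oppr_ge0 ln_le0.
  rewrite /expmax -[X in X <= _](@lnK _ q)// ler_expR lerNr mulrC -ler_pdivlMr//.
  by rewrite ge_max lq andbT.
have mlev k : bm (lev k).
  split; last first.
    by exists 1 => s; rewrite /lev; case: (_ <= expmax a s); rewrite ?normr1 ?normr0.
  rewrite (_ : lev k = (fun t : R => (k.+1%:R / N%:R <= t)%R%:R) \o expmax a)//.
  apply: measurableT_comp; last exact: measurable_expmax.
  rewrite (_ : (fun t => _) = \1_(`[(k.+1%:R / N%:R), +oo[%classic : set R)).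
    exact: measurable_indic.
  apply/funext => t; rewrite indicE; have [h|h] := boolP (_ <= t).
    by rewrite mem_set/= ?in_itv/= ?h.
  by rewrite memNset/= ?in_itv/= ?andbT//; exact/negP.
have bS := bm_sum N mlev.
have NR : 0 < N%:R :> R by rewrite ltr0n.
pose S s := N%:R^-1 * \sum_(k < N) lev k s.
have bS' : bm S.
  case: bS => m [D sD]; split; first exact: measurable_funM.
  exists (N%:R^-1 * D) => s; rewrite normrM (@ger0_norm _ N%:R^-1) ?invr_ge0 ?(ltW NR)//.
  by rewrite ler_wpM2l ?invr_ge0 ?(ltW NR).
have dS : `|discrepancy S| <= C / r.
  rewrite discrepancyZ// normrM ger0_norm ?invr_ge0 ?(ltW NR)//.
  rewrite mulrC ler_pdivrMr// mulrC; apply: discrepancy_sum => // k kN.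
  by rewrite levE//; exact: discrepancy_step.
have gS s : `|expmax a s - S s| <= N%:R^-1.
  by apply: sum_levels => //; exact/expmax01/ltW.
have mgS : measurable_fun setT (fun s => expmax a s - S s).
  by apply: measurable_funB; [exact: measurable_expmax|case: bS'].
rewrite (_ : expmax a = fun s => (expmax a s - S s) + S s); last first.
  by apply/funext => s; rewrite subrK.
rewrite discrepancyD//; last by split => //; exists N%:R^-1.
apply: le_trans (ler_normD _ _) _; rewrite addrC lerD//.
exact: le_trans (discrepancy_le mgS gS) Ne.
Qed.

(** The weighted tail is [expmax a s - (1 - G s)]: on the negative side both terms are 1, on the
    positive side the second vanishes. Each contributes one [C / r]. *)
Lemma tilted_tail (a : R) (G : R -> R) : 0 <= a -> measurable_fun setT G ->
  (forall s, (0 < s)%R%:R <= G s <= (0 <= s)%R%:R) ->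
  `|iter n (avg Q w X) (fun s => expR (- (a * s)) * G s) 0 - millsR (a * r)|
    <= 2 * (C / r).
Proof.
move=> a0 mG G01.
have mG' : measurable_fun setT (fun s => 1 - G s) by exact: measurable_funB.
have G01' s : (s < 0)%R%:R <= 1 - G s <= (s <= 0)%R%:R.
  have /andP[h1 h2] := G01 s.
  have e1 : (s < 0)%R%:R = 1 - (0 <= s)%R%:R :> R.
    by rewrite ltNge; case: (0 <= s); rewrite /= ?subrr ?subr0.
  have e2 : (s <= 0)%R%:R = 1 - (0 < s)%R%:R :> R.
    by rewrite leNgt; case: (0 < s); rewrite /= ?subrr ?subr0.
  by rewrite e1 e2 !lerD2l !lerN2 h1 h2.
have G1 s : `|1 - G s| <= 1.
  have /andP[h1 h2] := G01' s; rewrite ger0_norm; last by apply: le_trans h1; rewrite ler0n.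
  by apply: le_trans h2 _; rewrite lern1 leq_b1.
have qe := qg_bounded (measurable_expmax a) (fun s => expmax_norm s a0).
rewrite (_ : (fun s => _) = (fun s => expmax a s - (1 - G s))); last first.
  apply/funext => s; have := G01 s; rewrite /expmax.
  have [s0|s0|s0] := ltrgtP 0 s.
  - by rewrite -eq_le => /eqP <-; rewrite mulr1 subrr subr0.
  - rewrite -eq_le => /eqP <-; rewrite mulr0 subr0.
    by rewrite mulr0 oppr0 expR0 subrr.
  - by move=> _; rewrite -s0 mulr0 oppr0 expR0 mul1r opprB addrC subrK.
rewrite (iterB w0 mw mX w1 wint1 wX2 _ qe (qg_bounded mG' G1)).
have h1 := expmax_discrepancy a0; have := BE mG' G01'.
rewrite mul0r => h2.
have E (u v p q : R) : u - v - q = (u - (p + q)) - (v - p) by ring.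
rewrite (E _ _ (Phi 0)).
apply: le_trans (ler_normB _ _) _; rewrite mulr_natl mulr2n; exact: lerD.
Qed.

End level_approximation.

Section exponential_tilting.
Context {R : realType} d (Y : measurableType d) (Q : probability Y R) (xi : Y -> R).
Variables (h m a r : R).
Hypothesis mxi : measurable_fun setT xi.
Hypothesis a0 : a != 0.
Hypothesis wxi2 : wable Q (fun=> 1) (fun y => xi y ^+ 2).

Let mw1 : measurable_fun setT (fun _ : Y => 1 : R). Proof. exact: measurable_cst. Qed.

Lemma wable1 : wable Q (fun=> 1) (fun=> 1).
Proof.
split => //; rewrite (_ : _ \o _ = EFin \o cst 1); first exact: finite_measure_integrable_cst.
by apply/funext => y /=; rewrite mulr1.
Qed.

Lemma wint11 : wint Q (fun=> 1) (fun=> 1) = 1.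
Proof.
rewrite /wint mulr1 /Rintegral integral_cst// mul1e.
exact: (congr1 fine (probability_setT Q)).
Qed.

(** The factor [expR (- (h * _))] on the test function cancels the density at every averaging, which
    leaves one [r^-1] and moves the offset by [m]. The general [s] and [c] make the induction go
    through. *)
Lemma iter_avg_tilt n (G : R -> R) c s : quadratic_growth G ->
  iter n (avg Q (fun y => expR (h * xi y) / r) (fun y => (xi y - m) / a))
    (fun t => expR (- (h * (a * t + c))) * G (a * t + c)) s =
  r^-1 ^+ n * expR (- (h * (a * s + (c - n%:R * m)))) *
    iter n (avg Q (fun=> 1) xi) G (a * s + (c - n%:R * m)).
Proof.
move=> qG; elim: n s => [|n IHn] s; first by rewrite expr0 mul1r mul0r subr0.
have qGn := qg_iter (fun=> ler01) mw1 mxi wable1 wint11 wxi2 n qG.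
rewrite iterS [in RHS]iterS {1}/avg.
set u := a * s + (c - n.+1%:R * m).
rewrite (eq_wint Q _ (b := fun y => r^-1 ^+ n * expR (- (h * (u + xi y))) *
  iter n (avg Q (fun=> 1) xi) G (u + xi y))); last first.
  move=> y; rewrite IHn (_ : a * (s + (xi y - m) / a) + (c - n%:R * m) = u + xi y)//.
  by rewrite /u -natr1; field.
have [_ ig] := wable_qg mw1 mxi wable1 wxi2 u qGn.
rewrite /avg /wint -RintegralZl//; apply: eq_Rintegral => y _.
rewrite mulrDr opprD expRD exprS mulr1 [expR (- (h * xi y))]expRN.
have e0 : expR (h * xi y) != 0 by rewrite gt_eqF ?expR_gt0.
set E := expR (- (h * u)); set H := expR (h * xi y) in e0 *.
set I := iter _ _ _ _; set rn := r^-1 ^+ n.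
by move: (r^-1) E H I rn e0 => ri E H I rn e0; field.
Qed.

Lemma iter_avg_untilt n (G : R -> R) : quadratic_growth G -> r != 0 ->
  iter n (avg Q (fun=> 1) xi) G 0 = r ^+ n * iter n
    (avg Q (fun y => expR (h * xi y) / r) (fun y => (xi y - m) / a))
    (fun t => expR (- (h * (a * t + n%:R * m))) * G (a * t + n%:R * m)) 0.
Proof.
move=> qG r0; rewrite iter_avg_tilt// mulr0 add0r subrr mulr0 oppr0 expR0 mulr1.
by rewrite exprVn mulrA divff ?mul1r// expf_neq0.
Qed.

End exponential_tilting.

(** * The law of a sum of independent variables *)

Section law_on_event.
Local Open Scope ereal_scope.
Context d d' (T : measurableType d) (T' : measurableType d') (R : realType).
Context (P : probability T R) (E : set T) (mE : measurable E) (f : T -> T').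
Hypothesis mf : measurable_fun setT f.

(** The law of [f] on the event [E], left unnormalised so that [E] may be null. *)
Definition law_on of measurable_fun setT f := fun A : set T' => mrestr P mE (f @^-1` A).

Local Notation law := (law_on mf).

Let measurable_preim A : measurable A -> measurable (f @^-1` A).
Proof. by move=> mA; rewrite -[X in measurable X]setTI; exact: mf. Qed.

Let law_on0 : law set0 = 0.
Proof. by rewrite /law_on preimage_set0 measure0. Qed.

Let law_on_ge0 A : 0 <= law A.
Proof. exact: measure_ge0. Qed.

Let law_on_sigma_additive : semi_sigma_additive law.
Proof.
move=> F mF tF mUF; rewrite /law_on preimage_bigcup.
apply: measure_semi_sigma_additive.
- by move=> n; exact: measurable_preim.
- apply/trivIsetP => /= i j _ _ ij; rewrite -preimage_setI.
  by move/trivIsetP : tF => /(_ _ _ _ _ ij) ->//; rewrite preimage_set0.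
- by rewrite -preimage_bigcup; exact: measurable_preim.
Qed.

HB.instance Definition _ := isMeasure.Build _ _ _ law
  law_on0 law_on_ge0 law_on_sigma_additive.

Let law_on_fin : fin_num_fun law.
Proof. by move=> A mA; apply: fin_num_measure; exact: measurable_preim. Qed.

HB.instance Definition _ := @Measure_isFinite.Build _ _ _ law law_on_fin.

Lemma ge0_integral_law_on (g : T' -> \bar R) : measurable_fun setT g ->
  (forall y, 0 <= g y) -> \int[law]_y g y = \int[mrestr P mE]_t g (f t).
Proof. by move=> mg g0; rewrite (ge0_integral_pushforward mf). Qed.

End law_on_event.

Section law_of_sum.
Context d (T : measurableType d) (R : realType) (P : probability T R).
Context (Z : nat -> {RV P >-> R}) (V : cumulativeBounded (0 : R) (1 : R)).
Hypothesis indep : mutually_independent Z.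
Hypothesis ZV : forall n y, cdf (Z n) y = (V y)%:E.

Local Notation TR := (measurableTypeR R).
Local Notation muV := (lebesgue_stieltjes_measure V).

Let id_TR : TR -> R := idfun.

Let Z_TR n : T -> TR := Z n.

Let mZ n : measurable_fun setT (Z n). Proof. exact: measurable_funPT. Qed.

(** The common cdf makes the two measures agree on half-open intervals, which determine a
    Lebesgue-Stieltjes measure. *)
Lemma law_lebesgue_stieltjes n (A : set TR) : measurable A ->
  muV A = P (Z n @^-1` A).
Proof.
move=> mA.
have mZn : measurable_fun setT (Z_TR n) by exact: mZ.
pose Zn : {mfun T >-> TR} := HB.pack (Z_TR n) (isMeasurableFun.Build _ _ _ _ (Z_TR n) mZn).
apply: (@lebesgue_stieltjes_measure_unique R V (pushforward P Zn)) => // I [[a b]] /= _ <-.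
rewrite /lebesgue_stieltjes_measure /measure_extension/=.
rewrite measurable_mu_extE/=; last exact: is_ocitv.
have [ab | ba] := leP a b; last first.
  by rewrite set_itv_ge ?wlength0 ?measure0// bnd_simp -leNgt ltW.
rewrite wlength_itv_bnd// EFinB -!(ZV n).
rewrite /cdf /distribution /pushforward /=.
have -> : `]a, b]%classic = `]-oo, b] `\` `]-oo, a].
  by rewrite -[RHS]setCK setCD setCitvl setUC -[LHS]setCK setCitv.
rewrite -[RHS]/(P ((Z n @^-1` `]-oo, b]) `\` (Z n @^-1` `]-oo, a]))) measureD ?setIidr//.
- by apply: preimage_subset; exact: subset_itvl.
- exact: measurable_funPTI.
- exact: measurable_funPTI.
- by rewrite -ge0_fin_numE// fin_num_measure//; exact: measurable_funPTI.
Qed.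

Let event (s : seq nat) (B : nat -> set R) := \bigcap_(i in [set` s]) (Z i @^-1` B i).

Let measurable_event s B : (forall i, measurable (B i)) -> measurable (event s B).
Proof.
move=> mB; apply: fin_bigcap_measurable; first exact: finite_seq.
by move=> i _; exact: measurable_funPTI.
Qed.

Let partial_sum n (t : T) : R := \sum_(i < n) Z i t.

Let mpartial_sum n : measurable_fun setT (partial_sum n).
Proof. by apply: measurable_sum => i. Qed.

Let avgV := avg muV (fun=> 1) id_TR.

Hypothesis V2 : wable muV (fun=> 1) (fun y => id_TR y ^+ 2).

Let mid_TR : measurable_fun setT id_TR. Proof. exact: measurable_id. Qed.

Let mw1 : measurable_fun setT (fun _ : TR => 1 : R). Proof. exact: measurable_cst. Qed.

(** The event constrains variables of index at least [n] only. Carrying it along lets the induction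
    peel off [Z n] with independence in its product form for events; bounds on [G] make Tonelli and
    the iterates of [avg] available. *)
Lemma law_partial_sum_event n s B (mB : forall i, measurable (B i)) (G : R -> R) D :
  uniq s -> (forall i, i \in s -> (n <= i)%N) ->
  measurable_fun setT G -> (forall x, 0 <= G x <= D) ->
  (\int[mrestr P (measurable_event s mB)]_t (G (partial_sum n t))%:E =
   (iter n avgV G 0)%:E * P (event s B))%E.
Proof.
elim: n s B mB G D => [|n IHn] s B mB G D us sn mG G0D.
  under eq_integral do rewrite /partial_sum big_ord0.
  rewrite integral_cst//; congr (_ * _)%E.
  by rewrite -[LHS]/(P (setT `&` event s B)) setTI.
have G0 x : 0 <= G x by case/andP: (G0D x).
have GD x : `|G x| <= D by rewrite ger0_norm//; case/andP: (G0D x).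
have qG := qg_bounded mG GD.
set mE := measurable_event s mB.
have mS := mpartial_sum n.
have mZn : measurable_fun setT (Z_TR n) by exact: mZ.
pose F t := (partial_sum n t, Z_TR n t).
have mF : measurable_fun setT F by apply/measurable_fun_pairP.
pose g (p : R * TR) := (G (p.1 + id_TR p.2))%:E.
have mg : measurable_fun setT g.
  apply/measurable_EFinP; apply: measurableT_comp => //.
  by apply: measurable_funD => //; exact: measurableT_comp.
have g0 p : (0 <= g p)%E by rewrite lee_fin.
have avg0D x : 0 <= avgV G x <= D.
  apply/andP; split; first by apply: wint_ge0 => // y.
  have := iter_bounded (fun=> ler01) mw1 mid_TR (wable1 muV) (wint11 muV) V2 1 mG GD x.
  by move=> /ler_normlW.
have mavg : measurable_fun setT (avgV G).
  by have [] := qg_avg (fun=> ler01) mw1 mid_TR (wable1 muV) (wint11 muV) V2 qG.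
(* Rectangles suffice. The condition on [Z n] joins the event, as [n :: s] with [B']; the induction
   hypothesis for [s] and for [n :: s] then differs by the factor P(Z_n in A'). *)
have muF (C : set (R * TR)) : measurable C ->
    (law_on P mE mS \x muV)%E C = law_on P mE mF C.
  move=> mC; apply: (@product_measure_unique _ _ R TR R
    (law_on P mE mS) muV (law_on P mE mF)) mC => A A' mA mA'.
  have IHA (s' : seq nat) (B' : nat -> set R) (mB' : forall i, measurable (B' i)) : uniq s' ->
      (forall i, i \in s' -> (n <= i)%N) ->
      (P (partial_sum n @^-1` A `&` event s' B') = (iter n avgV \1_A 0)%:E * P (event s' B'))%E.
    move=> us' ns'; rewrite -(IHn s' B' mB' \1_A 1 us' ns'); last 2 first.
    - exact: measurable_indic.
    - by move=> x; rewrite indicE; case: (x \in A); rewrite ?lexx ?ler01.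
    have mSA : measurable (partial_sum n @^-1` A) by rewrite -[X in measurable X]setTI; exact: mS.
    transitivity (\int[mrestr P (measurable_event s' mB')]_t (\1_(partial_sum n @^-1` A) t)%:E)%E.
      by rewrite integral_indic// setIT.
    by apply: eq_integral => t _; rewrite !indicE.
  pose B' i := if i == n then A' : set R else B i.
  have mB' i : measurable (B' i) by rewrite /B'; case: eqP.
  have ns : n \notin s by apply/negP => /sn; rewrite ltnn.
  have B's i : i \in s -> B' i = B i.
    by move=> si; rewrite /B'; case: eqP => // ni; move: ns; rewrite -ni si.
  have E1 : event (n :: s) B' = Z n @^-1` A' `&` event s B.
    apply/seteqP; split => t.
    - move=> h; split.
        by have := h n; rewrite /= mem_head /B' eqxx; exact.
      move=> i /= si; have := h i; rewrite /= in_cons si orbT B's//; exact.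
    - move=> [h1 h2] i /=; rewrite in_cons => /orP[/eqP ->|si].
        by rewrite /B' eqxx.
      by rewrite B's//; exact: h2.
  have uns : uniq (n :: s) by rewrite /= ns.
  have PE : (P (event (n :: s) B') = P (Z n @^-1` A') * P (event s B))%E.
    rewrite /event !indep//; try by move=> i _.
    rewrite big_cons {1}/B' eqxx; congr (_ * _)%E.
    by rewrite !big_seq; apply: eq_bigr => i si; rewrite B's.
  rewrite -[LHS]/(P (F @^-1` (A `*` A') `&` event s B)).
  rewrite -[X in (X * _)%E]/(P (partial_sum n @^-1` A `&` event s B)).
  have -> : F @^-1` (A `*` A') `&` event s B = partial_sum n @^-1` A `&` event (n :: s) B'.
    by rewrite E1 setIA.
  rewrite !IHA//; last 2 first.
  - by move=> i /sn /ltnW.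
  - by move=> i; rewrite in_cons => /orP[/eqP ->//|/sn /ltnW].
  rewrite PE -muleA; congr (_ * _)%E; rewrite muleC; congr (_ * _)%E.
  exact/esym/law_lebesgue_stieltjes.
transitivity (\int[law_on P mE mF]_p g p)%E.
  rewrite ge0_integral_law_on//.
  by apply: eq_integral => t _; rewrite /g /F/= /partial_sum big_ord_recr.
transitivity (\int[law_on P mE mS \x muV]_p g p)%E.
  by apply: eq_measure_integral => C mC _; exact/esym/muF.
rewrite fubini_tonelli1//.
transitivity (\int[law_on P mE mS]_x (avgV G x)%:E)%E.
  apply: eq_integral => x _; rewrite /fubini_F /avgV /avg wintE; last first.
    exact: (wable_qg mw1 mid_TR (wable1 muV) V2 x qG).
  by apply: eq_integral => y _; rewrite mulr1.
rewrite ge0_integral_law_on//; last 2 first.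
- by apply/measurable_EFinP.
- by move=> x; rewrite lee_fin; case/andP: (avg0D x).
rewrite (IHn s B mB (avgV G) D)// -?iterSr//.
by move=> i /sn /ltnW.
Qed.

Lemma cdf_partial_sum n c :
  fine (P [set t | \sum_(i < n) Z i t <= c]) = iter n avgV (fun s => (s <= c)%R%:R) 0.
Proof.
pose B (i : nat) : set R := setT.
have mB i : measurable (B i) by exact: measurableT.
have PE : P (event [::] B) = 1%E by rewrite /event indep// big_nil.
have step01 (x : R) : 0 <= ((x <= c)%R%:R : R) <= 1 by case: (x <= c); rewrite ?lexx ?ler01.
have nil_ge (i : nat) : i \in [::] -> (n <= i)%N by [].
have := @law_partial_sum_event n [::] B mB _ 1 isT nil_ge (measurable_step c) step01.
rewrite PE mule1 => E; apply: (etrans _ (congr1 fine E)); congr fine.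
have mS : measurable [set t | \sum_(i < n) Z i t <= c].
  rewrite [X in measurable X](_ : _ = partial_sum n @^-1` `]-oo, c]).
    by rewrite -[X in measurable X]setTI; exact: mpartial_sum.
  by apply/seteqP; split => t /=; rewrite in_itv.
transitivity (\int[mrestr P (measurable_event [::] mB)]_t (\1_[set t | \sum_(i < n) Z i t <= c] t)%:E)%E.
  rewrite integral_indic// setIT -[RHS]/(P ([set t | \sum_(i < n) Z i t <= c] `&` event [::] B)).
  by congr (P _); apply/seteqP; split => [t h|t []//]; split.
apply: eq_integral => t _; rewrite indicE; congr (_%:R)%:E.
by congr nat_of_bool; apply/idP/idP => h; [exact: set_mem h|exact: mem_set].
Qed.

End law_of_sum.

(** * Exponential moments *)

Section exp_bounds.
Context {R : realType}.
Implicit Types (x u : R).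

Lemma expR_sub1_le x : `|expR x - 1| <= `|x| * expR `|x|.
Proof.
have h (u : R) : 0 <= u -> expR u - 1 <= u * expR u.
  move=> u0; have := expR_ge1Dx (- u); rewrite expRN => e1.
  have e0 := expR_gt0 u; set e := expR u in e1 e0 *.
  have : (1 - u) * e <= e^-1 * e by rewrite ler_wpM2r// ltW.
  rewrite mulVf ?gt_eqF//; lra.
have [x0|x0] := leP 0 x.
  by rewrite (ger0_norm x0) ger0_norm ?h// subr_ge0 -[leLHS]expR0 ler_expR.
rewrite (ltr0_norm x0) ltr0_norm ?subr_lt0; last by rewrite -[ltRHS]expR0 ltr_expR.
have := expR_ge1Dx x => e1; apply: (@le_trans _ _ (- x)); first lra.
by rewrite ler_peMr ?oppr_ge0 ?(ltW x0)// -[leLHS]expR0 ler_expR oppr_ge0 ltW.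
Qed.

Lemma expR_taylor1_le x : `|expR x - 1 - x| <= x ^+ 2 * expR `|x|.
Proof.
have d (y : R) : is_derive y 1 (fun y => expR y - 1 - y) (expR y - 1).
  by apply: is_derive_eq; rewrite ?subr0.
have [r rx] := mvt_shift 0 x d.
rewrite add0r expR0 subrr subr0 subr0 add0r => ->.
rewrite normrM; apply: le_trans (ler_wpM2r (normr_ge0 x) (expR_sub1_le r)) _.
rewrite -[x ^+ 2]real_normK ?num_real// expr2 mulrAC.
apply: ler_pM; rewrite ?mulr_ge0 ?expR_ge0 ?ler_expR//.
by apply: ler_pM.
Qed.

Lemma expn_le_expR (a u : R) k : 0 < a -> 0 <= u ->
  u ^+ k <= (k`!%:R / a ^+ k) * expR (a * u).
Proof.
move=> a0 u0; have au : 0 <= a * u by rewrite mulr_ge0// ltW.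
have kf : 0 < k`!%:R :> R by rewrite ltr0n fact_gt0.
have h : (a * u) ^+ k <= k`!%:R * expR (a * u).
  case: k kf => [|k] kf.
    by rewrite expr0 fact0 mul1r -[leLHS]expR0 ler_expR.
  have e1 : (a * u) ^+ k.+1 / k.+1`!%:R <= expR (a * u).
    by apply: le_trans (expR_ge1Dxn k au); rewrite lerDr.
  by move: e1; rewrite ler_pdivrMr// [leRHS]mulrC.
rewrite mulrAC ler_pdivlMr ?exprn_gt0//; apply: le_trans h.
by rewrite exprMn mulrC.
Qed.

(** Takes the place of differentiation under the integral sign: [Vmom_taylor] already provides a
    remainder quadratic in [t]. *)
Lemma is_derive_of_quadratic (f : R -> R) x l C e : 0 < e ->
  (forall t, `|t| <= e -> `|f (x + t) - f x - t * l| <= C * t ^+ 2) ->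
  is_derive x 1 f l.
Proof.
move=> e0 fC.
have C0 : 0 <= C.
  have ee : `|e| <= e by rewrite (ger0_norm (ltW e0)).
  by have := le_trans (normr_ge0 _) (fC e ee); rewrite pmulr_lge0// exprn_gt0.
have cv : h^-1 *: (f (h *: (1 : R) + x) - f x) @[h --> 0^'] --> l.
  apply/cvgrPdist_le => /= eps eps0; near=> t.
  have t0 : t != 0 by near: t; exact: nbhs_dnbhs_neq.
  rewrite /GRing.scale/= mulr1 [t + x]addrC.
  have te : `|t| <= e.
    by near: t; apply: dnbhs0_le.
  have tC : `|t| <= eps / (C + 1).
    by near: t; apply: dnbhs0_le; rewrite divr_gt0// ltr_wpDl.
  rewrite distrC (_ : t^-1 * _ - l = t^-1 * (f (x + t) - f x - t * l)); last by field.
  rewrite normrM normfV mulrC ler_pdivrMr ?normr_gt0//.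
  apply: le_trans (fC _ te) _; rewrite -[t ^+ 2]real_normK ?num_real// expr2 mulrA.
  rewrite ler_wpM2r//; move: tC; rewrite ler_pdivlMr ?ltr_wpDl// => tC.
  by apply: le_trans tC; rewrite mulrC ler_wpM2l// lerDl.
by apply: DeriveDef; [apply/cvg_ex; exists l|exact/cvg_lim].
Unshelve. all: by end_near. Qed.

End exp_bounds.

Section exponential_moments.
Context {R : realType} (V : cumulativeBounded (0 : R) (1 : R)) (A : R).
Local Notation TR := (measurableTypeR R).
Local Notation muV := (lebesgue_stieltjes_measure V).
Hypothesis A0 : 0 < A.
Hypothesis expV : forall h : R, `|h| < A -> exp_integrable V h.

Let id_TR : TR -> R := idfun.
Let mid_TR : measurable_fun setT id_TR. Proof. exact: measurable_id. Qed.
Let mw1 : measurable_fun setT (fun _ : TR => 1 : R). Proof. exact: measurable_cst. Qed.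
(** The dominating function [expR (2 * a * |y|)] stays integrable, as [2 * a < A]; one [a] is for
    the tilt, the other for powers of [y]. *)
Let a : R := A / 4.
Let a0 : 0 < a. Proof. by rewrite divr_gt0. Qed.

Definition Vint (f : TR -> R) : R := wint muV (fun=> 1) f.
Definition Vable (f : TR -> R) : Prop := wable muV (fun=> 1) f.

Lemma Vable_exp h : `|h| < A -> Vable (fun y => expR (h * id_TR y)).
Proof.
move=> hA; split.
  by apply: measurableT_comp => //; exact: measurable_funM.
have := expV hA; apply: eq_integrable => // y _ /=.
by rewrite mulr1.
Qed.

Lemma mgfE h : mgf V h = Vint (fun y => expR (h * id_TR y)).
Proof. by rewrite /mgf /Vint /wint /Rintegral; congr fine; apply: eq_integral => y _; rewrite mulr1. Qed.

Let dom (y : TR) : R := expR (2 * a * `|id_TR y|).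

Let measurable_exp_norm c : measurable_fun setT (fun y : TR => expR (c * `|id_TR y|)).
Proof.
apply: measurableT_comp => //; apply: measurable_funM => //.
exact: measurableT_comp.
Qed.

Lemma Vable_exp_norm c : 0 <= c -> c < A -> Vable (fun y => expR (c * `|id_TR y|)).
Proof.
move=> c0 cA; apply: (@wable_le _ _ _ _ _ mw1 _
  (fun y => expR (c * id_TR y) + expR (- c * id_TR y))).
- exact: measurable_exp_norm.
- move=> y; rewrite ger0_norm ?expR_ge0//.
  have [y0|y0] := leP 0 (id_TR y).
    by rewrite ger0_norm// lerDl expR_ge0.
  by rewrite ltr0_norm// mulrN mulNr lerDr expR_ge0.
- by apply: wableD; apply: Vable_exp; rewrite ?normrN ger0_norm.
Qed.

Let Vable_dom : Vable dom.
Proof.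
apply: Vable_exp_norm; first by rewrite mulr_ge0// ltW.
by rewrite /a; have := A0; lra.
Qed.

Let D : R := Vint dom.

Let pow_exp_le (k : nat) (h : R) (y : TR) : `|h| <= a ->
  `|id_TR y| ^+ k * expR (`|h| * `|id_TR y|) <= (k`!%:R / a ^+ k) * dom y.
Proof.
move=> ha; apply: (@le_trans _ _ ((k`!%:R / a ^+ k) * expR (a * `|id_TR y|) *
    expR (a * `|id_TR y|))).
  apply: ler_pM; rewrite ?expR_ge0 ?exprn_ge0//.
    exact: expn_le_expR.
  by rewrite ler_expR ler_wpM2r.
by rewrite -mulrA -expRD -mulrDl /dom [2 * a]mulr_natl mulr2n.
Qed.

Definition Vmom (k : nat) (h : R) : R := Vint (fun y => id_TR y ^+ k * expR (h * id_TR y)).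

Let measurable_mom k h : measurable_fun setT (fun y : TR => id_TR y ^+ k * expR (h * id_TR y)).
Proof.
apply: measurable_funM; first exact: measurable_funX.
by apply: measurableT_comp => //; exact: measurable_funM.
Qed.

Lemma Vable_mom k h : `|h| <= a -> Vable (fun y => id_TR y ^+ k * expR (h * id_TR y)).
Proof.
move=> ha; apply: (@wable_le _ _ _ _ _ mw1 _ (fun y => (k`!%:R / a ^+ k) * dom y)) => //.
- move=> y; apply: le_trans (pow_exp_le k y ha).
  rewrite normrM normrX (ger0_norm (expR_ge0 _)) ler_wpM2l ?exprn_ge0// ler_expR -normrM.
  exact: ler_norm.
- exact: wableZ.
Qed.

(** The Taylor remainder of [expR (t * y)] brings two more powers of [y]; [pow_exp_le] then
    dominates the integrand uniformly in [h]. The linear coefficient is the next moment, so [Vmom k]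
    is the k-th derivative of the moment generating function. *)
Lemma Vmom_taylor k h t : `|h| + `|t| <= a ->
  `|Vmom k (h + t) - Vmom k h - t * Vmom k.+1 h| <= ((k.+2)`!%:R / a ^+ k.+2 * D) * t ^+ 2.
Proof.
move=> hta; have ha : `|h| <= a by apply: le_trans hta; rewrite lerDl.
have hta' : `|h + t| <= a by apply: le_trans hta; exact: ler_normD.
have i1 := Vable_mom k hta'; have i2 := Vable_mom k ha; have i3 := Vable_mom k.+1 ha.
have i12 := wableB i1 i2; have i4 := wableZ t i3.
rewrite /Vmom /Vint -wintZ// -wintB// -wintB//.
rewrite mulrC mulrA -/D /D /Vint -wintZ//; apply: wint_norm_le => //; first exact: wableB.
  exact: wableZ.
move=> y; set u := id_TR y.
have -> : u ^+ k * expR ((h + t) * u) - u ^+ k * expR (h * u) - t * (u ^+ k.+1 * expR (h * u)) =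
    u ^+ k * expR (h * u) * (expR (t * u) - 1 - t * u).
  by rewrite mulrDl expRD exprS; ring.
rewrite !normrM normrX (ger0_norm (expR_ge0 _)).
apply: (@le_trans _ _ (`|u| ^+ k * expR (`|h| * `|u|) * ((t * u) ^+ 2 * expR (`|t| * `|u|)))).
  apply: ler_pM; rewrite ?mulr_ge0 ?exprn_ge0 ?expR_ge0//.
    by rewrite ler_wpM2l ?exprn_ge0// ler_expR -normrM ler_norm.
  by apply: le_trans (expR_taylor1_le _) _; rewrite normrM.
have -> : `|u| ^+ k * expR (`|h| * `|u|) * ((t * u) ^+ 2 * expR (`|t| * `|u|)) =
    t ^+ 2 * (`|u| ^+ k.+2 * expR (`| (`|h| + `|t|)| * `|u|)).
  have hn : `| (`|h| + `|t|)| = `|h| + `|t| by rewrite ger0_norm ?addr_ge0.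
  by rewrite hn exprMn -[u ^+ 2]real_normK ?num_real// [(_ + _) * `|u|]mulrDl expRD !exprS; ring.
rewrite -[leRHS]mulrA ler_wpM2l ?sqr_ge0//; apply: pow_exp_le.
by rewrite ger0_norm ?addr_ge0.
Qed.

Lemma is_derive_mgf (h : R) : `|h| < a -> is_derive h 1 (mgf V) (Vmom 1 h).
Proof.
move=> ha; apply: (@is_derive_of_quadratic _ _ _ _ (2`!%:R / a ^+ 2 * D) (a - `|h|)).
  by rewrite subr_gt0.
move=> t ta; have := @Vmom_taylor 0 h t; rewrite -lerBrDl => /(_ ta).
suff E x : mgf V x = Vmom 0 x by rewrite !E.
by rewrite mgfE; apply: eq_wint => y; rewrite expr0 mul1r.
Qed.

Variable sigma : R.
Hypothesis sigma0 : 0 < sigma.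
Hypothesis EV : Vint id_TR = 0.
Hypothesis EV2 : Vint (fun y => id_TR y ^+ 2) = sigma ^+ 2.

Let Vmom0 : Vmom 0 0 = 1.
Proof.
rewrite -(wint11 muV); apply: eq_wint => y.
by rewrite mul0r expR0 expr0 mulr1.
Qed.

Let Vmom1 : Vmom 1 0 = 0.
Proof. by rewrite -[RHS]EV; apply: eq_wint => y; rewrite mul0r expR0 mulr1 expr1. Qed.

Let Vmom2 : Vmom 2 0 = sigma ^+ 2.
Proof. by rewrite -EV2; apply: eq_wint => y; rewrite mul0r expR0 mulr1. Qed.

Let mgf_Vmom h : mgf V h = Vmom 0 h.
Proof. by rewrite mgfE; apply: eq_wint => y; rewrite expr0 mul1r. Qed.

Lemma Vmom_bounds : exists2 C, 0 < C & forall h, `|h| <= a ->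
  [/\ `|mgf V h - 1| <= C * h ^+ 2, `|Vmom 1 h - sigma ^+ 2 * h| <= C * h ^+ 2 &
      `|Vmom 2 h - sigma ^+ 2| <= C * `|h|].
Proof.
pose c k := (k.+2)`!%:R / a ^+ k.+2 * D.
have D0 : 0 <= D by apply: wint_ge0 => // y; exact: expR_ge0.
have c0 k : 0 <= c k by rewrite mulr_ge0// divr_ge0// exprn_ge0// ltW.
have T k h : `|h| <= a -> `|Vmom k h - Vmom k 0 - h * Vmom k.+1 0| <= c k * h ^+ 2.
  by move=> ha; have := @Vmom_taylor k 0 h; rewrite normr0 !add0r => /(_ ha).
exists (1 + c 0%N + c 1%N + c 2%N * a + `|Vmom 3 0|).
  have := mulr_ge0 (c0 2%N) (ltW a0); have := c0 1%N; have := c0 0%N.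
  by have := normr_ge0 (Vmom 3 0); lra.
move=> h ha; set C := (X in [/\ _ <= X * _, _ & _]).
have h2 : 0 <= h ^+ 2 by exact: sqr_ge0.
have c2a : 0 <= c 2%N * a by rewrite mulr_ge0// ltW.
have v3 := normr_ge0 (Vmom 3 0).
split.
- have := T 0%N h ha; rewrite Vmom0 Vmom1 mulr0 subr0 -mgf_Vmom => /le_trans; apply.
  by rewrite ler_wpM2r// /C; have := c0 1%N; lra.
- have := T 1%N h ha; rewrite Vmom1 Vmom2 subr0 mulrC => /le_trans; apply.
  by rewrite ler_wpM2r// /C; have := c0 0%N; lra.
- have t2 := T 2%N h ha; rewrite Vmom2 in t2.
  rewrite (_ : Vmom 2 h - sigma ^+ 2 =
    (Vmom 2 h - sigma ^+ 2 - h * Vmom 3 0) + h * Vmom 3 0); last by rewrite subrK.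
  apply: le_trans (ler_normD _ _) _; rewrite normrM.
  apply: (@le_trans _ _ (c 2%N * a * `|h| + `|h| * `|Vmom 3 0|)).
    rewrite lerD2r; apply: le_trans t2 _; rewrite -[h ^+ 2]real_normK ?num_real// expr2 mulrA.
    by rewrite ler_wpM2r// ler_wpM2l.
  rewrite [`|h| * _]mulrC -mulrDl ler_wpM2r// /C.
  by have := c0 1%N; have := c0 0%N; lra.
Qed.

End exponential_moments.

(** * Regularity of the Mills ratio *)

Section mills_ratio.
Context {R : realType}.
Implicit Types (x y : R).

Let gd0E x : expR (x ^+ 2 / 2) * gd x = gd 0.
Proof.
by rewrite /gd mulrCA -expRD; congr (_ * expR _); field.
Qed.

Lemma is_derive_millsR x : is_derive x 1 millsR (x * millsR x - gd 0).
Proof.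
have d1 : is_derive x 1 (fun y : R => y ^+ 2 / 2) x.
  by apply: is_derive_eq; rewrite /GRing.scale/=; field.
have d2 := @is_derive1_comp R expR (fun y : R => y ^+ 2 / 2) _ _ _ (is_derive_expR _) d1.
have d3 := is_derive_Phi x.
have -> : x * millsR x - gd 0 = expR (x ^+ 2 / 2) * (- gd x) + (1 - Phi x) * (expR (x ^+ 2 / 2) * x).
  by rewrite mulrN gd0E /millsR; ring.
by apply: is_derive_eq; rewrite /GRing.scale/=; ring.
Qed.

(** The two Mills inequalities give [0 <= gd 0 - x * millsR x <= gd 0 / (1 + x ^+ 2)]. This decay
    will compensate an error growing like h^2 sqrt n in the argument. *)
Lemma millsR_dec_bound x : 0 <= x -> `|x * millsR x - gd 0| <= (1 + x ^+ 2)^-1.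
Proof.
move=> x0; have e0 := expR_gt0 (x ^+ 2 / 2).
have x2 : 0 < 1 + x ^+ 2 by rewrite ltr_pwDl// sqr_ge0.
have h1 : x * millsR x <= gd 0.
  rewrite /millsR mulrCA -(gd0E x) ler_wpM2l ?(ltW e0)//; exact: mills_ub.
have h2 : x * gd 0 <= millsR x * (1 + x ^+ 2).
  rewrite /millsR -(gd0E x) mulrCA -mulrA ler_wpM2l ?(ltW e0)//; exact: mills_lb.
rewrite distrC ger0_norm ?subr_ge0// -[leRHS]mul1r ler_pdivlMr//.
apply: le_trans (gd_le1 0); rewrite mulrBl lerBlDr mulrDr mulr1 lerD2l.
by rewrite [X in _ <= X]mulrAC -[leRHS]mulrA [leRHS]mulrC; move: h2 x0; clear; nra.
Qed.

Lemma millsR_lip q x y : 0 <= q -> q <= x -> q <= y ->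
  `|millsR x - millsR y| <= `|x - y| / (1 + q ^+ 2).
Proof.
move=> q0; wlog xy : x y / y <= x.
  move=> H qx qy; have [yx|xy] := leP y x; first exact: H.
  by rewrite distrC [`|x - y|]distrC; apply: H => //; exact: ltW.
move=> qx qy.
have [z _||z] := @MVT_segment R millsR (fun z => z * millsR z - gd 0) y x xy.
- exact: is_derive_millsR.
- exact: continuous_subspaceT (continuous_of_is_derive is_derive_millsR).
- rewrite in_itv/= => /andP[yz _] ->; rewrite normrM mulrC ler_wpM2l//.
  have qz := le_trans qy yz.
  apply: le_trans (millsR_dec_bound (le_trans q0 qz)) _.
  rewrite lef_pV2 ?posrE ?ltr_pwDl ?sqr_ge0// lerD2l.
  by rewrite ler_pXn2r ?nnegrE// (le_trans q0 qz).
Qed.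

Lemma millsRE x : expR (- (x ^+ 2 / 2)) * millsR x = 1 - Phi x.
Proof. by rewrite /millsR mulrA -expRD addNr expR0 mul1r. Qed.

End mills_ratio.

(** * Tails of the sum under a tilt near 0 *)

Section tilted_sum.
Context {R : realType} (V : cumulativeBounded (0 : R) (1 : R)) (A sigma : R).
Local Notation TR := (measurableTypeR R).
Local Notation muV := (lebesgue_stieltjes_measure V).
Hypothesis A0 : 0 < A.
Hypothesis expV : forall h : R, `|h| < A -> exp_integrable V h.

Let id_TR : TR -> R := idfun.
Let mid_TR : measurable_fun setT id_TR. Proof. exact: measurable_id. Qed.
Let mw1 : measurable_fun setT (fun _ : TR => 1 : R). Proof. exact: measurable_cst. Qed.

Hypothesis sigma0 : 0 < sigma.
Hypothesis EV : Vint V id_TR = 0.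
Hypothesis EV2 : Vint V (fun y => id_TR y ^+ 2) = sigma ^+ 2.

Let a : R := A / 4.
Let a0 : 0 < a. Proof. by rewrite divr_gt0. Qed.

(** Mean, and below it variance, of the tilted law as quotients of moments; agreement with the
    derivative [tilted_mean] near 0 is [tilted_mean_near0]. *)
Definition tmean h : R := Vmom V 1 h / mgf V h.
Definition tvar h : R := Vmom V 2 h / mgf V h - tmean h ^+ 2.

Lemma tilt_bounds : exists2 C, 0 < C & exists2 e, 0 < e & forall h, `|h| <= e ->
  [/\ `|h| < a, 2^-1 <= mgf V h, `|tmean h - sigma ^+ 2 * h| <= C * h ^+ 2,
      `|tvar h - sigma ^+ 2| <= C * `|h| & sigma ^+ 2 / 4 <= tvar h /\ `|tmean h| <= 1].
Proof.
have [B B0 HB] := Vmom_bounds A0 expV EV EV2.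
have s20 : 0 < sigma ^+ 2 by rewrite exprn_gt0.
set s2 := sigma ^+ 2 in s20 HB *.
pose C1 := 2 * B + 2 * s2 * B.
have C10 : 0 < C1 by rewrite addr_gt0// !mulr_gt0.
pose C := C1 + (s2 + C1) ^+ 2.
have C0 : 0 < C by rewrite addr_gt0// exprn_gt0// addr_gt0.
exists C => //.
(* A sum of the reciprocals of all thresholds: [|h| * S <= 1] yields every smallness condition at
   once. *)
pose S := 1 + 2 / a + 2 * B + (s2 + C1) + 2 * C / s2.
have S1 : 0 < 2 / a by rewrite divr_gt0.
have S2 : 0 < 2 * C / s2 by rewrite divr_gt0// mulr_gt0.
have S0 : 0 < S by rewrite /S; lra.
exists S^-1; first by rewrite invr_gt0.
move=> h; rewrite -[S^-1]mul1r ler_pdivlMr// => hS.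
have ha0 := normr_ge0 h; set u := `|h| in hS ha0 *.
have uS (c : R) : c <= S -> u * c <= 1 by move=> cS; apply: le_trans hS; rewrite ler_wpM2l.
have u1 : u <= 1 by have := uS 1; rewrite mulr1; apply; rewrite /S; lra.
have ua : u * (2 / a) <= 1 by apply: uS; rewrite /S; lra.
have uB : u * (2 * B) <= 1 by apply: uS; rewrite /S; lra.
have uC1 : u * (s2 + C1) <= 1 by apply: uS; rewrite /S; lra.
have uC : u * (2 * C / s2) <= 1 by apply: uS; rewrite /S; lra.
have {}ua : u < a.
  move: ua; rewrite mulrA ler_pdivrMr// mul1r => ua.
  by have := a0; lra.
have {}uC : C * u <= s2 / 2 by move: uC; rewrite mulrA ler_pdivrMr// mul1r; lra.
have h2 : h ^+ 2 = u ^+ 2 by rewrite real_normK ?num_real.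
have [H1 H2 H3] := HB h (ltW ua).
have Bu2 : B * h ^+ 2 <= u / 2 by rewrite h2; nra.
have R2 : 2^-1 <= mgf V h.
  by have := H1; rewrite ler_norml => /andP[]; lra.
set r := (mgf V h)^-1; have Rgt0 : 0 < mgf V h by lra.
have r0 : 0 < r by rewrite invr_gt0.
have r2 : r <= 2 by rewrite /r -[2]invrK lef_pV2 ?posrE.
have rE : r - 1 = (1 - mgf V h) * r by rewrite mulrBl mul1r mulfV ?gt_eqF.
have r1 : `|r - 1| <= 2 * B * h ^+ 2.
  rewrite rE normrM distrC (ger0_norm (ltW r0)) mulrC -mulrA.
  by apply: ler_pM => //; exact: ltW.
have T1 : `|tmean h - s2 * h| <= C1 * h ^+ 2.
  rewrite (_ : tmean h - s2 * h = r * (Vmom V 1 h - s2 * h) + s2 * h * (r - 1)); last first.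
    by rewrite /tmean -/r; ring.
  apply: le_trans (ler_normD _ _) _; rewrite /C1 mulrDl lerD//.
    rewrite normrM (ger0_norm (ltW r0)) -mulrA.
    by apply: ler_pM => //; exact: ltW.
  rewrite (normrM (s2 * h)) (normrM s2) (ger0_norm (ltW s20)) -/u.
  apply: (@le_trans _ _ (s2 * u * (2 * B * h ^+ 2))).
    by rewrite ler_wpM2l// mulr_ge0// ltW.
  rewrite (_ : 2 * s2 * B * h ^+ 2 = s2 * 1 * (2 * B * h ^+ 2)); last by ring.
  apply: ler_wpM2r; first by apply: mulr_ge0 (sqr_ge0 _); rewrite mulr_ge0// ltW.
  by apply: ler_wpM2l => //; exact: ltW.
have T2 : `|tmean h| <= u * (s2 + C1).
  rewrite -[tmean h](subrK (s2 * h)); apply: le_trans (ler_normD _ _) _.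
  rewrite normrM (ger0_norm (ltW s20)) -/u mulrDr addrC lerD//; first by rewrite mulrC.
  apply: le_trans T1 _; rewrite mulrC ler_wpM2r ?(ltW C10)// h2 expr2.
  by rewrite ler_piMl.
have T3 : `|tvar h - s2| <= C * u.
  rewrite (_ : tvar h - s2 = r * (Vmom V 2 h - s2) + s2 * (r - 1) - tmean h ^+ 2); last first.
    by rewrite /tvar -/r; ring.
  apply: le_trans (ler_normB _ _) _; rewrite /C mulrDl lerD//.
    apply: le_trans (ler_normD _ _) _; rewrite /C1 mulrDl lerD//.
      rewrite normrM (ger0_norm (ltW r0)) -mulrA.
      by apply: ler_pM => //; exact: ltW.
    rewrite normrM (ger0_norm (ltW s20)).
    apply: (@le_trans _ _ (s2 * (2 * B * h ^+ 2))); first by rewrite ler_wpM2l// ltW.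
    rewrite h2 (_ : s2 * (2 * B * u ^+ 2) = 2 * s2 * B * (u * u)); last by ring.
    apply: ler_wpM2l; last by rewrite ler_piMl.
    by apply: mulr_ge0 (ltW B0); rewrite mulr_ge0// ltW.
  rewrite normrX; apply: (@le_trans _ _ ((u * (s2 + C1)) ^+ 2)).
    by rewrite ler_pXn2r ?nnegrE// mulr_ge0// addr_ge0// ltW.
  by rewrite exprMn mulrC ler_wpM2l ?sqr_ge0// expr2 ler_piMl.
split => //.
- by apply: le_trans T1 _; rewrite ler_wpM2r ?sqr_ge0// /C lerDl sqr_ge0.
- split; last exact: le_trans T2 uC1.
  by move: T3; rewrite ler_norml => /andP[]; lra.
Qed.

Lemma wintVE h f : 2^-1 <= mgf V h -> Vable V (fun y => f y * expR (h * id_TR y)) ->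
  measurable_fun setT f ->
  wable muV (fun y => expR (h * id_TR y) / mgf V h) f /\
  wint muV (fun y => expR (h * id_TR y) / mgf V h) f =
  Vint V (fun y => f y * expR (h * id_TR y)) / mgf V h.
Proof.
move=> R2 If mf; have := wableZ (mgf V h)^-1 If => -[m1 i1].
split.
  split => //; move: i1; apply: eq_integrable => // y _ /=.
  by congr EFin; ring.
rewrite mulrC /Vint -wintZ//; apply: eq_Rintegral => y _; ring.
Qed.

(** The signed standard deviation [s] may be negative, and then the half-line of [G] is a lower one.
    The condition [0 <= h * s] makes the exponential weight decay along that half-line in both
    cases. *)
Lemma tilted_sum_tail : exists2 C, 0 < C & exists2 e, 0 < e & forall h s, `|h| <= e ->
  s ^+ 2 = tvar h -> 0 <= h * s ->
  forall n (G : R -> R), (0 < n)%N -> measurable_fun setT G ->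
  (forall t, (0 < t)%R%:R <= G (s * t + n%:R * tmean h) <= (0 <= t)%R%:R) ->
  `|iter n (avg muV (fun=> 1) id_TR) G 0 -
    (mgf V h * expR (- (h * tmean h))) ^+ n * millsR (h * s * Num.sqrt n%:R)|
  <= (mgf V h * expR (- (h * tmean h))) ^+ n * (C / Num.sqrt n%:R).
Proof.
have [C1 C10 [e e0 He]] := tilt_bounds.
(* As [|s| >= sigma / 2], this gives [kappa / |s| <= a]; with [|tmean h| <= 1] the exponent
   [kappa * |X y|] is at most [a + a * |y|]. The moment bound [2 * (expR a * D)] follows, the 2 from
   [mgf V h >= 2^-1]. *)
pose kappa := Num.min 1 (a * sigma / 2).
have k01 : 0 < kappa <= 1.
  by rewrite lt_min ltr01/= divr_gt0 ?mulr_gt0//= ge_min lexx.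
pose D := Vint V (fun y => expR (2 * a * `|id_TR y|)).
have D0 : 0 <= D by apply: wint_ge0 => y; rewrite ?ler01 ?expR_ge0.
have [C C0 HC] := @berry_esseen R kappa (2 * (expR a * D)) k01.
exists (2 * C); first by rewrite mulr_gt0.
exists e => // h s he s2 hs n G n0 mG Gs.
have [ha R2 _ _ [v4 m1]] := He h he.
have Rgt0 : 0 < mgf V h by lra.
have s0 : s != 0.
  by rewrite -sqrf_eq0 s2 gt_eqF//; apply: lt_le_trans v4; rewrite divr_gt0// exprn_gt0.
set m := tmean h in Gs m1 *.
pose w (y : TR) := expR (h * id_TR y) / mgf V h.
pose X (y : TR) := (id_TR y - m) / s.
have w0 y : 0 <= w y by rewrite divr_ge0 ?expR_ge0// ltW.
have mw : measurable_fun setT w.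
  by apply: measurable_funM => //; apply: measurableT_comp => //; exact: measurable_funM.
have mX : measurable_fun setT X by apply: measurable_funM => //; exact: measurable_funB.
have wm k : wable muV w (fun y => id_TR y ^+ k) /\
    wint muV w (fun y => id_TR y ^+ k) = Vmom V k h / mgf V h.
  apply: wintVE => //; first exact: (Vable_mom A0 expV k (ltW ha)).
  exact: measurable_funX.
have m0E : Vmom V 0 h = mgf V h.
  by rewrite mgfE; apply: eq_wint => y; rewrite expr0 mul1r.
have [w1 W1] : wable muV w (fun=> 1) /\ wint muV w (fun=> 1) = 1.
  by have [] := wm 0%N; rewrite m0E divff ?gt_eqF.
have [wy Wy] : wable muV w id_TR /\ wint muV w id_TR = m.
  exact: (wm 1%N).
have [wy2 Wy2] := wm 2%N.
have EX : wint muV w X = 0.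
  transitivity (wint muV w (fun y => s^-1 * (id_TR y - m * 1))).
    by apply: eq_wint => y; rewrite mulr1 mulrC.
  rewrite wintZ; last by apply: wableB => //; exact: wableZ.
  by rewrite wintB//; [rewrite wintZ// W1 Wy mulr1 subrr mulr0|exact: wableZ].
have EX2 : wint muV w (fun y => X y ^+ 2) = 1.
  transitivity (wint muV w (fun y => (s ^+ 2)^-1 * (id_TR y ^+ 2 - 2 * m * id_TR y + m ^+ 2 * 1))).
    by apply: eq_wint => y; rewrite /X; field.
  have i1 := wableZ (2 * m) wy; have i2 := wableB wy2 i1; have i3 := wableZ (m ^+ 2) w1.
  rewrite wintZ; last exact: wableD.
  rewrite wintD// wintB// !wintZ// W1 Wy Wy2 s2 mulr1 /tvar -/m.
  have -> : Vmom V 2 h / mgf V h - 2 * m * m + m ^+ 2 = Vmom V 2 h / mgf V h - m ^+ 2 by ring.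
  by rewrite mulVf// -/(tvar h) -s2 sqrf_eq0.
have sk : kappa / `|s| <= a.
  rewrite ler_pdivrMr ?normr_gt0//; apply: (@le_trans _ _ (a * (sigma / 2))).
    by rewrite /kappa ge_min mulrA lexx orbT.
  rewrite ler_wpM2l ?(ltW a0)// -(@ler_pXn2r _ 2) ?nnegrE ?divr_ge0 ?(ltW sigma0)//.
  by rewrite real_normK ?num_real// s2; apply: le_trans v4; rewrite expr_div_n; lra.
have kX y : expR (kappa * `|X y|) <= expR a * expR (a * `|id_TR y|).
  rewrite -expRD ler_expR normrM normfV mulrCA mulrC.
  apply: (@le_trans _ _ (a * `|id_TR y - m|)).
    exact: ler_wpM2r.
  rewrite -{2}[a]mulr1 -mulrDr ler_wpM2l ?(ltW a0)//.
  by apply: le_trans (ler_normB _ _) _; rewrite addrC lerD2r.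
have [wexp Wexp] : wable muV w (fun y => expR (a * `|id_TR y|)) /\
    wint muV w (fun y => expR (a * `|id_TR y|)) <= 2 * D.
  have mea : measurable_fun setT (fun y : TR => expR (a * `|id_TR y|)).
    apply: measurableT_comp => //; apply: measurable_funM => //.
    exact: measurableT_comp.
  have Id : Vable V (fun y => expR (2 * a * `|id_TR y|)).
    apply: (Vable_exp_norm expV); first by rewrite mulr_ge0// ltW.
    by rewrite /a; have := A0; lra.
  have le_dom y : expR (a * `|id_TR y|) * expR (h * id_TR y) <= expR (2 * a * `|id_TR y|).
    rewrite -expRD ler_expR mulr_natl mulr2n mulrDl lerD2l.
    apply: le_trans (ler_norm _) _; rewrite normrM ler_wpM2r//; exact: ltW.
  have Ie : Vable V (fun y => expR (a * `|id_TR y|) * expR (h * id_TR y)).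
    apply: (@wable_le _ _ _ _ _ mw1 _ _ _ _ Id) => [|y].
      by apply: measurable_funM => //; apply: measurableT_comp => //; exact: measurable_funM.
    by rewrite ger0_norm// mulr_ge0 ?expR_ge0.
  have [h1 ->] := wintVE R2 Ie mea; split => //.
  rewrite ler_pdivrMr//; apply: (@le_trans _ _ D).
    by apply: le_wint => // y; exact: ler01.
  by rewrite mulrAC ler_peMl//; lra.
have mkX : measurable_fun setT (fun y => expR (kappa * `|X y|)).
  apply: measurableT_comp => //; apply: measurable_funM => //.
  exact: measurableT_comp.
have wX : wable muV w (fun y => expR (kappa * `|X y|)).
  apply: (@wable_le _ _ _ _ _ mw _ _ _ _ (wableZ (expR a) wexp)) => // y.
  by rewrite ger0_norm ?expR_ge0.
have HX : wint muV w (fun y => expR (kappa * `|X y|)) <= 2 * (expR a * D).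
  apply: (@le_trans _ _ (wint muV w (fun y => expR a * expR (a * `|id_TR y|)))).
    by apply: le_wint => //; exact: wableZ.
  by rewrite wintZ// mulrCA ler_wpM2l ?expR_ge0.
have BE := HC _ _ muV w X w0 mw mX w1 W1 EX EX2 wX HX.
have wX2 : wable muV w (fun y => X y ^+ 2).
  have i1 := wableZ (2 * m) wy; have i2 := wableB wy2 i1; have i3 := wableZ (m ^+ 2) w1.
  have := wableZ (s ^+ 2)^-1 (wableD i2 i3); congr (wable _ _ _).
  by apply/funext => y; rewrite /X; field.
have wV2 : wable muV (fun=> 1) (fun y => id_TR y ^+ 2).
  have := Vable_mom A0 expV 2 (h := 0); rewrite normr0 => /(_ (ltW a0)).
  congr (wable _ _ _); apply/funext => y.
  by rewrite mul0r expR0 mulr1.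
have G1 t : `|G t| <= 1.
  have := Gs ((t - n%:R * m) / s).
  have -> : s * ((t - n%:R * m) / s) + n%:R * m = t by field.
  move=> /andP[g0 g1]; rewrite ger0_norm; last by apply: le_trans g0; rewrite ler0n.
  by apply: le_trans g1 _; rewrite lern1 leq_b1.
have qG := qg_bounded mG G1.
rewrite (iter_avg_untilt (xi := id_TR) h m mid_TR s0 wV2 n qG (lt0r_neq0 Rgt0)).
pose G' t := G (s * t + n%:R * m).
have mG' : measurable_fun setT G'.
  by apply: measurableT_comp => //; apply: measurable_funD => //; exact: measurable_funM.
have G'1 t : `|G' t| <= 1 by exact: G1.
(* The weight may be unbounded for negative [t], but there [G'] vanishes. *)
have bexp t : `|expR (- (h * s * t)) * G' t| <= 1.
  have /andP[g0 g1] := Gs t.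
  have g0' : 0 <= G' t by apply: le_trans g0; rewrite ler0n.
  rewrite ger0_norm ?mulr_ge0 ?expR_ge0//.
  have [t0|t0] := leP 0 t.
    rewrite mulr_ile1 ?expR_ge0//; last by have := G'1 t; rewrite ger0_norm.
    by rewrite -[leRHS]expR0 ler_expR oppr_le0 mulr_ge0.
  have -> : G' t = 0 by apply/eqP; rewrite eq_le g0' andbT; move: g1; rewrite [0 <= t]leNgt t0.
  by rewrite mulr0.
have mexp : measurable_fun setT (fun t => expR (- (h * s * t)) * G' t).
  apply: measurable_funM => //; apply: measurableT_comp => //.
  by apply: measurableT_comp => //; exact: measurable_funM.
have -> : (fun t => expR (- (h * (s * t + n%:R * m))) * G (s * t + n%:R * m)) =
    (fun t => expR (- (h * m)) ^+ n * (expR (- (h * s * t)) * G' t)).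
  apply/funext => t; rewrite -expRM_natl mulrA -expRD; congr (expR _ * _); ring.
rewrite (iterZ w0 mw mX w1 W1 wX2 _ _ (qg_bounded mexp bexp)).
rewrite mulrA -exprMn -mulrBr normrM ger0_norm; last first.
  by rewrite exprn_ge0// mulr_ge0 ?expR_ge0// ltW.
apply: ler_wpM2l; first by rewrite exprn_ge0// mulr_ge0 ?expR_ge0// ltW.
rewrite -(mulrA 2 C); exact: (tilted_tail w0 mw mX w1 W1 wX2 n0 (ltW C0)
  (fun x G'' mG'' Gx => BE n x G'' n0 mG'' Gx) hs mG' Gs).
Qed.

End tilted_sum.

Section law_moments.
Context d (T : measurableType d) (R : realType) (P : probability T R).
Context (Z : nat -> {RV P >-> R}) (V : cumulativeBounded (0 : R) (1 : R)).
Hypothesis ZV : forall n y, cdf (Z n) y = (V y)%:E.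

Local Notation TR := (measurableTypeR R).
Local Notation muV := (lebesgue_stieltjes_measure V).

Let id_TR : TR -> R := idfun.

Let mid_TR : measurable_fun setT id_TR. Proof. exact: measurable_id. Qed.

Let Z_TR n : T -> TR := Z n.

Let mZ n : measurable_fun setT (Z n). Proof. exact: measurable_funPT. Qed.

Lemma integral_law n (f : TR -> \bar R) : measurable_fun setT f ->
  (\int[muV]_y f y = \int[P]_t f (Z n t))%E.
Proof.
move=> mf; have mZn : measurable_fun setT (Z_TR n) by exact: mZ.
have ge0_case (g : TR -> \bar R) : measurable_fun setT g -> (forall y, (0 <= g y)%E) ->
    (\int[muV]_y g y = \int[P]_t g (Z n t))%E.
  move=> mg g0; rewrite (@eq_measure_integral _ _ _ _ (pushforward P (Z_TR n))); last first.
    by move=> A mA _; exact: (law_lebesgue_stieltjes ZV n mA).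
  by rewrite ge0_integral_pushforward.
have mp : measurable_fun setT f^\+%E by exact: measurable_funepos.
have mn : measurable_fun setT f^\-%E by exact: measurable_funeneg.
rewrite integralE [RHS]integralE (ge0_case _ mp) => [|y]; last exact: funepos_ge0.
rewrite (ge0_case _ mn) => [|y]; last exact: funeneg_ge0.
by congr (_ - _)%E; apply: eq_integral => t _; rewrite ?funeposE ?funenegE.
Qed.

Lemma Vint_law n f : measurable_fun setT f ->
  Vint V f = fine (\int[P]_t (f (Z n t))%:E)%E.
Proof.
move=> mf; rewrite /Vint /wint /Rintegral (integral_law n).
  by under eq_integral do rewrite mulr1.
by apply/measurable_EFinP; under eq_fun do rewrite mulr1.
Qed.

Lemma Vint_id_expectation n : Vint V id_TR = fine 'E_P[Z n].
Proof. have h := Vint_law n mid_TR.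
by rewrite h expectation_def. Qed.

Lemma Vint_sqr_expectation n :
  Vint V (fun y => id_TR y ^+ 2) = fine 'E_P[fun t => (Z n t ^+ 2)%R].
Proof.
have mf : measurable_fun setT (fun y : TR => id_TR y ^+ 2) by exact: measurable_funX.
have h := Vint_law n mf.
by rewrite h unlock.
Qed.

End law_moments.

(** * Power series and the saddlepoint *)

Section power_series.
Context {R : realType}.
Implicit Types (c : nat -> R) (f g : R -> R).

Lemma near0_intro (A : R -> Prop) (e : R) : 0 < e ->
  (forall z, `|z| < e -> A z) -> \forall z \near (0 : R), A z.
Proof.
move=> e0 H; apply/nbhs_ballP; exists e => // z.
by rewrite /ball/= sub0r normrN; exact: H.
Qed.

Lemma near0_elim (A : R -> Prop) : (\forall z \near (0 : R), A z) ->
  exists2 e, 0 < e & forall z, `|z| <= e -> A z.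
Proof.
move=> /nbhs_ballP[e /= e0 H]; exists (e / 2); first by rewrite divr_gt0.
move=> z ze; apply: H; rewrite /ball/= sub0r normrN; apply: le_lt_trans ze _.
by rewrite ltr_pdivrMr// ltr_pMr// ltr1n.
Qed.

Lemma power_series_radius c f : power_series_at0 c f ->
  exists2 r, 0 < r & cvgn (pseries c r) /\ forall z, `|z| <= r -> pseries c z @ \oo --> f z.
Proof.
move=> /near0_elim[e e0 H]; exists e => //.
by split => //; apply: cvgP; apply: H; rewrite ger0_norm// ltW.
Qed.

Lemma power_series_bounded c f : power_series_at0 c f ->
  exists2 B, 0 < B & \forall z \near (0 : R), `|f z| <= B.
Proof.
move=> /power_series_radius[r r0 [cr H]].
have r20 : 0 < r / 2 by rewrite divr_gt0.
have cn : cvgn (pseries (fun k => `|c k|) (r / 2)).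
  apply: is_cvg_pseries_inside_norm cr _.
  by rewrite !ger0_norm ?ltW// ltr_pdivrMr// ltr_pMr// ltr1n.
exists (1 + limn (pseries (fun k => `|c k|) (r / 2))).
  rewrite ltr_pwDl//; apply: limr_ge => //; near=> n.
  by apply: sumr_ge0 => i _; rewrite mulr_ge0// exprn_ge0// ltW.
apply/nbhs_ballP; exists (r / 2) => // z; rewrite /ball/= sub0r normrN => zr.
have {}H : pseries c z @ \oo --> f z.
  by apply: H; apply: le_trans (ltW zr) _; rewrite ler_pdivrMr// ler_peMr ?ltW// ltr1n.
apply: le_trans (_ : _ <= limn (pseries (fun k => `|c k|) (r / 2))) _; last by rewrite lerDr.
have Hn : `|pseries c z n| @[n --> \oo] --> `|f z| by exact: cvg_norm.
apply: (@cvgr_to_le _ _ _ _ _ _ _ Hn); near=> n.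
apply: le_trans (ler_norm_sum _ _ _) _.
apply: (@le_trans _ _ (pseries (fun k => `|c k|) (r / 2) n)).
  apply: ler_sum => i _; rewrite normrM normrX ler_wpM2l//.
  by rewrite lerXn2r// ?nnegrE ltW.
apply: nondecreasing_cvgn_le => //.
apply: nondecreasing_series => k _ _.
by rewrite mulr_ge0// exprn_ge0// ltW.
Unshelve. all: by end_near. Qed.

Lemma power_series_shift c f : power_series_at0 c f ->
  exists2 g, power_series_at0 (fun k => c k.+1) g &
  \forall z \near (0 : R), f z = c 0%N + z * g z.
Proof.
move=> /power_series_radius[r r0 [_ H]].
(* The value at 0 is the one that the shifted series takes there. *)
pose g z := if z == 0 then c 1%N else (f z - c 0%N) / z.
have f0 : f 0 = c 0%N.
  have h0 : pseries c 0 @ \oo --> f 0 by apply: H; rewrite normr0 ltW.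
  suff h1 : pseries c 0 @ \oo --> c 0%N by exact: cvg_unique h0 h1.
  rewrite -(@cvg_shiftn 1 R); apply: cvg_near_cst; near=> n.
  rewrite /pseries /series/= addn1 big_nat_recl//= expr0 mulr1 big1 ?addr0// => i _.
  by rewrite expr0n/= mulr0.
exists g; apply/nbhs_ballP; exists r => // z; rewrite /ball/= sub0r normrN => /ltW zr; last first.
  rewrite /g; case: eqP => [->|/eqP z0]; first by rewrite mul0r addr0.
  by rewrite mulrC divfK// addrC subrK.
rewrite /g; case: eqP => [->|/eqP z0].
  rewrite -(@cvg_shiftn 1 R); apply: cvg_near_cst; near=> n.
  rewrite /pseries /series/= addn1 big_nat_recl//= expr0 mulr1 big1 ?addr0// => i _.
  by rewrite expr0n/= mulr0.
rewrite (_ : pseries _ z = fun n => (pseries c z n.+1 - c 0%N) / z).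
  apply: cvgMl; apply: cvgB; last exact: cvg_cst.
  by rewrite (@cvg_shiftS _ (pseries c z)); exact: H.
apply/funext => n; rewrite /pseries /series/= big_nat_recl//= expr0 mulr1 addrC addKr.
by rewrite mulr_suml; apply: eq_bigr => i _; rewrite exprSr mulrA mulfK.
Unshelve. all: by end_near. Qed.

Lemma power_series_cvg0 c f : power_series_at0 c f -> f z @[z --> (0 : R)] --> c 0%N.
Proof.
move=> /power_series_shift[g /power_series_bounded[B B0 gB] fE].
have h0 : (fun z : R => c 0%N + z * g z) z @[z --> (0 : R)] --> c 0%N.
  rewrite -[X in _ --> X]addr0; apply: cvgD; first exact: cvg_cst.
  apply/cvgr0Pnorm_le => e e0.
  near=> z; rewrite normrM; apply: (@le_trans _ _ (e / B * B)); last by rewrite divfK// gt_eqF.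
  apply: ler_pM => //; near: z => //.
  apply/nbhs_ballP; exists (e / B); first by rewrite /= divr_gt0.
  by move=> z; rewrite /ball/= sub0r normrN => /ltW.
apply: cvg_trans h0; apply: near_eq_cvg; near=> z; symmetry; near: z.
exact: fE.
Unshelve. all: by end_near. Qed.

(** For [u] strictly between the two moduli, u^{i+1} - |s|^{i+1} is (u - |s|) times a sum of i + 1
    terms, each at least |s|^i. Hence the differentiated series is dominated by the original one at
    [u]. *)
Lemma cvg_pseries_diffs c (r s : R) : cvgn (pseries c r) -> `|s| < `|r| ->
  cvgn (pseries (pseries_diffs c) s).
Proof.
move=> cr sr.
have r0 : 0 < `|r| := le_lt_trans (normr_ge0 s) sr.
pose u := (`|s| + `|r|) / 2.
have su : `|s| < u by rewrite /u ltr_pdivlMr// mulr_natr mulr2n ltrD2l.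
have ur : u < `|r| by rewrite /u ltr_pdivrMr// mulr_natr mulr2n ltrD2r.
have u0 : 0 < u := le_lt_trans (normr_ge0 s) su.
have cn : cvgn (pseries (fun k => `|c k|) u).
  by apply: is_cvg_pseries_inside_norm cr _; rewrite ger0_norm// ltW.
pose C := (u - `|s|)^-1.
have C0 : 0 < C by rewrite invr_gt0 subr_gt0.

have bd i : i.+1%:R * `|s| ^+ i <= C * u ^+ i.+1.
  rewrite [leRHS]mulrC ler_pdivlMr ?subr_gt0//.
  have -> : u ^+ i.+1 = u ^+ i.+1 - `|s| ^+ i.+1 + `|s| ^+ i.+1 by rewrite subrK.
  rewrite subrXX -[leLHS]addr0 lerD ?exprn_ge0// mulrC ler_wpM2l ?subr_ge0 ?(ltW su)//.
  rewrite mulr_natl -[X in _ *+ X](card_ord i.+1) -sumr_const; apply: ler_sum => j _ /=.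
  rewrite -[X in `|s| ^+ X <= _](@subnK j i) 1?(leq_ord j)// exprD ler_pM ?exprn_ge0//.
  by rewrite lerXn2r ?nnegrE// ltW.
apply: normed_cvg.
apply: (@series_le_cvg _ _ (fun i => C * (`|c i.+1| * u ^+ i.+1))) => [i|i|i|].
- by rewrite normr_ge0.
- by rewrite !mulr_ge0// ?exprn_ge0// ltW.
- rewrite /= /pseries_diffs !normrM normrX mulrAC ger0_norm// mulrC [leRHS]mulrCA.
  by rewrite ler_wpM2l.
apply: is_cvg_seriesZ.
have := cn; rewrite /pseries; set v := (X in series X) => cv.
have -> : series (fun i => v i.+1) = fun n => series v n.+1 - v 0%N.
  by apply/funext => n; rewrite /series/= big_nat_recl//= addrC addKr.
apply: is_cvgB; last exact: is_cvg_cst.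
apply: (cvgP (limn (series v))).
by rewrite (@cvg_shiftS _ (series v)).
Qed.

Lemma power_series_derive c f : power_series_at0 c f ->
  power_series_at0 (pseries_diffs c) (derive1 f) /\
  \forall z \near (0 : R), derivable f z 1.
Proof.
move=> /power_series_radius[r r0 [cr H]].
(* Two termwise derivatives must converge at [K], and each costs some radius: from [r] to [2 * K],
   then to [K]. *)
pose K := r / 4.
have K0 : 0 < K by rewrite divr_gt0.
have Kr : K < r by rewrite ltr_pdivrMr// ltr_pMr// ltr1n.
have K2r : 2 * K < r by rewrite /K; have := r0; lra.
have cK := is_cvg_pseries_inside cr.
have d1 : cvgn (pseries (pseries_diffs c) (2 * K)).
  by apply: cvg_pseries_diffs cr _; rewrite !ger0_norm ?mulr_ge0 ?ltW.
have d1K : cvgn (pseries (pseries_diffs c) K).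
  by apply: cvg_pseries_diffs cr _; rewrite !ger0_norm ?ltW.
have d2K : cvgn (pseries (pseries_diffs (pseries_diffs c)) K).
  apply: cvg_pseries_diffs d1 _; rewrite !ger0_norm ?mulr_ge0 ?ltW//.
  by rewrite ltr_pMl// ltr1n.
have key (z : R) : `|z| < K -> is_derive z 1 f (limn (pseries (pseries_diffs c) z)).
  move=> zK.
  have D := @pseries_snd_diffs R c K z (cK _ _) d1K d2K.
  have {}D : is_derive z 1 (fun x => limn (pseries c x)) (limn (pseries (pseries_diffs c) z)).
    by apply: D; rewrite (ger0_norm (ltW K0))// (ger0_norm (ltW r0)).
  apply: near_eq_is_derive D.
  near=> y; apply/cvg_lim => //; apply: H.
  apply: le_trans (_ : `|y| <= K) (ltW Kr); near: y.
  apply/nbhs_ballP; exists (K - `|z|); first by rewrite /= subr_gt0.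
  move=> y; rewrite /ball/= => yz; rewrite -(subrK z y); apply: le_trans (ler_normD _ _) _.
  by rewrite -lerBrDr distrC ltW.
split; apply: (near0_intro K0) => z zK.
  have dz := key z zK.
  rewrite derive1E (@derive_val _ _ _ _ _ _ _ dz).
  by apply: (is_cvg_pseries_inside d1K); rewrite (ger0_norm (ltW K0)).
by have [] := key z zK.
Unshelve. all: by end_near. Qed.

End power_series.

(** * The first two coefficients of the Cramer series *)

Section cramer_coefficients.
Context {R : realType}.
Implicit Types (a c : nat -> R).

Lemma cvg_expr (T : Type) (F : set_system T) (FF : Filter F) (f : T -> R) (l : R) n :
  f z @[z --> F] --> l -> f z ^+ n @[z --> F] --> l ^+ n.
Proof.
move=> fl; elim: n => [|n IH]; first by under eq_fun do rewrite expr0; exact: cvg_cst.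
by under eq_fun do rewrite exprS; rewrite exprS; exact: cvgM.
Qed.

(* With [h = hz z], [m h = s ^+ 2 * h + h ^+ 2 * m2 h] and
   [K h = s ^+ 2 * h ^+ 2 / 2 + h ^+ 3 * K3 h], the defining equation of [lam]
   divided by [h ^+ 3] reads
   [(m h / (s * h)) ^+ 3 * lam z = h * m2 h ^+ 2 / (2 * s ^+ 2) + K3 h];
   the two coefficients come from its limit and from that of its difference
   quotient. *)
Lemma cramer_coefficients (s g3 g4 : R) (K m lam hz : R -> R) a c : 0 < s ->
  power_series_at0 a K -> power_series_at0 (pseries_diffs a) m ->
  a 0%N = 0 -> a 1%N = 0 -> a 2%N = s ^+ 2 / 2 -> a 3%N = g3 / 6 -> a 4%N = g4 / 24 ->
  power_series_at0 c lam -> hz z @[z --> (0 : R)] --> (0 : R) ->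
  (\forall z \near (0 : R), s * z = m (hz z)) ->
  (\forall z \near (0 : R), z ^+ 3 * lam z =
    m (hz z) ^+ 2 / (2 * s ^+ 2) - hz z * m (hz z) + K (hz z)) ->
  c 0%N = g3 / (6 * s ^+ 3) /\
  c 1%N = (s ^+ 2 * g4 - 3 * g3 ^+ 2) / (24 * s ^+ 6).
Proof.
move=> s0 pK pm a0 a1 a2 a3 a4 pl hz0 Em El.
have [K1 pK1 EK] := power_series_shift pK.
have [K2 pK2 EK1] := power_series_shift pK1.
have [K3 pK3 EK2] := power_series_shift pK2.
have [K4 pK4 EK3] := power_series_shift pK3.
have [m1 pm1 Em0] := power_series_shift pm.
have [m2 pm2 Em1] := power_series_shift pm1.
have [l1 pl1 El0] := power_series_shift pl.
have b0 : pseries_diffs a 0%N = 0 by rewrite /pseries_diffs a1 mulr0.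
have b1 : pseries_diffs a 1%N = s ^+ 2 by rewrite /pseries_diffs a2; field.
have b2 : pseries_diffs a 2%N = g3 / 2 by rewrite /pseries_diffs a3; field.
rewrite {}a0 in EK; rewrite {}a1 in EK1; rewrite {}a2 in EK2; rewrite a3 in EK3.
rewrite {}b0 in Em0; rewrite b1 in Em1.
have hz0' : hz z @[z --> (0 : R)^'] --> (0 : R).
  by apply: cvg_trans hz0; apply: cvg_app; exact: cvg_within.
have comp (f : R -> R) (l : R) : f z @[z --> (0 : R)] --> l -> f (hz z) @[z --> (0 : R)^'] --> l.
  by move=> fl; exact: cvg_comp hz0' fl.
have dn (f : R -> R) (l : R) : f z @[z --> (0 : R)] --> l -> f z @[z --> (0 : R)^'] --> l.
  by move=> fl; apply: cvg_trans fl; apply: cvg_app; exact: cvg_within.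
have cK3 := comp _ _ (power_series_cvg0 pK3).
have cK4 := comp _ _ (power_series_cvg0 pK4).
have cm1 := comp _ _ (power_series_cvg0 pm1).
have cm2 := comp _ _ (power_series_cvg0 pm2).
have cl := dn _ _ (power_series_cvg0 pl).
have cl1 := dn _ _ (power_series_cvg0 pl1).
rewrite a3 in cK3; rewrite a4 in cK4; rewrite b1 in cm1; rewrite b2 in cm2.
have nh (S : R -> Prop) : (\forall h \near (0 : R), S h) -> \forall z \near (0 : R)^', S (hz z).
  by move=> H; exact: hz0' _ H.
have nd (S : R -> Prop) : (\forall h \near (0 : R), S h) -> \forall z \near (0 : R)^', S z.
  by move=> H; exact: (@cvg_within _ (nbhs (0 : R)) _ _ _ H).
have sn0 : s != 0 by rewrite gt_eqF.
(* On the punctured neighbourhood [z != 0] forces [hz z != 0], so that powers of [hz z] may be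
   cancelled. *)
have facts : \forall z \near (0 : R)^',
  [/\ z = hz z * (m1 (hz z) / s), hz z != 0, m1 (hz z) = s ^+ 2 + hz z * m2 (hz z),
    (m1 (hz z) / s) ^+ 3 * lam z = hz z * m2 (hz z) ^+ 2 / (2 * s ^+ 2) + K3 (hz z) &
    lam z = c 0%N + z * l1 z /\ K3 (hz z) = g3 / 6 + hz z * K4 (hz z)].
  near=> z.
  have z0 : z != 0 by near: z; exact: nbhs_dnbhs_neq.
  have e1 : s * z = m (hz z) by near: z; exact: nd.
  have e2 : z ^+ 3 * lam z =
    m (hz z) ^+ 2 / (2 * s ^+ 2) - hz z * m (hz z) + K (hz z) by near: z; exact: nd.
  have e3 : lam z = c 0%N + z * l1 z by near: z; exact: nd.
  have e4 : m (hz z) = 0 + hz z * m1 (hz z) by near: z; exact: (nh _ Em0).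
  have e5 : m1 (hz z) = s ^+ 2 + hz z * m2 (hz z) by near: z; exact: (nh _ Em1).
  have e6 : K (hz z) = 0 + hz z * K1 (hz z) by near: z; exact: (nh _ EK).
  have e7 : K1 (hz z) = 0 + hz z * K2 (hz z) by near: z; exact: (nh _ EK1).
  have e8 : K2 (hz z) = s ^+ 2 / 2 + hz z * K3 (hz z) by near: z; exact: (nh _ EK2).
  have e9 : K3 (hz z) = g3 / 6 + hz z * K4 (hz z) by near: z; exact: (nh _ EK3).
  have zE : z = hz z * (m1 (hz z) / s).
    by rewrite mulrA -[hz z * _]add0r -e4 -e1 mulrAC divff// mul1r.
  have h0 : hz z != 0.
    by apply: contra_neq z0 => h0; rewrite zE h0 mul0r.
  split => //; apply: (mulfI (expf_neq0 3 h0)).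
  rewrite mulrA -exprMn -zE e2.
  rewrite e4 e6 e7 e8 e5; set h := hz z; set M := m2 _; set L := K3 _.
  by field.
have lim1 : (m1 (hz z) / s) ^+ 3 * lam z @[z --> (0 : R)^'] --> (s ^+ 2 / s) ^+ 3 * c 0%N.
  by apply: cvgM cl; apply: cvg_expr; exact: cvgMr_tmp.
have lim2 : hz z * m2 (hz z) ^+ 2 / (2 * s ^+ 2) + K3 (hz z) @[z --> (0 : R)^']
    --> 0 * (g3 / 2) ^+ 2 / (2 * s ^+ 2) + g3 / 6.
  apply: cvgD cK3; apply: cvgMr_tmp; apply: cvgM => //; exact: cvg_expr.
have near_uniq (f g : R -> R) (l l' : R) : (\forall z \near (0 : R)^', f z = g z) ->
    f z @[z --> (0 : R)^'] --> l -> g z @[z --> (0 : R)^'] --> l' -> l = l'.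
  move=> fg fl gl; have fl' : g z @[z --> (0 : R)^'] --> l.
    by apply: cvg_trans fl; apply: near_eq_cvg.
  exact: cvg_unique fl' gl.
have c0E : (s ^+ 2 / s) ^+ 3 * c 0%N = 0 * (g3 / 2) ^+ 2 / (2 * s ^+ 2) + g3 / 6.
  by apply: near_uniq lim1 lim2; apply: filterS facts => z [].
have {}c0E : c 0%N = g3 / (6 * s ^+ 3).
  apply: (mulfI (expf_neq0 3 sn0)); move: c0E.
  rewrite (_ : s ^+ 2 / s = s); last by field.
  by move=> ->; field.
(* With [h = hz z] and [u = m1 h / s] this is [(u ^+ 3 * lam z - s ^+ 3 * c 0) / h]: use
   [u - s = h * m2 h / s], [u * s = m1 h] and [z = h * u]. *)
have lim3 : c 0%N * (m2 (hz z) / s) * ((m1 (hz z) / s) ^+ 2 + m1 (hz z) + s ^+ 2) +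
    (m1 (hz z) / s) ^+ 4 * l1 z @[z --> (0 : R)^'] -->
    c 0%N * (g3 / 2 / s) * ((s ^+ 2 / s) ^+ 2 + s ^+ 2 + s ^+ 2) + (s ^+ 2 / s) ^+ 4 * c 1%N.
  apply: cvgD; apply: cvgM => //.
  - by apply: cvgMl_tmp; exact: cvgMr_tmp.
  - apply: cvgD; last exact: cvg_cst.
    by apply: cvgD => //; apply: cvg_expr; exact: cvgMr_tmp.
  - by apply: cvg_expr; exact: cvgMr_tmp.
have lim4 : m2 (hz z) ^+ 2 / (2 * s ^+ 2) + K4 (hz z) @[z --> (0 : R)^'] -->
    (g3 / 2) ^+ 2 / (2 * s ^+ 2) + g4 / 24.
  by apply: cvgD cK4; apply: cvgMr_tmp; exact: cvg_expr.
have c1E : c 0%N * (g3 / 2 / s) * ((s ^+ 2 / s) ^+ 2 + s ^+ 2 + s ^+ 2) + (s ^+ 2 / s) ^+ 4 * c 1%N =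
    (g3 / 2) ^+ 2 / (2 * s ^+ 2) + g4 / 24.
  apply: near_uniq lim3 lim4; apply: filterS facts => z [zE h0 m1E e1 [lE K3E]].
  apply: (mulfI h0); rewrite [LHS]mulrDr [LHS]addrC.
  have -> : hz z * ((m1 (hz z) / s) ^+ 4 * l1 z) = (m1 (hz z) / s) ^+ 3 * (z * l1 z).
    by move: zE; set h := hz z; set u := _ / s => ->; ring.
  have -> : z * l1 z = lam z - c 0%N by rewrite lE addrC addKr.
  rewrite mulrBr e1 K3E m1E c0E; set h := hz z; set M := m2 _; set L := K4 _.
  by field.
split => //; apply: (mulfI (expf_neq0 4 sn0)); move: c1E.
rewrite (_ : s ^+ 2 / s = s); last by field.
move/(canRL (addKr _)) => ->; rewrite c0E.
by field.
Unshelve. all: by end_near. Qed.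

End cramer_coefficients.

Section saddlepoint.
Context {R : realType} (V : cumulativeBounded (0 : R) (1 : R)) (A sigma : R).
Hypothesis A0 : 0 < A.
Hypothesis expV : forall h : R, `|h| < A -> exp_integrable V h.
Hypothesis sigma0 : 0 < sigma.
Hypothesis EV : Vint V (idfun : measurableTypeR R -> R) = 0.
Hypothesis EV2 : Vint V (fun y => (idfun : measurableTypeR R -> R) y ^+ 2) = sigma ^+ 2.

Lemma cgf_power_series (gamma : nat -> R) : cumulants V gamma ->
  power_series_at0 (fun k => if (k < 2)%N then 0 else gamma k / k`!%:R) (cgf V).
Proof.
move=> H; rewrite /power_series_at0; apply: filterS H => h.
apply: cvg_trans; apply: near_eq_cvg; near=> n.
have n2 : (2 <= n)%N by near: n; exists 2%N.
rewrite /pseries /series/= [RHS](big_cat_nat (n := 2))//= (_ : \sum_(0 <= i < 2) _ = 0); last first.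
  by apply: big1_seq => i /=; rewrite mem_index_iota => /andP[_ ->]; rewrite mul0r.
rewrite add0r; apply: eq_big_nat => k /andP[k2 _].
by rewrite ltnNge k2.
Unshelve. all: by end_near. Qed.

Lemma tilted_mean_near0 : \forall h \near (0 : R), tilted_mean V h = tmean V h.
Proof.
have [C C0 [e e0 He]] := tilt_bounds A0 expV sigma0 EV EV2.
apply: (near0_intro e0) => h /ltW/He[ha R2 _ _ _].
have Rgt0 : 0 < mgf V h by lra.
have d1 := is_derive_mgf A0 expV ha.
have d2 := @is_derive1_comp R (@ln R) (mgf V) _ _ _ (is_derive1_ln Rgt0) d1.
rewrite /tilted_mean derive1E (_ : cgf V = @ln R \o mgf V)//.
by rewrite (@derive_val _ _ _ _ _ _ _ d2) /tmean mulrC.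
Qed.

(** The cumulants are known only through the series of [cgf V]. Its derivative divided by [h] has
    limit [gamma 2] by that series, and [sigma ^+ 2] by [tilt_bounds]. *)
Lemma cumulant2 (gamma : nat -> R) : cumulants V gamma -> gamma 2%N = sigma ^+ 2.
Proof.
move=> /cgf_power_series/power_series_derive[+ _].
move=> /power_series_shift[m1 /power_series_cvg0 cm1 Em].
have [C C0 [e e0 He]] := tilt_bounds A0 expV sigma0 EV EV2.
have cm1' : m1 z @[z --> (0 : R)^'] --> sigma ^+ 2.
  apply/cvgrPdist_le => ep ep0; near=> h.
  have h0 : h != 0 by near: h; exact: nbhs_dnbhs_neq.
  have he : `|h| <= Num.min e (ep / C).
    near: h; apply: (@cvg_within _ (nbhs (0 : R))); apply: (near0_intro _ (fun z => @ltW _ _ _ _)).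
    by rewrite lt_min e0 divr_gt0.
  have E1 : tilted_mean V h = h * m1 h.
    rewrite (_ : tilted_mean V h =
      pseries_diffs (fun k => if (k < 2)%N then 0 else gamma k / k`!%:R) 0%N + h * m1 h).
      by rewrite /pseries_diffs/= mulr0 add0r.
    by near: h; exact: (@cvg_within _ (nbhs (0 : R)) _ _ _ Em).
  have E2 : tilted_mean V h = tmean V h.
    by near: h; exact: (@cvg_within _ (nbhs (0 : R)) _ _ _ tilted_mean_near0).
  move: he; rewrite le_min => /andP[/He[_ _ T1 _ _] he].
  have hn : 0 < `|h| by rewrite normr_gt0.
  rewrite -(ler_pM2l hn) -normrM mulrBr -E1 E2 distrC [h * _]mulrC.
  apply: le_trans T1 _; rewrite -real_normK ?num_real// expr2 mulrCA ler_wpM2l//.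
  by move: he; rewrite ler_pdivlMr// mulrC.
have cm1'' : m1 z @[z --> (0 : R)^'] --> gamma 2%N.
  rewrite (_ : gamma 2%N = pseries_diffs (fun k => if (k < 2)%N then 0 else gamma k / k`!%:R) 1%N).
    by apply: cvg_trans cm1; apply: cvg_app; exact: cvg_within.
  by rewrite /pseries_diffs/= mulrC divfK// pnatr_eq0.
exact: cvg_unique cm1'' cm1'.
Unshelve. all: by end_near. Qed.

(** The sign [eps] serves both tails. Everything follows from m(h) = sigma^2 h + O(h^2) and a^2 =
    sigma^2 + O(h), where a is the tilted standard deviation: the root has the sign and order of the
    argument, and h a differs from it by two errors of size [C1 / sigma * h ^+ 2]. *)
Lemma saddlepoint_tilt (hz : R -> R) : saddlepoint V sigma hz ->
  exists2 C, 0 < C & forall e, 0 < e -> exists2 dl, 0 < dl &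
  forall eps z, `|eps| = 1 -> 0 <= z -> z <= dl ->
  [/\ `|hz (eps * z)| <= e, 0 <= eps * hz (eps * z),
    tilted_mean V (hz (eps * z)) = tmean V (hz (eps * z)) /\
      sigma * (eps * z) = tmean V (hz (eps * z)),
    `|hz (eps * z)| * (sigma / 2) <= z /\ sigma / 2 <= Num.sqrt (tvar V (hz (eps * z))) &
    `|eps * hz (eps * z) * Num.sqrt (tvar V (hz (eps * z))) - z| <= C * hz (eps * z) ^+ 2].
Proof.
move=> [hz0 hzE].
have [C1 C10 [e1 e10 He]] := tilt_bounds A0 expV sigma0 EV EV2.
have [e2 e20 He2] := near0_elim tilted_mean_near0.
have [e3 e30 He3] := near0_elim hzE.
exists (2 * (C1 / sigma)); first by rewrite mulr_gt0// divr_gt0.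
move=> e e0.
(* The last threshold keeps the quadratic error of the mean below half of its main term
   [sigma ^+ 2 * |h|], which fixes the sign of [h]. *)
pose e' := Num.min (Num.min e e1) (Num.min e2 (sigma ^+ 2 / (2 * C1))).
have e'0 : 0 < e'.
  by rewrite !lt_min e0 e10 e20/= divr_gt0 ?exprn_gt0// mulr_gt0.
have hzs : \forall z \near (0 : R), `|hz z| <= e' by exact: (cvgr0_norm_le _ hz0).
have [dl dl0 Hdl] := near0_elim hzs.
exists (Num.min dl e3); first by rewrite lt_min dl0.
move=> eps z eps1 z0; rewrite le_min => /andP[zdl ze3].
have nz : `|eps * z| = z by rewrite normrM eps1 mul1r ger0_norm.
have hE : sigma * (eps * z) = tilted_mean V (hz (eps * z)) by apply: He3; rewrite nz.
have he : `|hz (eps * z)| <= e' by apply: Hdl; rewrite nz.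
set h := hz (eps * z) in he hE *.
move: he; rewrite /e' !le_min => /andP[/andP[he he1] /andP[he2 he3]].
have tE := He2 h he2.
rewrite {}tE in hE *.
have [_ _ T1 T2 [T3 _]] := He h he1.
rewrite -hE in T1.
have eps2 : eps ^+ 2 = 1 by rewrite -(real_normK (num_real eps)) eps1 expr1n.
set k := eps * h.
have kE : h = eps * k by rewrite /k mulrA -expr2 eps2 mul1r.
have nk : `|h| = `|k| by rewrite /k normrM eps1 mul1r.
have T1' : `|sigma * z - sigma ^+ 2 * k| <= C1 * h ^+ 2.
  apply: le_trans T1; rewrite kE.
  have -> : sigma * (eps * z) - sigma ^+ 2 * (eps * k) = eps * (sigma * z - sigma ^+ 2 * k) by ring.
  by rewrite [in leRHS]normrM eps1 mul1r.
have he3' : C1 * h ^+ 2 <= sigma ^+ 2 / 2 * `|k|.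
  move: he3; rewrite ler_pdivlMr ?mulr_gt0// => he3.
  rewrite -nk -[h ^+ 2]real_normK ?num_real// expr2 mulrA ler_wpM2r//.
  by rewrite ler_pdivlMr// -mulrA mulrC -mulrA.
have sz : sigma ^+ 2 / 2 * `|k| <= sigma * z /\ 0 <= k.
  move: T1'; rewrite ler_norml => /andP[t1 t2].
  have s20 : 0 < sigma ^+ 2 by rewrite exprn_gt0.
  have sz0 : 0 <= sigma * z by rewrite mulr_ge0// ltW.
  have [k0|k0] := leP 0 k.
    by move: he3'; rewrite (ger0_norm k0) => he3'; split => //; lra.
  exfalso; move: he3'; rewrite (ltr0_norm k0) => he3'.
  have : 0 < sigma ^+ 2 * - k by rewrite mulr_gt0// oppr_gt0.
  lra.
have [sz1 k0] := sz.
have sv : sigma / 2 <= Num.sqrt (tvar V h).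
  rewrite -(ger0_norm (divr_ge0 (ltW sigma0) (ler0n _ 2))) -sqrtr_sqr ler_wsqrtr//.
  by rewrite expr_div_n; apply: le_trans T3; rewrite ler_pM2l ?exprn_gt0//; lra.
split => //.
- split => //; rewrite nk -(ler_pM2l sigma0); apply: le_trans sz1.
  by rewrite le_eqVlt; apply/orP; left; apply/eqP; ring.
- set v := Num.sqrt _.
  have v2 : v ^+ 2 = tvar V h.
    by rewrite sqr_sqrtr//; apply: le_trans T3; rewrite divr_ge0// sqr_ge0.
  have vs : `|v - sigma| <= C1 * `|h| / sigma.
    have vpos : sigma <= v + sigma by rewrite lerDr; apply: le_trans sv; rewrite divr_ge0// ltW.
    rewrite ler_pdivlMr//; apply: le_trans T2; rewrite -v2.
    have -> : v ^+ 2 - sigma ^+ 2 = (v - sigma) * (v + sigma) by ring.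
    rewrite (normrM (v - sigma)) ler_wpM2l//; apply: le_trans vpos _; exact: ler_norm.
  have -> : k * v - z = k * (v - sigma) - (sigma * z - sigma ^+ 2 * k) / sigma.
    by field; rewrite gt_eqF.
  apply: le_trans (ler_normB _ _) _.
  rewrite -(mulrA 2) mulr_natl mulr2n lerD//.
    rewrite (normrM k) -nk; apply: le_trans (ler_wpM2l (normr_ge0 h) vs) _.
    rewrite -[h ^+ 2]real_normK ?num_real// le_eqVlt; apply/orP; left; apply/eqP; ring.
  rewrite (normrM _ sigma^-1) normfV (gtr0_norm sigma0) [leRHS]mulrAC ler_wpM2r//.
  by rewrite invr_ge0 ltW.
Qed.

End saddlepoint.

(** * Tail probabilities *)

Section tail_approximation.
Context d (T : measurableType d) (R : realType) (P : probability T R).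
Context (Z : nat -> {RV P >-> R}) (V : cumulativeBounded (0 : R) (1 : R)) (A sigma : R).
Hypothesis indep : mutually_independent Z.
Hypothesis ZV : forall n y, cdf (Z n) y = (V y)%:E.
Hypothesis A0 : 0 < A.
Hypothesis expV : forall h : R, `|h| < A -> exp_integrable V h.
Hypothesis sigma0 : 0 < sigma.
Hypothesis EV : Vint V (idfun : measurableTypeR R -> R) = 0.
Hypothesis EV2 : Vint V (fun y => (idfun : measurableTypeR R -> R) y ^+ 2) = sigma ^+ 2.
Variables hz lambda : R -> R.
Hypothesis sad : saddlepoint V sigma hz.
Hypothesis cra : cramer_function V sigma hz lambda.

Local Notation muV := (lebesgue_stieltjes_measure V).

Definition tail (lower : bool) n x : R :=
  if lower then normalized_sum_cdf Z sigma n (- x) else 1 - normalized_sum_cdf Z sigma n x.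

Let wV2 : wable muV (fun=> 1) (fun y => (idfun : measurableTypeR R -> R) y ^+ 2).
Proof.
have a0 : 0 <= A / 4 by rewrite divr_ge0// ltW.
have := Vable_mom A0 expV 2 (h := 0); rewrite normr0 => /(_ a0).
by congr (wable _ _ _); apply/funext => y; rewrite mul0r expR0 mulr1.
Qed.

Let step (lower : bool) (c s : R) : R := if lower then (s <= c)%R%:R else (c < s)%R%:R.

Let measurable_stepb lower c : measurable_fun setT (step lower c).
Proof.
case: lower; first exact: measurable_step.
rewrite /step (_ : (fun s => _) = fun s => 1 - (s <= c)%R%:R); last first.
  by apply/funext => s; rewrite ltNge; case: (s <= c); rewrite /= ?subrr ?subr0.
by apply: measurable_funB => //; exact: measurable_step.
Qed.

Let tailE (lower : bool) n x : tail lower n x =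
  iter n (avg muV (fun=> 1) (idfun : measurableTypeR R -> R))
    (step lower (sigma * ((-1) ^+ lower * x) * Num.sqrt n%:R)) 0.
Proof.
have cdfE y : normalized_sum_cdf Z sigma n y =
  iter n (avg muV (fun=> 1) (idfun : measurableTypeR R -> R))
    (fun s => (s <= sigma * y * Num.sqrt n%:R)%R%:R) 0 := cdf_partial_sum indep ZV wV2 n _.
rewrite /tail; case: lower; first by rewrite cdfE mulN1r.
rewrite cdfE expr0 mul1r; set c := _ * _.
have -> : step false c = fun s => 1 - (s <= c)%R%:R.
  by apply/funext => s; rewrite /step ltNge; case: (s <= c); rewrite /= ?subrr ?subr0.
have q1 : quadratic_growth (fun _ : R => 1 : R).
  have n1 (s : R) : `|1 : R| <= 1 by rewrite normr1.
  exact: (qg_bounded (measurable_cst _) n1).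
have qs : quadratic_growth (fun s : R => (s <= c)%R%:R : R).
  have n1 (s : R) : `|(s <= c)%R%:R : R| <= 1 by rewrite ger0_norm// lern1 leq_b1.
  exact: (qg_bounded (measurable_step c) n1).
have w1 : wable muV (fun=> 1) (fun=> 1) by exact: wable1.
have W1 : wint muV (fun=> 1) (fun=> 1) = 1 by exact: wint11.
have mw : measurable_fun setT (fun _ : measurableTypeR R => 1 : R) by exact: measurable_cst.
have mX : measurable_fun setT (idfun : measurableTypeR R -> R) by exact: measurable_id.
have E := congr1 (@^~ 0) (iterB (fun=> ler01) mw mX w1 W1 wV2 n q1 qs).
by rewrite [RHS]E (iter_cst _ w1 W1).
Qed.

(** Two errors make up the constant: [C2] from the normal approximation under the tilt, and
    [4 * C1 / sigma ^+ 2] from moving the argument of the Mills ratio to [x]. *)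
Lemma tail_approx : exists2 C : R, 0 < C & exists2 dl : R, 0 < dl &
  forall (lower : bool) n (x : R), (0 < n)%N -> 0 <= x -> x <= dl * Num.sqrt n%:R ->
  let z := (-1) ^+ lower * (x / Num.sqrt n%:R) in
  `|tail lower n x - expR (n%:R * (z ^+ 3 * lambda z)) * (1 - Phi x)| <=
  C / Num.sqrt n%:R * (expR (n%:R * (z ^+ 3 * lambda z)) * expR (- (x ^+ 2 / 2))).
Proof.
have [C1 C10 H1] := saddlepoint_tilt A0 expV sigma0 EV EV2 sad.
have [C2 C20 [e2 e20 H2]] := tilted_sum_tail A0 expV sigma0 EV EV2.
have [C3 C30 [e3 e30 H3]] := tilt_bounds A0 expV sigma0 EV EV2.
have [e4 e40 H4] := near0_elim cra.
have e0 : 0 < Num.min e2 e3 by rewrite lt_min e20.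
have [dl dl0 H5] := H1 _ e0.
have s20 : 0 < sigma ^+ 2 by rewrite exprn_gt0.
exists (C2 + 4 * C1 / sigma ^+ 2); first by rewrite addr_gt0// divr_gt0// mulr_gt0.
exists (Num.min dl e4); first by rewrite lt_min dl0.
move=> lower n x n0 x0 xd.
set r := Num.sqrt n%:R in xd *.
have r0 : 0 < r by rewrite sqrtr_gt0 ltr0n.
have rn : n%:R = r ^+ 2 by rewrite sqr_sqrtr.
have rn0 : r != 0 by rewrite gt_eqF.
move: xd; rewrite -ler_pdivrMr//; set y := x / r => xd.
have xE : x = y * r by rewrite divfK.
have x2E : x ^+ 2 = n%:R * y ^+ 2 by rewrite rn {1}xE exprMn mulrC.
have y0 : 0 <= y by rewrite divr_ge0// ltW.
move: xd; rewrite le_min => /andP[yd y4].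
set eps : R := (-1) ^+ lower.
have eps1 : `|eps| = 1 by rewrite normrX normrN normr1 expr1n.
have eps2 : eps ^+ 2 = 1 by rewrite -(real_normK (num_real eps)) eps1 expr1n.
have /= := H5 eps y eps1 y0 yd.
move eqz : (eps * y) => z; have zE' := esym eqz; set h := hz z.
move=> [he kh [mE1 mE2] [hy sv] hsy].
move: he; rewrite le_min => /andP[he2 he3].
have [_ R2 _ _ [v4 _]] := H3 h he3.
have Rgt0 : 0 < mgf V h by lra.
have v0 : 0 <= tvar V h by apply: le_trans v4; rewrite divr_ge0// ltW.
set v := Num.sqrt (tvar V h) in sv hsy.
have v2 : (eps * v) ^+ 2 = tvar V h by rewrite exprMn eps2 mul1r sqr_sqrtr.
have hs0 : 0 <= h * (eps * v) by rewrite mulrCA mulrA mulr_ge0// sqrtr_ge0.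
have cE : sigma * (eps * x) * r = n%:R * tmean V h.
  by rewrite -mE2 rn xE zE'; ring.
have Gs (t : R) : (0 < t)%R%:R <=
    step lower (sigma * (eps * x) * r) (eps * v * t + n%:R * tmean V h) <= (0 <= t)%R%:R.
  have v00 : 0 < v by apply: lt_le_trans sv; rewrite divr_gt0.
  rewrite cE /step /eps; case: (lower).
    rewrite expr1 mulN1r mulNr gerDr oppr_le0 pmulr_rge0// lexx andbT.
    by rewrite ler_nat; case: (ltP 0 t) => // /ltW ->.
  rewrite expr0 mul1r ltrDr pmulr_rgt0// lexx/=.
  by rewrite ler_nat; case: (ltP 0 t) => // /ltW ->.
have := H2 h (eps * v) he2 v2 hs0 n _ n0 (measurable_stepb lower _) Gs.
rewrite -tailE.
have zy : z ^+ 2 = y ^+ 2 by rewrite zE' exprMn eps2 mul1r.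
have z4 : `|z| <= e4 by rewrite zE' normrM eps1 mul1r ger0_norm.
(* The definition of [lambda] says log R - h m = z^3 lambda(z) - m^2 / (2 sigma^2), and m = sigma z
   turns the last term into z^2 / 2. *)
have expE : (mgf V h * expR (- (h * tmean V h))) ^+ n =
    expR (n%:R * (z ^+ 3 * lambda z)) * expR (- (x ^+ 2 / 2)).
  rewrite (H4 z z4) -/h mE1 -mE2 -{1}(lnK (x := mgf V h)) ?posrE// -/(cgf V h).
  rewrite -expRD -expRM_natl -expRD; congr expR.
  have -> : (sigma * z) ^+ 2 / (2 * sigma ^+ 2) = z ^+ 2 / 2 by field; rewrite gt_eqF.
  by rewrite x2E -zy; ring.
rewrite expE; set E := expR _ * expR _.
have E0 : 0 <= E by rewrite mulr_ge0 ?expR_ge0.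
have EP : E * millsR x = expR (n%:R * (z ^+ 3 * lambda z)) * (1 - Phi x).
  by rewrite -mulrA millsRE.
rewrite -EP => H6.
rewrite -(subrK (E * millsR (h * (eps * v) * r)) (tail lower n x)) -addrA.
apply: le_trans (ler_normD _ _) _.
rewrite mulrDl mulrDl lerD//; first by rewrite [leRHS]mulrC.
rewrite -mulrBr (normrM E) (ger0_norm E0) mulrC ler_wpM2r//.
have hE : h * (eps * v) * r = eps * h * v * r by ring.
(* A lower bound for both arguments of the Mills ratio. Since [q ^+ 2] is proportional to
   [h ^+ 2 * n], dividing by [1 + q ^+ 2] cancels the [h ^+ 2] of the error. *)
pose q := `|h| * (sigma / 2) * r.
have sg2 : 0 <= sigma / 2 by rewrite divr_ge0// ltW.
have q0 : 0 <= q by exact: mulr_ge0 (mulr_ge0 (normr_ge0 _) sg2) (ltW r0).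
have qx : q <= x by rewrite xE ler_wpM2r// ltW.
have qh : q <= h * (eps * v) * r.
  rewrite hE ler_wpM2r ?(ltW r0)//.
  have -> : `|h| = eps * h by rewrite -[RHS]ger0_norm// normrM eps1 mul1r.
  by rewrite ler_wpM2l.
apply: le_trans (millsR_lip q0 qh qx) _.
rewrite hE {1}xE -mulrBl normrM (gtr0_norm r0).
rewrite ler_pdivrMr ?ltr_pwDl ?sqr_ge0//.
apply: le_trans (ler_wpM2r (ltW r0) hsy) _.
have qE : C1 * h ^+ 2 * r = 4 * C1 / sigma ^+ 2 / r * q ^+ 2.
  rewrite /q !exprMn real_normK ?num_real//; field.
  by rewrite rn0 gt_eqF.
rewrite qE ler_wpM2l//; last by rewrite lerDr.
by apply: divr_ge0 (ltW r0); apply: divr_ge0 (ltW s20); rewrite mulr_ge0// ltW.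
Qed.

End tail_approximation.

(** * Consequences of the uniform approximation, for either tail *)

Section tail_estimates.
Context {R : realType}.

Lemma gdE (x : R) : gd x = gd 0 * expR (- (x ^+ 2 / 2)).
Proof.
by rewrite /gd -mulrA -expRD; congr (_ * expR _); rewrite expr0n/= oppr0 mul0r add0r mulNr.
Qed.

(** [mills_lb] with [1 + x ^+ 2 <= 2 * x ^+ 2]. It turns the absolute error of the approximation
    into a relative one at the cost of a factor [x]. *)
Lemma expR_half_sqr_le (x : R) : 1 <= x ->
  expR (- (x ^+ 2 / 2)) <= 2 / gd 0 * x * (1 - Phi x).
Proof.
move=> x1; have x0 : 0 < x by apply: lt_le_trans x1.
have g0 := gd_gt0 (0 : R).
have h : gd x <= 2 * x * (1 - Phi x).
  rewrite -(ler_pM2l x0); apply: le_trans (mills_lb x) _.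
  rewrite [leLHS]mulrC mulrA ler_wpM2r ?subr_ge0 ?Phi_le1//.
  by rewrite mulrCA -expr2 mulr_natl mulr2n lerD2r exprn_ege1.
have -> : 2 / gd 0 * x * (1 - Phi x) = 2 * x * (1 - Phi x) / gd 0 by ring.
by rewrite ler_pdivlMr// mulrC -gdE.
Qed.

Lemma Phi_lt1 (x : R) : Phi x < 1.
Proof.
have pos (y : R) : 1 <= y -> Phi y < 1.
  move=> y1; have := lt_le_trans (expR_gt0 _) (expR_half_sqr_le y1).
  rewrite pmulr_rgt0 ?subr_gt0// mulr_gt0 ?divr_gt0 ?gd_gt0//.
  exact: lt_le_trans y1.
apply: le_lt_trans (pos (Num.max 1 x) _); last by rewrite le_max lexx.
by apply: Phi_ndecr; rewrite le_max lexx orbT.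
Qed.

Lemma expR_lip (m u v : R) : `|u| <= m -> `|v| <= m ->
  `|expR u - expR v| <= expR (3 * m) * `|u - v|.
Proof.
move=> um vm; rewrite -[u in expR u](subrK v) expRD -[X in _ - X]mul1r -mulrBl.
rewrite normrM (ger0_norm (expR_ge0 v)).
apply: (@le_trans _ _ (`|u - v| * expR `|u - v| * expR v)).
  by rewrite ler_wpM2r ?expR_ge0//; exact: expR_sub1_le.
rewrite -mulrA mulrC ler_wpM2r// -expRD ler_expR.
have := ler_normB u v; have := ler_norm v; lra.
Qed.

Variables (Q : nat -> R -> R) (Lam : R -> R) (C dl B : R).
Hypotheses (C0 : 0 < C) (dl0 : 0 < dl) (B0 : 0 < B).

(** Here [Q] stands for either tail and [Lam] is to be [lambda] with the matching signs, so that [x]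
    is nonnegative throughout. *)
Definition saddle_exp n (x : R) : R :=
  expR (n%:R * ((x / Num.sqrt n%:R) ^+ 3 * Lam (x / Num.sqrt n%:R))).

Hypothesis core : forall n x, (0 < n)%N -> 0 <= x -> x <= dl * Num.sqrt n%:R ->
  `|Q n x - saddle_exp n x * (1 - Phi x)| <=
  C / Num.sqrt n%:R * (saddle_exp n x * expR (- (x ^+ 2 / 2))).
Hypothesis Lam_lip : forall z w, 0 <= z <= dl -> 0 <= w <= dl ->
  `|Lam z - Lam w| <= B * `|z - w|.

Let sq0 n : (0 < n)%N -> 0 < Num.sqrt n%:R :> R.
Proof. by move=> n0; rewrite sqrtr_gt0 ltr0n. Qed.

Let sqE n : n%:R = Num.sqrt n%:R ^+ 2 :> R.
Proof. by rewrite sqr_sqrtr. Qed.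

Let ratio n x := Q n x / (saddle_exp n x * (1 - Phi x)).

Let ratioE n x : Q n x / (1 - Phi x) = saddle_exp n x * ratio n x.
Proof.
have P0 : 1 - Phi x != 0 by rewrite gt_eqF// subr_gt0 Phi_lt1.
have E0 : saddle_exp n x != 0 by rewrite gt_eqF// expR_gt0.
by rewrite /ratio; field; rewrite P0 E0.
Qed.

Lemma ratio_bound n x : (0 < n)%N -> 1 <= x -> x <= dl * Num.sqrt n%:R ->
  `|ratio n x - 1| <= 2 * C / gd 0 * (x / Num.sqrt n%:R).
Proof.
move=> n0 x1 xd; have r0 := sq0 n0.
have x0 : 0 < x by apply: lt_le_trans x1.
have P0 : 0 < 1 - Phi x by rewrite subr_gt0 Phi_lt1.
have E0 : 0 < saddle_exp n x by exact: expR_gt0.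
have D0 : 0 < saddle_exp n x * (1 - Phi x) by rewrite mulr_gt0.
have -> : ratio n x - 1 = (Q n x - saddle_exp n x * (1 - Phi x)) / (saddle_exp n x * (1 - Phi x)).
  by rewrite mulrBl divff ?gt_eqF.
rewrite normrM normfV (gtr0_norm D0) ler_pdivrMr//.
apply: le_trans (core n0 (ltW x0) xd) _.
rewrite (_ : _ * (saddle_exp n x * (1 - Phi x)) =
  C / Num.sqrt n%:R * (saddle_exp n x * (2 / gd 0 * x * (1 - Phi x)))); last by ring.
apply: ler_wpM2l; first by rewrite divr_ge0 ?ltW.
by apply: ler_wpM2l; [exact: ltW | exact: expR_half_sqr_le].
Qed.

Let Bd := `|Lam 0| + B * dl.

Let Lam_bound z : 0 <= z <= dl -> `|Lam z| <= Bd.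
Proof.
move=> zd; rewrite -(subrK (Lam 0) (Lam z)); apply: le_trans (ler_normD _ _) _.
rewrite /Bd addrC lerD2l; apply: le_trans (Lam_lip zd _) _; first by rewrite lexx ltW.
by move: zd => /andP[z0 zd]; rewrite subr0 ger0_norm// ler_wpM2l// ltW.
Qed.

Let Bd0 : 0 <= Bd. Proof. by rewrite addr_ge0// mulr_ge0 ?ltW. Qed.

Let exponentE n (x : R) : (0 < n)%N ->
  n%:R * (x / Num.sqrt n%:R) ^+ 3 = x ^+ 3 / Num.sqrt n%:R.
Proof. by move=> n0; rewrite {1}sqE; field; rewrite gt_eqF// sq0. Qed.

Lemma saddle_exp_bound (M : R) n (x : R) : (0 < n)%N -> 0 <= x -> x <= dl * Num.sqrt n%:R ->
  x ^+ 3 <= M * Num.sqrt n%:R -> saddle_exp n x <= expR (3 * (M * Bd)).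
Proof.
move=> n0 x0 xd xM; have r0 := sq0 n0.
rewrite /saddle_exp mulrA exponentE// ler_expR.
have zd : 0 <= x / Num.sqrt n%:R <= dl by rewrite divr_ge0 ?(ltW r0)//= ler_pdivrMr.
have u0 : 0 <= x ^+ 3 / Num.sqrt n%:R by rewrite divr_ge0 ?exprn_ge0 ?(ltW r0).
have uM : x ^+ 3 / Num.sqrt n%:R <= M by rewrite ler_pdivrMr.
apply: (@le_trans _ _ (M * Bd)); last first.
  by rewrite ler_peMl// ?ler1n// mulr_ge0// (le_trans u0 uM).
apply: le_trans (ler_norm _) _; rewrite normrM (ger0_norm u0) ler_pM//.
exact: Lam_bound.
Qed.

(** Replacing [Lam (x / sqrt n)] by [Lam 0] moves the exponent by at most [B] times the last two
    factors; both exponents are bounded by [M * Bd], where the exponential is Lipschitz by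
    [expR_lip]. *)
Lemma saddle_exp_cubic (M : R) n (x : R) : (0 < n)%N -> 0 <= x -> x <= dl * Num.sqrt n%:R ->
  x ^+ 3 <= M * Num.sqrt n%:R ->
  `|saddle_exp n x - expR (Lam 0 * x ^+ 3 / Num.sqrt n%:R)| <=
  expR (3 * (M * Bd)) * B * (x ^+ 3 / Num.sqrt n%:R) * (x / Num.sqrt n%:R).
Proof.
move=> n0 x0 xd xM; have r0 := sq0 n0.
rewrite /saddle_exp mulrA exponentE// -[Lam 0 * _ / _]mulrA [Lam 0 * _]mulrC.
have zd : 0 <= x / Num.sqrt n%:R <= dl by rewrite divr_ge0 ?(ltW r0)//= ler_pdivrMr.
have u0 : 0 <= x ^+ 3 / Num.sqrt n%:R by rewrite divr_ge0 ?exprn_ge0 ?(ltW r0).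
have uM : x ^+ 3 / Num.sqrt n%:R <= M by rewrite ler_pdivrMr.
have dd : 0 <= (0 : R) <= dl by rewrite lexx ltW.
apply: le_trans (@expR_lip (M * Bd) _ _ _ _) _.
- by rewrite normrM (ger0_norm u0) ler_pM//; exact: Lam_bound.
- by rewrite normrM (ger0_norm u0) ler_pM//; exact: Lam_bound.
rewrite -mulrBr normrM (ger0_norm u0).
rewrite (_ : expR _ * B * _ * _ =
  expR (3 * (M * Bd)) * (x ^+ 3 / Num.sqrt n%:R * (B * (x / Num.sqrt n%:R)))); last by ring.
apply: ler_wpM2l; first exact: expR_ge0.
apply: ler_wpM2l => //; apply: le_trans (Lam_lip zd dd) _.
by case/andP: zd => z0 _; rewrite subr0 (ger0_norm z0).
Qed.

Lemma near_le_sqrt (t : R) : \forall n \near \oo, t <= Num.sqrt n%:R.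
Proof.
have : \forall n \near \oo, t ^+ 2 <= n%:R :> R by exact: nbhs_infty_ger.
apply: filterS => n tn; apply: le_trans (ler_norm t) _.
by rewrite -sqrtr_sqr ler_wsqrtr.
Qed.

Lemma cubic_of_bigO (x : nat -> R) : (forall n, (0 < n)%N -> 0 <= x n) ->
  x =O_\oo (fun n => n%:R `^ (6%:R^-1) : R) ->
  exists2 M : R, 0 < M & \forall n \near \oo, x n ^+ 3 <= M * Num.sqrt n%:R.
Proof.
move=> x0 /eqO_exP[k k0 H]; exists (k ^+ 3); first by rewrite exprn_gt0.
near=> n; have n0 : (0 < n)%N by near: n; exists 1%N.
have : `|x n| <= k * `|n%:R `^ (6%:R^-1) : R| by near: n.
rewrite (ger0_norm (x0 n n0)) (ger0_norm (powR_ge0 _ _)) => xk.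
have -> : Num.sqrt n%:R = (n%:R `^ (6%:R^-1)) ^+ 3 :> R.
  rewrite -powR_mulrn ?powR_ge0// -powRrM -powR12_sqrt//; congr (_ `^ _).
  by field.
rewrite -exprMn lerXn2r ?nnegrE ?x0// mulr_ge0 ?powR_ge0// ltW.
Unshelve. all: by end_near. Qed.

(** If [x] exceeded [e * r] with [r] the root of [n], its cube would exceed [M * r] as soon as
    [r >= 1 + |M| / e ^+ 3]. This brings [x] into the range of [core]. *)
Lemma sqrt_dominates_cubic (x : nat -> R) M e : 0 < e ->
  (forall n, (0 < n)%N -> 0 <= x n) ->
  (\forall n \near \oo, x n ^+ 3 <= M * Num.sqrt n%:R) ->
  \forall n \near \oo, x n <= e * Num.sqrt n%:R.
Proof.
move=> e0 x0 H; near=> n.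
have n0 : (0 < n)%N by near: n; exists 1%N.
have xM : x n ^+ 3 <= M * Num.sqrt n%:R by near: n.
have r1 : 1 + `|M| / e ^+ 3 <= Num.sqrt n%:R by near: n; exact: near_le_sqrt.
have r0 := sq0 n0; move: (Num.sqrt n%:R) xM r1 r0 => r xM r1 r0.
have e30 : 0 < e ^+ 3 by rewrite exprn_gt0.
have Me0 : 0 <= `|M| / e ^+ 3 by rewrite divr_ge0// ltW.
rewrite leNgt; apply/negP => xe.
have : (e * r) ^+ 3 < M * r.
  apply: lt_le_trans xM; rewrite ltrXn2r// ?nnegrE ?mulr_ge0 ?x0// ltW//.
rewrite exprMn (exprSr r) mulrA ltr_pM2r// ltNge => /negP; apply.
have r11 : 1 <= r by apply: le_trans r1; rewrite lerDl.
apply: le_trans (ler_norm M) _; rewrite mulrC -ler_pdivrMr//.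
apply: (@le_trans _ _ r); first by apply: le_trans r1; rewrite lerDr.
by rewrite expr2 ler_peMl// (le_trans _ r11).
Unshelve. all: by end_near. Qed.

Lemma near_le_littleo (x : nat -> R) e : 0 < e ->
  x =o_\oo (fun n => Num.sqrt n%:R : R) -> \forall n \near \oo, x n <= e * Num.sqrt n%:R.
Proof.
move=> e0 /eqoP/(_ e e0); apply: filterS => n /le_trans; rewrite ger0_norm ?sqrtr_ge0// => h.
exact: le_trans (ler_norm _) (h _ (lexx _)).
Qed.

Lemma tail_ratio_large (x : nat -> R) : (forall n, (0 < n)%N -> 1 < x n) ->
  x =o_\oo (fun n => Num.sqrt n%:R : R) ->
  exists r : nat -> R, r =O_\oo (fun n => x n / Num.sqrt n%:R) /\
  forall n, (0 < n)%N -> Q n (x n) / (1 - Phi (x n)) =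
    expR (x n ^+ 3 / Num.sqrt n%:R * Lam (x n / Num.sqrt n%:R)) * (1 + r n).
Proof.
(* Defining the remainder through the exact quotient gives the identity for every positive [n]; only
   its size is asymptotic. *)
move=> x1 xo; exists (fun n => ratio n (x n) - 1); split; last first.
  move=> n n0; rewrite (_ : 1 + (ratio n (x n) - 1) = ratio n (x n)); last by rewrite addrC subrK.
  by rewrite ratioE -exponentE// -mulrA.
apply/eqO_exP; exists (2 * C / gd 0).
  by rewrite divr_gt0 ?gd_gt0// mulr_gt0.
near=> n; have n0 : (0 < n)%N by near: n; exists 1%N.
have xd : x n <= dl * Num.sqrt n%:R by near: n; exact: near_le_littleo.
apply: le_trans (ratio_bound n0 (ltW (x1 n n0)) xd) _.
rewrite ler_wpM2l ?ler_norm// divr_ge0 ?gd_ge0// mulr_ge0// ltW.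
Unshelve. all: by end_near. Qed.

Lemma tail_ratio_cubic (x : nat -> R) : (forall n, (0 < n)%N -> 1 < x n) ->
  x =O_\oo (fun n => n%:R `^ (6%:R^-1) : R) ->
  (fun n => Q n (x n) / (1 - Phi (x n))) =
  (fun n => expR (Lam 0 * x n ^+ 3 / Num.sqrt n%:R)) +O_\oo (fun n => x n / Num.sqrt n%:R).
Proof.
move=> x1 xO; have x0 n (n0 : (0 < n)%N) : 0 <= x n by rewrite ltW// (lt_trans ltr01)// x1.
have [M M0 xM] := cubic_of_bigO x0 xO.
apply/eqaddOP/bigO_exP.
exists (expR (3 * (M * Bd)) * B * M + expR (3 * (M * Bd)) * (2 * C / gd 0)).
  have CM := mulr_gt0 (mulr_gt0 (expR_gt0 (3 * (M * Bd))) B0) M0.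
  have CQ := mulr_gt0 (expR_gt0 (3 * (M * Bd))) (divr_gt0 (mulr_gt0 (ltr0n R 2) C0) (gd_gt0 0)).
  exact: addr_gt0.
near=> n; have n0 : (0 < n)%N by near: n; exists 1%N.
have xd : x n <= dl * Num.sqrt n%:R by near: n; exact: (sqrt_dominates_cubic dl0 x0 xM).
have xMn : x n ^+ 3 <= M * Num.sqrt n%:R by near: n.
have r0 := sq0 n0.
have P0 : 0 < 1 - Phi (x n) by rewrite subr_gt0 Phi_lt1.
have z0 : 0 <= x n / Num.sqrt n%:R by rewrite divr_ge0 ?x0 ?ltW.
have E0 : 0 < saddle_exp n (x n) by exact: expR_gt0.
rewrite /= !fctE (ger0_norm z0).
have -> : Q n (x n) / (1 - Phi (x n)) = saddle_exp n (x n) + saddle_exp n (x n) * (ratio n (x n) - 1).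
  by rewrite ratioE; ring.
rewrite addrAC; apply: le_trans (ler_normD _ _) _; rewrite [leRHS]mulrDl lerD//.
  apply: le_trans (saddle_exp_cubic n0 (x0 n n0) xd xMn) _.
  apply: ler_wpM2r => //; apply: ler_wpM2l; last by rewrite ler_pdivrMr.
  by rewrite mulr_ge0 ?expR_ge0// ltW.
rewrite normrM (gtr0_norm E0) -(mulrA (expR _)); apply: ler_pM => //; first exact: ltW.
  exact: (saddle_exp_bound n0 (x0 n n0) xd xMn).
exact: (ratio_bound n0 (ltW (x1 n n0)) xd).
Unshelve. all: by end_near. Qed.

(** As [x] may be small, [core] is used in its absolute form. The spare factor [x] in
    [saddle_exp_cubic] is absorbed by the upper Mills bound for [x * (1 - Phi x)]. *)
Lemma tail_cubic (x : nat -> R) : (forall n, (0 < n)%N -> 0 < x n) ->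
  x =O_\oo (fun n => n%:R `^ (6%:R^-1) : R) ->
  (fun n => Q n (x n)) =
  (fun n => (1 - Phi (x n)) * expR (Lam 0 * x n ^+ 3 / Num.sqrt n%:R))
  +O_\oo (fun n => (Num.sqrt n%:R)^-1 * expR (- (x n ^+ 2 / 2))).
Proof.
move=> x1 xO; have x0 n (n0 : (0 < n)%N) : 0 <= x n by rewrite ltW// x1.
have [M M0 xM] := cubic_of_bigO x0 xO.
apply/eqaddOP/bigO_exP.
exists (C * expR (3 * (M * Bd)) + expR (3 * (M * Bd)) * B * M).
  have CM := mulr_gt0 (mulr_gt0 (expR_gt0 (3 * (M * Bd))) B0) M0.
  have CQ := mulr_gt0 C0 (expR_gt0 (3 * (M * Bd))).
  exact: addr_gt0.
near=> n; have n0 : (0 < n)%N by near: n; exists 1%N.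
have xd : x n <= dl * Num.sqrt n%:R by near: n; exact: (sqrt_dominates_cubic dl0 x0 xM).
have xMn : x n ^+ 3 <= M * Num.sqrt n%:R by near: n.
have r0 := sq0 n0.
have P0 : 0 < 1 - Phi (x n) by rewrite subr_gt0 Phi_lt1.
have E0 : 0 < saddle_exp n (x n) by exact: expR_gt0.
have g0 : 0 <= (Num.sqrt n%:R)^-1 * expR (- (x n ^+ 2 / 2)).
  by rewrite mulr_ge0 ?expR_ge0// invr_ge0 ltW.
rewrite /= !fctE (ger0_norm g0).
rewrite -(subrK (saddle_exp n (x n) * (1 - Phi (x n))) (Q n (x n))) -addrA.
apply: le_trans (ler_normD _ _) _; rewrite [leRHS]mulrDl lerD//.
  apply: le_trans (core n0 (x0 n n0) xd) _.
  rewrite (_ : _ * (_ * _) =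
    C * saddle_exp n (x n) * ((Num.sqrt n%:R)^-1 * expR (- (x n ^+ 2 / 2)))); last by ring.
  apply: ler_wpM2r => //; apply: ler_wpM2l; first exact: ltW.
  exact: (saddle_exp_bound n0 (x0 n n0) xd xMn).
rewrite [_ * expR _]mulrC -mulrBl normrM (gtr0_norm P0).
apply: le_trans (ler_wpM2r (ltW P0) (saddle_exp_cubic n0 (x0 n n0) xd xMn)) _.
have Pg : x n * (1 - Phi (x n)) <= expR (- (x n ^+ 2 / 2)).
  apply: le_trans (mills_ub _) _; rewrite gdE ler_piMl ?expR_ge0//; exact: gd_le1.
set c := expR (3 * _) * B; have c0 : 0 <= c by rewrite mulr_ge0 ?expR_ge0// ltW.
rewrite (_ : _ * (1 - Phi (x n)) =
  c * (x n ^+ 3 / Num.sqrt n%:R) * ((Num.sqrt n%:R)^-1 * (x n * (1 - Phi (x n))))); last by ring.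
apply: ler_pM.
- by rewrite mulr_ge0// divr_ge0 ?exprn_ge0 ?x0// ltW.
- by rewrite mulr_ge0 ?invr_ge0 ?(ltW r0)// mulr_ge0 ?x0// ltW.
- by apply: ler_wpM2l => //; rewrite ler_pdivrMr.
- by apply: ler_wpM2l Pg; rewrite invr_ge0 ltW.
Unshelve. all: by end_near. Qed.

Lemma ratio_cvg1 (x : nat -> R) : (\forall n \near \oo, 1 <= x n) ->
  (forall e, 0 < e -> \forall n \near \oo, x n <= e * Num.sqrt n%:R) ->
  ratio n (x n) @[n --> \oo] --> (1 : R).
Proof.
move=> x1 xo; apply/cvgrPdist_le => e e0.
have K0 : 0 < 2 * C / gd 0 by rewrite divr_gt0 ?gd_gt0// mulr_gt0.
near=> n; have n0 : (0 < n)%N by near: n; exists 1%N.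
have r0 := sq0 n0.
rewrite distrC; apply: le_trans (ratio_bound n0 _ _) _; first by near: n.
  by near: n; exact: xo.
rewrite mulrC -ler_pdivlMr// ler_pdivrMr//.
by near: n; apply: xo; rewrite divr_gt0.
Unshelve. all: by end_near. Qed.

(** With [z] and [w] the two arguments over the root of [n], the shift gives [n * (w - z) * z = a]
    exactly. The increment of [z ^+ 3 * Lam z] is of order [(w - z) * z ^+ 2], hence [a * z] after
    multiplication by [n]. *)
Lemma saddle_exp_shift (a : R) n (x y : R) : 0 <= a -> (0 < n)%N -> 1 <= x -> y = x + a / x ->
  y <= 2 * x -> y <= dl * Num.sqrt n%:R ->
  `|n%:R * ((y / Num.sqrt n%:R) ^+ 3 * Lam (y / Num.sqrt n%:R)) -
    n%:R * ((x / Num.sqrt n%:R) ^+ 3 * Lam (x / Num.sqrt n%:R))| <=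
  12 * a * (Bd + B * dl) * (x / Num.sqrt n%:R).
Proof.
move=> a0 n0 x1 yE y2 yd; have x0 : 0 < x by apply: lt_le_trans x1.
have r0 := sq0 n0; have rn := sqE n; move: (Num.sqrt n%:R) r0 rn yd => r r0 -> yd.
have xy : x <= y by rewrite yE lerDl divr_ge0// ltW.
set z := x / r; set w := y / r.
have z0 : 0 <= z by rewrite divr_ge0// ltW.
have zw : z <= w by rewrite ler_wpM2r// invr_ge0 ltW.
have wd : w <= dl by rewrite ler_pdivrMr.
have w2 : w <= 2 * z by rewrite /z /w mulrA ler_wpM2r// invr_ge0 ltW.
have zI : 0 <= z <= dl by rewrite z0 (le_trans zw).
have wI : 0 <= w <= dl by rewrite (le_trans z0 zw).
have wzE : r ^+ 2 * ((w - z) * z) = a.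
  by rewrite /w /z yE; field; rewrite !gt_eqF.
have wz0 : 0 <= w - z by rewrite subr_ge0.
clearbody w z.
have bound : `|w ^+ 3 * Lam w - z ^+ 3 * Lam z| <= (w - z) * (12 * z ^+ 2) * (Bd + B * dl).
  have -> : w ^+ 3 * Lam w - z ^+ 3 * Lam z =
      (w ^+ 3 - z ^+ 3) * Lam w + z ^+ 3 * (Lam w - Lam z) by ring.
  have c1 : w ^+ 3 - z ^+ 3 = (w - z) * (w ^+ 2 + w * z + z ^+ 2) by ring.
  have c2 : w ^+ 2 + w * z + z ^+ 2 <= 12 * z ^+ 2.
    have h1 : w ^+ 2 <= (2 * z) ^+ 2 by rewrite lerXn2r// nnegrE ?(le_trans z0 zw)// mulr_ge0.
    have h2 : w * z <= 2 * z * z by rewrite ler_wpM2r.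
    have h3 : 0 <= z ^+ 2 by rewrite exprn_ge0.
    rewrite exprMn in h1; rewrite -mulrA -expr2 in h2; lra.
  apply: le_trans (ler_normD _ _) _; rewrite (mulrDr ((w - z) * _)) lerD//.
    rewrite normrM; apply: ler_pM => //; last exact: Lam_bound.
    rewrite c1 ger0_norm; last by rewrite mulr_ge0// !addr_ge0 ?mulr_ge0 ?exprn_ge0// (le_trans z0).
    exact: ler_wpM2l.
  rewrite normrM ger0_norm ?exprn_ge0//.
  apply: le_trans (ler_wpM2l (exprn_ge0 3 z0) (Lam_lip wI zI)) _.
  rewrite (ger0_norm wz0).
  rewrite (_ : z ^+ 3 * (B * (w - z)) = (w - z) * z ^+ 2 * (B * z)); last by ring.
  case/andP: zI => _ zd.
  apply: ler_pM => //.
  - by rewrite mulr_ge0// exprn_ge0.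
  - by rewrite mulr_ge0// ltW.
  - by rewrite ler_wpM2l// ler_peMl ?exprn_ge0// ler1n.
  - by rewrite ler_wpM2l// ltW.
rewrite -mulrBr normrM ger0_norm ?exprn_ge0 ?(ltW r0)//.
apply: le_trans (ler_wpM2l (exprn_ge0 2 (ltW r0)) bound) _.
rewrite le_eqVlt; apply/orP; left; apply/eqP; rewrite -wzE; ring.
Qed.

End tail_estimates.

Section tail_shift.
Context {R : realType}.

Lemma millsR_lb (x : R) : 1 <= x -> gd 0 / (2 * x) <= millsR x.
Proof.
move=> x1; have x0 : 0 < x by apply: lt_le_trans x1.
rewrite -(ler_pM2l (expR_gt0 (- (x ^+ 2 / 2)))) millsRE.
have := expR_half_sqr_le x1; have g0 := gd_gt0 (0 : R).
have -> : 2 / gd 0 * x * (1 - Phi x) = (1 - Phi x) * (2 * x) / gd 0 by ring.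
by rewrite ler_pdivlMr// => h; rewrite mulrA ler_pdivrMr ?mulr_gt0.
Qed.

(** Written with Mills ratios, the quotient has the exponential factor
    [expR (- (a + a ^+ 2 / (2 * x ^+ 2)))], and the quotient of the Mills ratios tends to 1 by
    [millsR_lip] and the lower bound of order [x^-1]. *)
Lemma Phi_shift_ratio (a : R) (x : nat -> R) : 0 < a -> x n @[n --> \oo] --> +oo ->
  (1 - Phi (x n + a / x n)) / (1 - Phi (x n)) @[n --> \oo] --> expR (- a).
Proof.
move=> a0 xy.
have x1 : \forall n \near \oo, 1 <= x n by move/cvgryPge : xy; exact.
have u0 : (x n)^-1 @[n --> \oo] --> (0 : R).
  have x0 : \forall n \near \oo, 0 < x n by apply: filterS x1 => n; exact: lt_le_trans.
  exact: (gtr0_cvgV0 x0).2 xy.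
have e1 : expR (- (a + a ^+ 2 / 2 * (x n)^-1 ^+ 2)) @[n --> \oo] --> expR (- (a + a ^+ 2 / 2 * 0 ^+ 2)).
  apply: continuous_cvg; first exact: continuous_expR.
  apply: cvgN; apply: cvgD; first exact: cvg_cst.
  by apply: cvgMl_tmp; exact: cvg_expr.
have m1 : millsR (x n + a / x n) / millsR (x n) @[n --> \oo] --> (1 : R).
  apply/cvgrPdist_le => e e0.
  have K0 : 0 < 2 * a / gd 0 by rewrite divr_gt0 ?gd_gt0// mulr_gt0.
  near=> n; have xn1 : 1 <= x n by near: n.
  have xn0 : 0 < x n := lt_le_trans ltr01 xn1.
  have M0 : 0 < millsR (x n).
    by apply: lt_le_trans (millsR_lb xn1); rewrite divr_gt0 ?gd_gt0// mulr_gt0.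
  have -> : 1 - millsR (x n + a / x n) / millsR (x n) =
      (millsR (x n) - millsR (x n + a / x n)) / millsR (x n).
    by rewrite mulrBl divff// gt_eqF.
  rewrite normrM normfV (gtr0_norm M0) ler_pdivrMr//.
  have ax : 0 <= a / x n by rewrite divr_ge0 ?ltW.
  have xd : x n <= x n + a / x n by rewrite lerDl.
  apply: le_trans (millsR_lip (ltW xn0) (lexx _) xd) _.
  rewrite opprD addrA subrr add0r normrN (ger0_norm ax).
  have eu : 2 * a / gd 0 * (x n)^-1 <= e.
    rewrite mulrC -ler_pdivlMr//; near: n.
    have h : \forall n \near \oo, `|(x n)^-1| <= e / (2 * a / gd 0).
      by apply: (cvgr0_norm_le _ u0); rewrite divr_gt0.
    by apply: filterS h => n; exact: le_trans (ler_norm _).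
  apply: le_trans (ler_pM _ _ eu (millsR_lb xn1)).
  - have -> : 2 * a / gd 0 / x n * (gd 0 / (2 * x n)) = a / x n * (x n)^-1.
      by field; rewrite !gt_eqF// gd_gt0.
    apply: ler_wpM2l => //; rewrite lef_pV2 ?posrE ?ltr_pwDl ?sqr_ge0//.
    by apply: (@le_trans _ _ (x n ^+ 2)); rewrite ?lerDr// expr2 ler_peMl// ltW.
  - by rewrite mulr_ge0 ?(ltW K0)// invr_ge0 ltW.
  - by rewrite divr_ge0 ?gd_ge0// mulr_ge0// ltW.
have em : expR (- (a + a ^+ 2 / 2 * (x n)^-1 ^+ 2)) * (millsR (x n + a / x n) / millsR (x n))
    @[n --> \oo] --> expR (- (a + a ^+ 2 / 2 * 0 ^+ 2)) * 1 by exact: cvgM.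
move: em; rewrite expr0n/= mulr0 addr0 mulr1; apply: cvg_trans; apply: near_eq_cvg; near=> n.
have xn1 : 1 <= x n by near: n.
have xn0 : 0 < x n := lt_le_trans ltr01 xn1.
rewrite -(millsRE (x n + _)) -(millsRE (x n)) -[RHS]mulf_div.
congr (_ * _); rewrite -expRN -expRD; congr expR; field.
by rewrite gt_eqF.
Unshelve. all: by end_near. Qed.

End tail_shift.

Section tail_shift_ratio.
Context {R : realType} (Q : nat -> R -> R) (Lam : R -> R) (C dl B : R).
Hypotheses (C0 : 0 < C) (dl0 : 0 < dl) (B0 : 0 < B).
Hypothesis core : forall n x, (0 < n)%N -> 0 <= x -> x <= dl * Num.sqrt n%:R ->
  `|Q n x - saddle_exp Lam n x * (1 - Phi x)| <=
  C / Num.sqrt n%:R * (saddle_exp Lam n x * expR (- (x ^+ 2 / 2))).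
Hypothesis Lam_lip : forall z w, 0 <= z <= dl -> 0 <= w <= dl ->
  `|Lam z - Lam w| <= B * `|z - w|.

(** The quotient of tails is the product of three factors: relative errors tending to 1, the
    exponential of an exponent difference tending to 0, and the normal quotient. The first also
    shows that [Q n (x n)] is eventually nonzero. *)
Lemma tail_shift_ratio (a : R) (x : nat -> R) : 0 < a -> x n @[n --> \oo] --> +oo ->
  x =o_\oo (fun n => Num.sqrt n%:R : R) ->
  (\forall n \near \oo, Q n (x n) != 0) /\
  Q n (x n + a / x n) / Q n (x n) @[n --> \oo] --> expR (- a).
Proof.
move=> a0 xy xo.
pose y n := x n + a / x n.
have x1 : \forall n \near \oo, 1 <= x n by move/cvgryPge : xy; exact.
have xa : \forall n \near \oo, a <= x n by move/cvgryPge : xy; exact.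
have y2 : \forall n \near \oo, x n <= y n <= 2 * x n.
  near=> n; have xn1 : 1 <= x n by near: n.
  have xn0 : 0 < x n := lt_le_trans ltr01 xn1.
  have xna : a <= x n by near: n.
  have ax : 0 <= a / x n by rewrite divr_ge0 ?ltW.
  have ax1 : a / x n <= 1 by rewrite ler_pdivrMr// mul1r.
  by rewrite /y; apply/andP; split; lra.
have y1 : \forall n \near \oo, 1 <= y n.
  near=> n; have /andP[xyn _] : x n <= y n <= 2 * x n by near: n.
  by apply: le_trans xyn; near: n.
have xe (e : R) : 0 < e -> \forall n \near \oo, x n <= e * Num.sqrt n%:R.
  by move=> e0; exact: near_le_littleo.
have ye (e : R) : 0 < e -> \forall n \near \oo, y n <= e * Num.sqrt n%:R.
  move=> e0; near=> n; have /andP[_ yn] : x n <= y n <= 2 * x n by near: n.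
  apply: le_trans yn _; rewrite -ler_pdivlMl// mulrA.
  by near: n; apply: xe; rewrite mulr_gt0.
have rx := ratio_cvg1 C0 dl0 core x1 xe.
have ry := ratio_cvg1 C0 dl0 core y1 ye.
have Qx0 : \forall n \near \oo, Q n (x n) != 0.
  have : \forall n \near \oo, 0 < Q n (x n) / (saddle_exp Lam n (x n) * (1 - Phi (x n))).
    by move/cvgr_gt : rx; apply.
  by apply: filterS => n; apply: contraTneq => ->; rewrite mul0r ltxx.
split => //.
have Px := Phi_shift_ratio a0 xy.
have Ex : expR (n%:R * ((y n / Num.sqrt n%:R) ^+ 3 * Lam (y n / Num.sqrt n%:R)) -
    n%:R * ((x n / Num.sqrt n%:R) ^+ 3 * Lam (x n / Num.sqrt n%:R))) @[n --> \oo] --> expR 0.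
  apply: continuous_cvg; first exact: continuous_expR.
  apply/cvgr0Pnorm_le => e e0.
  have K0 : 0 < 12 * a * (`|Lam 0| + B * dl + B * dl).
    by rewrite !mulr_gt0// addr_gt0 ?mulr_gt0// ltr_wpDl ?mulr_gt0.
  near=> n; have n0 : (0 < n)%N by near: n; exists 1%N.
  have r0 : 0 < Num.sqrt n%:R :> R by rewrite sqrtr_gt0 ltr0n.
  have /andP[_ yn] : x n <= y n <= 2 * x n by near: n.
  have xn1 : 1 <= x n by near: n.
  have yd : y n <= dl * Num.sqrt n%:R by near: n; exact: ye.
  apply: le_trans (saddle_exp_shift dl0 B0 Lam_lip (ltW a0) n0 xn1 _ yn yd) _ => //.
  rewrite mulrC -ler_pdivlMr// ler_pdivrMr//.
  by near: n; apply: xe; rewrite divr_gt0.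
have E1 : Q n (y n) / (saddle_exp Lam n (y n) * (1 - Phi (y n))) /
   (Q n (x n) / (saddle_exp Lam n (x n) * (1 - Phi (x n)))) @[n --> \oo] --> 1 / (1 : R).
  by apply: cvgM ry _; apply: cvgV => //; rewrite oner_eq0.
have -> : expR (- a) = 1 / 1 * expR 0 * expR (- a) by rewrite divr1 expR0 !mul1r.
apply: cvg_trans (cvgM (cvgM E1 Ex) Px); apply: near_eq_cvg; near=> n.
have Qn : Q n (x n) != 0 by near: n.
rewrite /= expRD expRN -/(saddle_exp Lam n (y n)) -/(saddle_exp Lam n (x n)) -/(y n).
have P1 : 1 - Phi (x n) != 0 by rewrite gt_eqF// subr_gt0 Phi_lt1.
have P2 : 1 - Phi (y n) != 0 by rewrite gt_eqF// subr_gt0 Phi_lt1.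
have E01 : saddle_exp Lam n (x n) != 0 by rewrite gt_eqF// expR_gt0.
have E02 : saddle_exp Lam n (y n) != 0 by rewrite gt_eqF// expR_gt0.
move: (saddle_exp Lam n (x n)) (saddle_exp Lam n (y n)) E01 E02 => e1 e2 E01 E02.
move: (1 - Phi (x n)) (1 - Phi (y n)) P1 P2 => p1 p2 P1 P2.
by field; rewrite E01 E02 P1 P2 Qn.
Unshelve. all: by end_near. Qed.

End tail_shift_ratio.

Section power_series_lipschitz.
Context {R : realType}.
Implicit Types (c : nat -> R) (f : R -> R).

Lemma power_series_at0E c f : power_series_at0 c f -> f 0 = c 0%N.
Proof. by move=> /power_series_shift[g _ /nbhs_singleton ->]; rewrite mul0r addr0. Qed.

(** The derivative is again a power series, hence bounded near 0, and the mean value theorem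
    applies. *)
Lemma power_series_lipschitz c f : power_series_at0 c f ->
  exists2 B, 0 < B & exists2 e, 0 < e &
  forall z w, `|z| <= e -> `|w| <= e -> `|f z - f w| <= B * `|z - w|.
Proof.
move=> pf; have [pd dn] := power_series_derive pf.
have [B B0 Bn] := power_series_bounded pd.
have [e1 e10 H1] := near0_elim dn.
have [e2 e20 H2] := near0_elim Bn.
exists B => //; exists (Num.min e1 e2); first by rewrite lt_min e10.
have der (z : R) : `|z| <= e1 -> is_derive z 1 f (derive1 f z).
  by move=> /H1 dz; rewrite derive1E; exact: derivableP.
have key (z w : R) : w <= z -> `|z| <= Num.min e1 e2 -> `|w| <= Num.min e1 e2 ->
    `|f z - f w| <= B * `|z - w|.
  move=> wz; rewrite !le_min => /andP[z1 z2] /andP[w1 w2].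
  have between t e : w <= t <= z -> `|z| <= e -> `|w| <= e -> `|t| <= e.
    by rewrite !ler_norml => /andP[wt tz] /andP[_ ze] /andP[ew _]; apply/andP; split; lra.
  have [t|t|t] := @MVT_segment R f (derive1 f) w z wz.
  - rewrite in_itv/= => /andP[/ltW wt /ltW tz]; apply: der.
    by apply: between z1 w1; rewrite wt.
  - apply: derivable_within_continuous => s; rewrite in_itv/= => sI.
    by apply: H1; exact: between z1 w1.
  - rewrite in_itv/= => tI ->; rewrite normrM; apply: ler_wpM2r => //.
    by apply: H2; exact: between z2 w2.
move=> z w ze we; have [wz|/ltW zw] := leP w z; first exact: key.
by rewrite distrC [`|z - w|]distrC; exact: key.
Qed.

End power_series_lipschitz.

Theorem theorem5 (R : realType) (d : measure_display) (T : measurableType d)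
    (P : probability T R) (Z : nat -> {RV P >-> R})
    (V : cumulativeBounded (0 : R) (1 : R)) (sigma : R)
    (A : R)
    (beta : R) (U1 U2 : cumulativeBounded (0 : R) (1 : R))
    (gamma : nat -> R) (hz lambda : R -> R) (c : nat -> R) :
  mutually_independent Z ->
  (forall n y, cdf (Z n) y = (V y)%:E) ->
  0 < sigma ->
  (forall n, ('E_P[Z n] = 0)%E) ->
  (forall n, ('E_P[fun w => (Z n w ^+ 2)%R] = (sigma ^+ 2)%:E)%E) ->
  0 < A -> (forall h : R, `|h| < A -> exp_integrable V h) ->
  cdf_decomposition V beta U1 U2 -> 0 < beta ->
  cumulants V gamma ->
  saddlepoint V sigma hz ->
  cramer_function V sigma hz lambda ->
  power_series_at0 c lambda ->
  let F : nat -> R -> R := normalized_sum_cdf Z sigma in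
  let sqrtn : nat -> R := fun n => Num.sqrt n%:R in
  let n16 : nat -> R := fun n => n%:R `^ (6%:R^-1) in
  [/\ c 0%N = gamma 3%N / (6%:R * sigma ^+ 3) /\
      c 1%N = (sigma ^+ 2 * gamma 4%N - 3%:R * gamma 3%N ^+ 2)
              / (24%:R * sigma ^+ 6),

      (forall x : nat -> R, (forall n, (0 < n)%N -> 1 < x n) ->
        x =o_\oo sqrtn ->
        (exists r : nat -> R, r =O_\oo (fun n => x n / sqrtn n) /\
          forall n, (0 < n)%N ->
            (1 - F n (x n)) / (1 - Phi (x n)) =
            expR (x n ^+ 3 / sqrtn n * lambda (x n / sqrtn n)) * (1 + r n)) /\
        (exists r : nat -> R, r =O_\oo (fun n => x n / sqrtn n) /\
          forall n, (0 < n)%N ->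
            F n (- x n) / Phi (- x n) =
            expR (- (x n ^+ 3 / sqrtn n) * lambda (- (x n / sqrtn n)))
            * (1 + r n))),

      (forall x : nat -> R, (forall n, (0 < n)%N -> 1 < x n) ->
        x =O_\oo n16 ->
        (fun n => (1 - F n (x n)) / (1 - Phi (x n))) =
          (fun n => expR (c 0%N * x n ^+ 3 / sqrtn n))
          +O_\oo (fun n => x n / sqrtn n) /\
        (fun n => F n (- x n) / Phi (- x n)) =
          (fun n => expR (- (c 0%N * x n ^+ 3 / sqrtn n)))
          +O_\oo (fun n => x n / sqrtn n)),

      (forall x : nat -> R, (forall n, (0 < n)%N -> 0 < x n) ->
        x =O_\oo n16 ->
        (fun n => 1 - F n (x n)) =
          (fun n => (1 - Phi (x n)) * expR (c 0%N * x n ^+ 3 / sqrtn n))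
          +O_\oo (fun n => (sqrtn n)^-1 * expR (- (x n ^+ 2 / 2))) /\
        (fun n => F n (- x n)) =
          (fun n => Phi (- x n) * expR (- (c 0%N * x n ^+ 3 / sqrtn n)))
          +O_\oo (fun n => (sqrtn n)^-1 * expR (- (x n ^+ 2 / 2)))) &

      (forall (a : R) (x : nat -> R), 0 < a ->
        x n @[n --> \oo] --> +oo ->
        x =o_\oo sqrtn ->
        (F n (x n + a / x n) - F n (x n)) / (1 - F n (x n))
          @[n --> \oo] --> 1 - expR (- a) /\
        (Phi (x n + a / x n) - Phi (x n)) / (1 - Phi (x n))
          @[n --> \oo] --> 1 - expR (- a))].
Proof.
move=> indep ZV sigma0 EZ EZ2 A0 expV _ _ cum sad cra pow F sqrtn n16.
have EV : Vint V (idfun : measurableTypeR R -> R) = 0.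
  by rewrite (Vint_id_expectation ZV 0%N) EZ.
have EV2 : Vint V (fun y => (idfun : measurableTypeR R -> R) y ^+ 2) = sigma ^+ 2.
  by rewrite (Vint_sqr_expectation ZV 0%N) EZ2.
have [C C0 [dl dl0 approx]] := tail_approx indep ZV A0 expV sigma0 EV EV2 sad cra.
have [B B0 [e e0 lip]] := power_series_lipschitz pow.
have lam0 := power_series_at0E pow.
(* The cube of the sign is the sign, so z^3 lambda(z) at the signed argument is y^3 times
   [Lam lower y] at [y = |z|]. *)
pose Lam (lower : bool) z := (-1) ^+ lower * lambda ((-1) ^+ lower * z).
have Lam0 lower : Lam lower 0 = (-1) ^+ lower * c 0%N by rewrite /Lam mulr0 lam0.
have dl'0 : 0 < Num.min dl e by rewrite lt_min dl0.
have eps1 (lower : bool) : `|(-1) ^+ lower : R| = 1 by rewrite normrX normrN normr1 expr1n.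
have core lower n x : (0 < n)%N -> 0 <= x -> x <= Num.min dl e * Num.sqrt n%:R ->
    `|tail Z sigma lower n x - saddle_exp (Lam lower) n x * (1 - Phi x)| <=
    C / Num.sqrt n%:R * (saddle_exp (Lam lower) n x * expR (- (x ^+ 2 / 2))).
  move=> n0 x0 xd; have xd' : x <= dl * Num.sqrt n%:R.
    by apply: le_trans xd _; rewrite ler_wpM2r ?sqrtr_ge0// ge_min lexx.
  have := approx lower n x n0 x0 xd'; rewrite /saddle_exp /Lam /=.
  set y := x / _; set eps : R := (-1) ^+ lower.
  rewrite (_ : (eps * y) ^+ 3 * lambda (eps * y) = y ^+ 3 * (eps * lambda (eps * y)))//.
  have eps2 : eps ^+ 2 = 1 by rewrite -(real_normK (num_real eps)) eps1 expr1n.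
  by rewrite exprMn exprS eps2 mulr1; ring.
have Lam_lip lower z w : 0 <= z <= Num.min dl e -> 0 <= w <= Num.min dl e ->
    `|Lam lower z - Lam lower w| <= B * `|z - w|.
  rewrite !le_min => /and3P[z0 _ ze] /and3P[w0 _ we].
  rewrite /Lam -mulrBr normrM eps1 mul1r.
  have -> : `|z - w| = `|(-1) ^+ lower * z - (-1) ^+ lower * w|.
    by rewrite -mulrBr normrM eps1 mul1r.
  by apply: lip; rewrite normrM eps1 mul1r ger0_norm.
split.
- have pk := cgf_power_series cum.
  have [pm _] := power_series_derive pk.
  (* The conditions on the coefficients of [cgf V] hold by computation, except at order 2, where
     [cumulant2] is needed. *)
  apply: (cramer_coefficients sigma0 pk pm _ _ _ _ _ pow sad.1 sad.2 cra) => //=.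
  by rewrite (cumulant2 A0 expV sigma0 EV EV2 cum).
- move=> x x1 xo; split.
    have [r [rO rE]] := tail_ratio_large C0 dl'0 (core false) x1 xo.
    exists r; split => // n n0; rewrite [LHS](rE n n0) /Lam expr0 !mul1r//.
  have [r [rO rE]] := tail_ratio_large C0 dl'0 (core true) x1 xo.
  exists r; split => // n n0; rewrite PhiN [LHS](rE n n0) /Lam expr1 !mulN1r.
  by rewrite mulrN mulNr.
- move=> x x1 xO; split.
    have h := tail_ratio_cubic C0 dl'0 B0 (core false) (@Lam_lip false) x1 xO.
    rewrite Lam0 expr0 mul1r in h; exact: h.
  have h := tail_ratio_cubic C0 dl'0 B0 (core true) (@Lam_lip true) x1 xO.
  rewrite Lam0 expr1 mulN1r in h.
  rewrite (_ : (fun n => expR (- (c 0%N * x n ^+ 3 / sqrtn n))) =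
    fun n => expR (- c 0%N * x n ^+ 3 / Num.sqrt n%:R)); last first.
    by apply/funext => n; rewrite !mulNr.
  rewrite (_ : (fun n => F n (- x n) / Phi (- x n)) =
    fun n => tail Z sigma true n (x n) / (1 - Phi (x n))); last first.
    by apply/funext => n; rewrite PhiN.
  exact: h.
- move=> x x1 xO; split.
    have h := tail_cubic C0 dl'0 B0 (core false) (@Lam_lip false) x1 xO.
    rewrite Lam0 expr0 mul1r in h; exact: h.
  have h := tail_cubic C0 dl'0 B0 (core true) (@Lam_lip true) x1 xO.
  rewrite Lam0 expr1 mulN1r in h.
  rewrite (_ : (fun n => Phi (- x n) * expR (- (c 0%N * x n ^+ 3 / sqrtn n))) =
    fun n => (1 - Phi (x n)) * expR (- c 0%N * x n ^+ 3 / Num.sqrt n%:R)); last first.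
    by apply/funext => n; rewrite PhiN !mulNr.
  exact: h.
- move=> a x a0 xy xo.
  have [Q0 Qr] := tail_shift_ratio C0 dl'0 B0 (core false) (@Lam_lip false) a0 xy xo.
  (* Both limits are complements of a quotient of upper tails, with [u] and [v] the distribution
     function at [x] and at the shifted point. *)
  have compl (u v : R) : 1 - u != 0 -> 1 - (1 - v) / (1 - u) = (v - u) / (1 - u).
    by move=> u1; field.
  split.
    apply: cvg_trans (cvgB (cvg_cst (1 : R)) Qr); apply: near_eq_cvg.
    near=> n; have Qn : tail Z sigma false n (x n) != 0 by near: n.
    exact: compl.
  apply: cvg_trans (cvgB (cvg_cst (1 : R)) (Phi_shift_ratio a0 xy)); apply: near_eq_cvg.
  near=> n; have Pn : 1 - Phi (x n) != 0 by rewrite gt_eqF// subr_gt0 Phi_lt1.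
  exact: compl.
Unshelve. all: by end_near. Qed.
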